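(* Let $k$ be an algebraically closed field of characteristic $p>2$, $X$ a smooth projective connected curve of genus $g$ over $k$, and $(Z,\omega)$ a deformation datum on $X$ with singular points $x_1,\dots,x_r$, where $2g-2+r>0$. Take $x_1,\dots,x_r$ as marked points. Let $U\subset X$ be the complement of the supersingular points of $(Z,\omega)$, and let $(\mathcal{E}|_U,\nabla)$, $e_0$ and $\gamma|_U$ be the flat bundle, section and projection on $U$ constructed from $(Z,\omega)$ in the context. (i) The bundle $(\mathcal{E}|_U,\nabla)$ extends to an indigenous bundle $(\mathcal{E},\nabla)$ on $X$. This extension is unique if we require that the section $e_0$ lies in the Hodge filtration $F^1\mathcal{E}$ and that $\gamma|_U$ extends to an epimorphism $\gamma:\mathcal{E}\to\mathcal{O}_X$. Let $(\mathcal{E},\nabla)$ be this extension. (ii) The bundle $(\mathcal{E},\nabla)$ is active, nilpotent, and normalized. (iii) The supersingular points of $(\mathcal{E},\nabla)$ are exactly the supersingular points of $(Z,\omega)$, and the marked points of $(\mathcal{E},\nabla)$ are the singular points of $(Z,\omega)$. (iv) For every $x\in X$ the order of vanishing of the $p$-curvature of $(\mathcal{E},\nabla)$ at $x$ equals the number $n_x$ given by: $n_x=0$ if $x$ is supersingular for $(Z,\omega)$; $n_x=(p-1)\sigma_x$ if $x$ is singular; $n_x=(p-1)(\sigma_x-1)$ otherwise.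
   Context: Deformation data. A deformation datum on $X$ is a pair $(Z,\omega)$, where $Z\to X$ is an at most tamely ramified Galois cover of smooth connected curves with group $H$ and $\omega$ is a nonzero rational section of $\Omega_{Z/k}$ such that $\sigma^*\omega=\chi(\sigma)\omega$ for all $\sigma\in H$, with $\chi:H\hookrightarrow\mathbb{F}_p^\times$ an injective character, and $\omega$ is logarithmic ($\omega=du/u$). For $x\in X$ and $z\in Z$ above $x$ with stabilizer $H_z$: $m_x=|H_z|$, $h_x=\mathrm{ord}_z\omega+1$, $\sigma_x=h_x/m_x\in\frac1{p-1}\mathbb{Z}$; congruences mod $p$ are in $\mathbb{Z}_{(p)}$. The point $x$ is supersingular for $(Z,\omega)$ if $\sigma_x=(p+1)/(p-1)$, and singular if it is not supersingular and $\sigma_x\not\equiv1\pmod p$. Bundles. $\Omega^{\log}_{X/k}=\Omega_{X/k}(\sum_i x_i)$ and $\tau^{\log}_{X/k}$ is its dual. A flat vector bundle is a vector bundle $\mathcal{E}$ on $X$ with a connection $\nabla:\mathcal{E}\to\mathcal{E}\otimes\Omega^{\log}_{X/k}$. The monodromy operator $\mu_i$ at $x_i$ is the endomorphism of the fiber $\mathcal{E}|_{x_i}$ induced by $\nabla(t\,\partial/\partial t)$, $t$ a local parameter at $x_i$. A filtration on a rank two flat bundle is a line subbundle $F^1\mathcal{E}\subset\mathcal{E}$ with $\mathrm{Gr}^1\mathcal{E}=\mathcal{E}/F^1\mathcal{E}$ a line bundle; its Kodaira--Spencer map is the $\mathcal{O}_X$-linear map $F^1\mathcal{E}\to\mathrm{Gr}^1\mathcal{E}\otimes\Omega^{\log}_{X/k}$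 induced by $\nabla$. An indigenous bundle is a rank two flat bundle which has a filtration (called the Hodge filtration; it is unique) whose Kodaira--Spencer map is an isomorphism, and with $\mu_i\neq0$ for all $i$. Let $\mathcal{T}=(\tau^{\log}_{X/k})^{\otimes p}$. The $p$-curvature is the $\mathcal{O}_X$-linear map $\Psi_{\mathcal{E}}:\mathcal{T}\to\mathrm{End}_{\mathcal{O}_X}(\mathcal{E})$, $\Psi_{\mathcal{E}}(D^{\otimes p})=\nabla(D)^p-\nabla(D^p)$. An indigenous bundle is active if $\Psi_{\mathcal{E}}\ne0$, nilpotent if the image of $\Psi_{\mathcal{E}}$ consists of nilpotent endomorphisms, normalized if there is a horizontal surjection $\gamma:\mathcal{E}\to\mathcal{O}_X$ (for an active nilpotent bundle, $\gamma$ is unique up to $k^\times$). For an active, nilpotent, normalized bundle, the canonical section is the unique rational section $e_0$ of $F^1\mathcal{E}$ with $\gamma(e_0)=1$, and the supersingular points of $(\mathcal{E},\nabla)$ are the points where the canonical section, as a section of $F^1\mathcal E$, has a pole. Construction on $U$. Choose a rational function $t$ on $X$ with $dt\ne0$, put $D=\partial/\partial t$, and write $\omega=z\,dt$ with $z^{p-1}=v^{-1}$, $v\in k(X)$. Put $S=\sum_x n_x\,x$ with $n_x$ as in part (iv) of the claim. Let $\mathcal{E}|_U=\mathcal{T}(S)|_U\oplus\mathcal{O}_U\cdot e_0$ with the connection given by $\nabla(D)(D^{\otimes p})=0$, $\nabla(D)(e_0)=v\cdot D^{\otimes p}$ (this does not depend on the choice of $t$), and let $\gamma|_U:\mathcal{E}|_U\to\mathcal{O}_U$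 be the projection onto the second factor (coefficient of $e_0$). *)

(* Defs.v *)
From HB Require Import structures.
From mathcomp Require Import all_boot all_order all_algebra all_fingroup all_field.
From mathcomp Require Import boolp classical_sets functions cardinality.

Set Implicit Arguments.
Unset Strict Implicit.
Unset Printing Implicit Defensive.

Import Order.TTheory GRing.Theory Num.Theory.
Local Open Scope classical_set_scope.
Local Open Scope ring_scope.

(* Throughout, a smooth projective connected curve X over an algebraically
   closed field k is given by its function field F = k(X): X is the set of all
   discrete valuation rings of F/k (the "abstract nonsingular curve" C_F of
   Hartshorne, I.6). The embedding of k in F is the ring morphism [iota].
   Sheaves on X are given by their stalks, as subsets of the generic fibre. *)

Definition function_field (k F : fieldType) (iota : {rmorphism k -> F}) : Prop :=
  exists t : F,
    (forall P : {poly k}, (map_poly iota P).[t] = 0 -> P = 0) /\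
    exists b : seq F, forall f : F, exists P Q : 'I_(size b) -> {poly k},
      (forall j, Q j != 0) /\
      f = \sum_(j < size b)
            (map_poly iota (P j)).[t] / (map_poly iota (Q j)).[t] * b`_j.

(* A point of X, given by its normalized valuation. The value at 0 carries no
   meaning; it is fixed so that a point is determined by its valuation. *)
Record place (k F : fieldType) (iota : {rmorphism k -> F}) := Place {
  ord :> F -> int;
  ord0E : ord 0 = 0;
  ordM : forall f h, f != 0 -> h != 0 -> ord (f * h) = ord f + ord h;
  ordD : forall f h, f != 0 -> h != 0 -> f + h != 0 ->
    Order.min (ord f) (ord h) <= ord (f + h);
  ord_const : forall c, ord (iota c) = 0;
  ord_onto : exists f, ord f = 1 }.

(* k-linear derivations of F, i.e. rational vector fields on X *)
Definition is_derivation (k F : fieldType) (iota : {rmorphism k -> F})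
    (D : F -> F) : Prop :=
  [/\ forall f h, D (f + h) = D f + D h,
      forall f h, D (f * h) = D f * h + f * D h
    & forall c, D (iota c) = 0].

Record der (k F : fieldType) (iota : {rmorphism k -> F}) := Der {
  der_fun :> F -> F;
  derP : is_derivation iota der_fun }.

Section DerModule.
Variables (k F : fieldType) (iota : {rmorphism k -> F}).
Local Notation der := (der iota).

Lemma der_ext (D1 D2 : der) : D1 =1 D2 -> D1 = D2.
Proof.
case: D1 D2 => [d1 h1] [d2 h2] /= /funext e; case: _ / e h2 => h2.
by rewrite (Prop_irrelevance h1 h2).
Qed.

HB.instance Definition _ := gen_eqMixin der.
HB.instance Definition _ := gen_choiceMixin der.

Lemma der0_subproof : is_derivation iota (fun=> 0).
Proof. by split=> // *; rewrite ?addr0 ?mul0r ?mulr0 ?addr0. Qed.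

Lemma derN_subproof (D : der) : is_derivation iota (fun f => - D f).
Proof.
case: (derP D) => dD dM dC; split=> [f h|f h|c].
- by rewrite dD opprD.
- by rewrite dM opprD mulNr mulrN.
- by rewrite dC oppr0.
Qed.

Lemma derD_subproof (D1 D2 : der) : is_derivation iota (fun f => D1 f + D2 f).
Proof.
case: (derP D1) (derP D2) => dD dM dC [eD eM eC]; split=> [f h|f h|c].
- by rewrite dD eD addrACA.
- by rewrite dM eM mulrDl mulrDr addrACA.
- by rewrite dC eC addr0.
Qed.

Lemma derZ_subproof (a : F) (D : der) : is_derivation iota (fun f => a * D f).
Proof.
case: (derP D) => dD dM dC; split=> [f h|f h|c].
- by rewrite dD mulrDr.
- by rewrite dM mulrDr mulrA mulrCA.
- by rewrite dC mulr0.
Qed.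

Definition der0 : der := Der der0_subproof.
Definition derN (D : der) : der := Der (derN_subproof D).
Definition derD (D1 D2 : der) : der := Der (derD_subproof D1 D2).
Definition derZ (a : F) (D : der) : der := Der (derZ_subproof a D).

Fact derDA : associative derD.
Proof. by move=> ? ? ?; apply: der_ext => f /=; rewrite addrA. Qed.
Fact derDC : commutative derD.
Proof. by move=> ? ?; apply: der_ext => f /=; rewrite addrC. Qed.
Fact der0D : left_id der0 derD.
Proof. by move=> ?; apply: der_ext => f /=; rewrite add0r. Qed.
Fact derND : left_inverse der0 derN derD.
Proof. by move=> ?; apply: der_ext => f /=; rewrite addNr. Qed.
HB.instance Definition _ := GRing.isZmodule.Build der derDA derDC der0D derND.

Fact derZA a b D : derZ a (derZ b D) = derZ (a * b) D.
Proof. by apply: der_ext => f /=; rewrite mulrA. Qed.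
Fact derZ1 : left_id 1 derZ.
Proof. by move=> ?; apply: der_ext => f /=; rewrite mul1r. Qed.
Fact derZDr : right_distributive derZ +%R.
Proof. by move=> ? ? ?; apply: der_ext => f /=; rewrite mulrDr. Qed.
Fact derZDl D : {morph derZ^~ D : a b / a + b}.
Proof. by move=> ? ?; apply: der_ext => f /=; rewrite mulrDl. Qed.
HB.instance Definition _ :=
  GRing.Zmodule_isLmodule.Build F der derZA derZ1 derZDr derZDl.

(* In characteristic p the p-th iterate of a derivation is a derivation. *)
Lemma iter_derM (D : der) n f h :
  iter n D (f * h) =
  \sum_(j < n.+1) (iter (n - j) D f * iter j D h) *+ 'C(n, j).
Proof.
case: (derP D) => dD dM _.
have d0 : D 0 = 0 by apply: (addrI (D 0)); rewrite -dD !addr0.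
have dn (a : F) m : D (a *+ m) = D a *+ m.
  by elim: m => [|m IHm]; rewrite ?mulr0n // !mulrS dD IHm.
elim: n => [|n IHn]; first by rewrite big_ord1 /= bin0.
rewrite iterS IHn (big_morph D dD d0).
under eq_bigr => j _ do rewrite dn dM mulrnDl.
rewrite big_split /=.
rewrite [in RHS]big_ord_recl /= bin0 [X in X + _ = _]big_ord_recl /= bin0.
rewrite -addrA subn0; congr (_ + _).
rewrite [X in _ + X]big_ord_recr /= [in RHS]big_ord_recr /= addrA.
rewrite !subnn !binn; congr (_ + _).
rewrite -big_split /=; apply: eq_bigr => j _.
rewrite binS mulrnDr /bump /= add1n subSS; congr (_ *+ _ + _).
rewrite -[in RHS](subnSK (ltn_ord j)) //.
Qed.

Lemma iter_der_subproof (p : nat) (hp : p \in [pchar k]) (D : der) :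
  is_derivation iota (iter p D).
Proof.
case: (derP D) => dD dM dC.
have d0 : D 0 = 0 by apply: (addrI (D 0)); rewrite -dD !addr0.
have p_gt0 : (0 < p)%N by rewrite prime_gt0 // (pcharf_prime hp).
split=> [f h|f h|c].
- by elim: p {hp p_gt0} => //= m ->; rewrite dD.
- have hF : p \in [pchar F] by rewrite (fmorph_pchar iota).
  have p_pr := pcharf_prime hp.
  rewrite iter_derM; case: p p_gt0 hF p_pr {hp} => // m _ hF p_pr.
  rewrite big_ord_recr big_ord_recl /= subnn bin0 binn !mulr1n.
  rewrite big1 ?addr0 // => j _; rewrite -mulr_natr.
  have /dvdnP[q ->] : (m.+1 %| 'C(m.+1, bump 0 j))%N.
    by apply: prime_dvd_bin; rewrite // /bump /= add1n ltnS.
  by rewrite natrM (pcharf0 hF) !mulr0.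
- case: p p_gt0 {hp} => // m _; rewrite iterSr dC.
  by elim: m => //= m ->.
Qed.

Definition der_pow (p : nat) (hp : p \in [pchar k]) (D : der) : der :=
  Der (iter_der_subproof hp D).

End DerModule.

Section Curve.
Variables (k F : fieldType) (iota : {rmorphism k -> F}).
Implicit Types (x : place iota) (D : der iota) (M : set (place iota)).

(* The power m_x^n of the maximal ideal (a fractional ideal if n < 0). *)
Definition max_pow x (n : int) : set F := [set f | f = 0 \/ n <= ord x f].

Definition local_ring x : set F := max_pow x 0.

(* Rational sections of Omega_{X/k}: as F/k is finitely generated, the finite
   dimensional space Omega_{F/k} is the F-dual of the space of derivations.
   The differential [dd f] of f is D |-> D f. *)
Definition rat_diff := {linear der iota -> F^o}.

Definition dd (f : F) : der iota -> F := fun D => D f.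

(* The stalk m_x^n Omega_{X/k,x}; the stalk at x of Omega_{X/k} is the span over
   the local ring of the dh, for h in the local ring. *)
Definition diff_stalk x (n : int) : set rat_diff :=
  [set w | exists (m : nat) (a h : 'I_m -> F),
     [/\ forall j, max_pow x n (a j), forall j, local_ring x (h j)
       & forall D, w D = \sum_(j < m) a j * dd (h j) D]].

Definition ord_diff x (w : rat_diff) : int :=
  xget 0 [set n | diff_stalk x n w /\ ~ diff_stalk x (n + 1) w].

(* g is the dimension of the space of global regular differentials. *)
Definition has_genus (g : nat) : Prop :=
  exists b : 'I_g -> rat_diff,
    (forall j x, diff_stalk x 0 (b j)) /\
    forall w : rat_diff, (forall x, diff_stalk x 0 w) ->
      exists! c : 'rV[k]_g, forall D, w D = \sum_(j < g) iota (c 0 j) * b j D.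

(* Stalks of Omega^log and of its dual tau^log; M is the set of marked points *)
Definition omega_log M x : set rat_diff :=
  diff_stalk x (if `[< M x >] then -1 else 0).

Definition tau_log M x : set (der iota) :=
  [set D | forall w, omega_log M x w -> local_ring x (w D)].

(* Vector bundles of rank n, with generic fibre F^n *)

Definition lattice n x (B : 'M[F]_n) : set 'rV[F]_n :=
  [set s | exists c : 'rV[F]_n,
     (forall j, local_ring x (c 0 j)) /\ s = c *m B].

(* Families of lattices almost all equal to the standard one are the vector
   bundles on X. *)
Record vbundle (n : nat) := VBundle {
  stalk :> place iota -> set 'rV[F]_n;
  stalk_free : forall x, exists2 B, B \in unitmx & stalk x = lattice x B;
  stalk_generic : finite_set [set x | stalk x <> lattice x 1%:M] }.

(* The submodule m_x^n E_x of the generic fibre *)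
Definition stalk_pow m (E : vbundle m) x (n : int) : set 'rV[F]_m :=
  [set s | exists f s0, [/\ max_pow x n f, E x s0 & s = f *: s0]].

Record flat_bundle (n : nat) := FlatBundle {
  flat_vb :> vbundle n;
  marked : set (place iota);
  marked_finite : finite_set marked;
  nabla : der iota -> 'rV[F]_n -> 'rV[F]_n;
  nabla_linear : forall a D1 D2 s,
    nabla (a *: D1 + D2) s = a *: nabla D1 s + nabla D2 s;
  nablaD : forall D s1 s2, nabla D (s1 + s2) = nabla D s1 + nabla D s2;
  nabla_leibniz : forall D f s, nabla D (f *: s) = D f *: s + f *: nabla D s;
  nabla_stalk : forall x D s, tau_log marked x D -> flat_vb x s ->
    flat_vb x (nabla D s) }.

(* A line subbundle of a rank two bundle whose quotient is a line bundle *)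
Definition filtration (E : vbundle 2) (Fil : place iota -> set 'rV[F]_2) :=
  (exists2 w : 'rV[F]_2, w != 0 &
     forall x s, Fil x s -> exists a, s = a *: w) /\
  forall x, exists B : 'M[F]_2,
    [/\ B \in unitmx, E x = lattice x B &
        Fil x = [set s | exists2 c, local_ring x c & s = c *: row 0 B]].

Definition rational_section (Fil : place iota -> set 'rV[F]_2) (s : 'rV[F]_2) :=
  forall x, exists f s0, Fil x s0 /\ s = f *: s0.

(* A generator D of tau^log at x identifies Gr^1 (x) Omega^log with Gr^1, and the
   Kodaira-Spencer map with s |-> nabla(D) s mod F^1. *)
Definition kodaira_spencer_iso (E : flat_bundle 2)
    (Fil : place iota -> set 'rV[F]_2) : Prop :=
  forall x, exists D,
    tau_log (marked E) x
      = [set D' | exists2 a, local_ring x a & D' = a *: D] /\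
    forall e, E x e -> exists! s, Fil x s /\ Fil x (nabla E D s - e).

(* The monodromy operator at x acts on E_x / m_x E_x by nabla(t d/dt). *)
Definition monodromy_neq0 n (E : flat_bundle n) x : Prop :=
  exists t D, [/\ ord x t = 1, D t = t
    & exists2 s, E x s & ~ stalk_pow E x 1 (nabla E D s)].

(* The Hodge filtration, which is unique, is carried along as a component. *)
Record indigenous_bundle := IndigenousBundle {
  indigenous_flat :> flat_bundle 2;
  hodge : place iota -> set 'rV[F]_2;
  hodge_filtration : filtration indigenous_flat hodge;
  hodge_ks : kodaira_spencer_iso indigenous_flat hodge;
  indigenous_monodromy : forall x, marked indigenous_flat x ->
    monodromy_neq0 indigenous_flat x }.

Definition horizontal_epi n (E : flat_bundle n)
    (gamma : {linear 'rV[F]_n -> F^o}) : Prop :=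
  (forall x, gamma @` E x = local_ring x) /\
  forall D s, gamma (nabla E D s) = D (gamma s).

Definition normalized_bundle n (E : flat_bundle n) : Prop :=
  exists gamma, horizontal_epi E gamma.

(* The poles of the canonical section; gamma is unique up to a constant. *)
Definition bundle_supersingular (E : indigenous_bundle) : set (place iota) :=
  [set x | exists gamma e,
     [/\ horizontal_epi E gamma, rational_section (hodge E) e,
         gamma e = 1 & ~ hodge E x e]].

Section PCurvature.
Variables (p : nat) (hp : p \in [pchar k]).

(* Psi_E(c . D^{(x)p}); every section of T has the form c . D^{(x)p}. *)
Definition pcurv n (E : flat_bundle n) D (c : F) (s : 'rV[F]_n) : 'rV[F]_n :=
  c *: (iter p (nabla E D) s - nabla E (der_pow hp D) s).

Definition active_bundle n (E : flat_bundle n) : Prop :=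
  exists D c s, pcurv E D c s <> 0.

Definition nilpotent_bundle n (E : flat_bundle n) : Prop :=
  forall D c, exists m, forall s, iter m (pcurv E D c) s = 0.

(* Psi_E maps the stalk of T = (tau^log)^{(x)p} into m_x^n End(E)_x. *)
Definition pcurv_vanishes m (E : flat_bundle m) x (n : nat) : Prop :=
  forall D c s, tau_log (marked E) x D -> local_ring x c -> E x s ->
    stalk_pow E x n%:Z (pcurv E D c s).

Definition pcurv_order m (E : flat_bundle m) x (n : nat) : Prop :=
  pcurv_vanishes E x n /\ ~ pcurv_vanishes E x n.+1.

End PCurvature.

(* The stalk at x of T(S), where T = (tau^log)^{(x)p} and S = sum_x n_x x has
   integral values; a section a . D^{(x)p} is given by its coefficient a, and
   (f D)^{(x)p} = f^p . D^{(x)p}. *)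
Definition T_twist p M (S : place iota -> rat) D x : set F :=
  [set a | exists h c f,
     [/\ h = 0 \/ - S x <= (ord x h)%:~R,
         local_ring x c, tau_log M x (f *: D) & a = h * (c * f ^+ p)]].

(* The generic fibre of E|_U is F^2, with basis D^{(x)p}, e_0. *)
Definition basis_Dp : 'rV[F]_2 := delta_mx 0 0.
Definition basis_e0 : 'rV[F]_2 := delta_mx 0 1.

(* E restricts on U to T(S) (+) O.e_0, with nabla(D)(D^{(x)p}) = 0 and
   nabla(D)(e_0) = v . D^{(x)p}. *)
Definition extends_construction p M (U : set (place iota))
    (S : place iota -> rat) D (v : F) (E : flat_bundle 2) : Prop :=
  [/\ marked E = M,
      forall x, U x ->
        E x = [set s | T_twist p M S D x (s 0 0) /\ local_ring x (s 0 1)],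
      nabla E D basis_Dp = 0
    & nabla E D basis_e0 = v *: basis_Dp].

(* e_0 is a section of F^1, and the projection to O.e_0 extends to an
   epimorphism onto O_X. *)
Definition compatible (E : indigenous_bundle) : Prop :=
  rational_section (hodge E) basis_e0 /\
  forall x, (fun s : 'rV[F]_2 => s 0 1) @` E x = local_ring x.

End Curve.

Section Deformation.
Variables (k K : fieldType) (iota : {rmorphism k -> K}) (L : splittingFieldType K).

Definition cover_embedding : {rmorphism k -> L} := (in_alg L : {rmorphism K -> L}) \o iota.

Local Notation G := ('Gal({:L} / 1))%g.

Definition above (x : place iota) (z : place cover_embedding) : Prop :=
  forall f : K, local_ring z f%:A <-> local_ring x f.

Definition tame (p : nat) : Prop :=
  forall x z, above x z -> forall f, ord x f = 1 -> ~~ (p%:Z %| ord z f%:A)%Z.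

Lemma conj_der_subproof (s : gal_of {:L}) (D : der cover_embedding) :
  is_derivation cover_embedding (fun f => (s^-1)%g (D (s f))).
Proof.
case: (derP D) => dD dM dC.
have sK f : (s^-1)%g (s f) = f.
  by rewrite -galM ?memvf // mulgV gal_id.
split=> [f h|f h|c].
- by rewrite !rmorphD dD rmorphD.
- by rewrite !rmorphM dM rmorphD !rmorphM /= !sK.
- by rewrite /= linearZ /= rmorph1 dC rmorph0.
Qed.

Definition conj_der (s : gal_of {:L}) (D : der cover_embedding) :
  der cover_embedding := Der (conj_der_subproof s D).

(* (s^* w)(D) = s (w (s^-1 D s)), so that s^* (f dh) = s f . d (s h). *)
Definition pullback (s : gal_of {:L}) (w : rat_diff cover_embedding) :
  der cover_embedding -> L := fun D => s (w (conj_der s D)).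

Definition deformation_datum (p : nat)
    (chi : {morphism G >-> {unit 'F_p}}) (w : rat_diff cover_embedding) : Prop :=
  [/\ galois 1 {:L}, tame p, (exists D, w D <> 0),
      ('injm chi)%g /\
      (forall s D, s \in G ->
         pullback s w D = (\val (chi s) : nat)%:R * w D)
    & exists2 u : L, u != 0 & forall D, w D = dd u D / u].

Definition stabilizer (z : place cover_embedding) : {set gal_of {:L}} :=
  [set s in G | `[< forall f, ord z (s f) = ord z f >]]%SET.

(* sigma_x = h_x / m_x, which does not depend on the choice of z above x. *)
Definition sigma (w : rat_diff cover_embedding) (x : place iota) : rat :=
  xget 0 [set q | exists2 z, above x z &
            q = (ord_diff z w + 1)%:~R / #|stabilizer z|%:R].

Definition supersingular (p : nat) (w : rat_diff cover_embedding) :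
    set (place iota) := [set x | sigma w x = (p.+1)%:R / (p.-1)%:R].

(* a = b mod p in Z_(p), i.e. p divides the numerator of a - b. *)
Definition eq_mod (p : nat) (a b : rat) : Prop := (p%:Z %| numq (a - b))%Z.

Definition singular (p : nat) (w : rat_diff cover_embedding) :
    set (place iota) :=
  [set x | ~ supersingular p w x /\ ~ eq_mod p (sigma w x) 1].

Definition n_at (p : nat) (w : rat_diff cover_embedding) (x : place iota) : rat :=
  if `[< supersingular p w x >] then 0
  else if `[< singular p w x >] then (p.-1)%:R * sigma w x
  else (p.-1)%:R * (sigma w x - 1).

End Deformation.

(* Main.v *)
Require Import Defs.
From HB Require Import structures.
From mathcomp Require Import all_boot all_order all_algebra all_fingroup all_field.
From mathcomp Require Import boolp classical_sets functions cardinality.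
From mathcomp Require Import zify ring.

Set Implicit Arguments.
Unset Strict Implicit.
Unset Printing Implicit Defensive.

Import Order.TTheory GRing.Theory Num.Theory.
Local Open Scope classical_set_scope.
Local Open Scope card_scope.
Local Open Scope ring_scope.

(* At a place x with parameter s put D_s = d/ds and omega = z_s ds, v_s = z_s^(1-p), and
   let a be the order of v_s. Tame ramification gives
   a = (p - 1)(1 - sigma_x), so x is supersingular iff a = -2, and singular iff a <> -2 and
   p does not divide a. As omega is logarithmic, Jacobson's formula gives
   D_s^(p-1) v_s = -1. This makes the p-curvature send e_0 to -D^(p), bounds a by p - 1,
   and kills the residue term of v_s at a supersingular point. Off the supersingular points
   T(S) + O e_0 is stable under the connection with an isomorphic Kodaira-Spencer map,
   by comparison of orders. At a supersingular point v_s = -D_s c + O(1) with c of order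
   -1, and D^(p), e_0 + c D^(p) span the stalk, whose Hodge line is spanned by s e_0; the
   Kodaira-Spencer condition leaves no other choice because p > 2 divides neither 1 nor 2.

   That almost all stalks are the standard ones requires that f and df have finitely many
   zeros and poles: weak approximation bounds the zeros of f by [K : k(f)], and where
   k(t)[b_1, ..., b_N] is separable, t - t(x) is a parameter at x. *)

(** * Places and weak approximation *)

(** A place is a bare valuation of the function field, with no power series ring behind it, so even
    the regularity of [d/ds] at a place with parameter [s] has to be proved. The substitute for
    completion is a relation [P(s, f) = 0] whose partial derivative in [f] is nonzero at [(s, f)],
    compared with truncated expansions of [f] in [s]. Likewise [sigma] refers to places of [L] above
    a place of [K]: their existence is Chevalley's extension theorem, and the order of a stabilizer
    has to be identified with the ramification index. The identity for [v] comes from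
    [omega = du/u]. With [w = omega(D)] one has [D u = w u], and Jacobson's formula computes
    [omega(D^p) = D^p u / u] as [D^(p-1) w + w^p]. Multiplication by [z^-p], a constant for every
    derivation, turns [w] into [v D(t)] and brings the identity down from [L] to [K]. The integers
    [level], [pole] and the function [tail] describe the stalks at all points by one formula,
    supersingular or not. In the uniqueness proof 1 and 2 are the distances from [level] at which a
    competing stalk could deviate. *)

Section Valuations.
Variables (k F : fieldType) (iota : {rmorphism k -> F}).
Implicit Types (x y : place iota) (f g h : F) (m n : int).

Lemma ord_one x : ord x 1 = 0.
Proof. by rewrite -(rmorph1 iota) ord_const. Qed.

Lemma ordN x f : ord x (- f) = ord x f.
Proof.
have [->|f0] := eqVneq f 0; first by rewrite oppr0.
rewrite -mulN1r ordM ?oppr_eq0 ?oner_eq0 //.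
by rewrite -(rmorph1 iota) -rmorphN ord_const add0r.
Qed.

Lemma ordV x f : ord x f^-1 = - ord x f.
Proof.
have [->|f0] := eqVneq f 0; first by rewrite invr0 ord0E oppr0.
apply: (addrI (ord x f)); rewrite -ordM ?invr_eq0 // mulfV // ord_one.
by rewrite subrr.
Qed.

Lemma ordX x f (i : nat) : ord x (f ^+ i) = ord x f *+ i.
Proof.
have [->|f0] := eqVneq f 0.
  by case: i => [|i]; rewrite ?expr0 ?ord_one // exprS mul0r ord0E mul0rn.
elim: i => [|i IH]; first by rewrite expr0 ord_one.
by rewrite exprS ordM ?expf_neq0 // IH mulrS.
Qed.

Lemma ord_div x f g : f != 0 -> g != 0 -> ord x (f / g) = ord x f - ord x g.
Proof. by move=> f0 g0; rewrite ordM ?invr_eq0 // ordV. Qed.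

Lemma max_pow0 x n : max_pow x n 0. Proof. by left. Qed.

Lemma max_pow_ord x n f : f != 0 -> max_pow x n f -> n <= ord x f.
Proof. by move=> /eqP f0 []. Qed.

Lemma max_powW x m n f : m <= n -> max_pow x n f -> max_pow x m f.
Proof. by move=> mn [->|nf]; [left|right; apply: le_trans nf]. Qed.

Lemma max_powN x n f : max_pow x n f -> max_pow x n (- f).
Proof. by case=> [->|nf]; [left; rewrite oppr0|right; rewrite ordN]. Qed.

Lemma max_powD x n f g : max_pow x n f -> max_pow x n g -> max_pow x n (f + g).
Proof.
case=> [->|nf]; first by rewrite add0r.
case=> [->|ng]; first by rewrite addr0; right.
have [->|f0] := eqVneq f 0; first by rewrite add0r; right.
have [->|g0] := eqVneq g 0; first by rewrite addr0; right.
have [->|fg0] := eqVneq (f + g) 0; first by left.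
by right; apply: le_trans (ordD x f0 g0 fg0); rewrite le_min nf ng.
Qed.

Lemma max_powB x n f g : max_pow x n f -> max_pow x n g -> max_pow x n (f - g).
Proof. by move=> nf ng; apply: max_powD => //; apply: max_powN. Qed.

Lemma max_pow_sum x n (I : Type) (r : seq I) (P : pred I) (G : I -> F) :
  (forall i, P i -> max_pow x n (G i)) -> max_pow x n (\sum_(i <- r | P i) G i).
Proof.
move=> H; apply: (big_ind (max_pow x n)) => //; first exact: max_pow0.
exact: max_powD.
Qed.

Lemma max_powM x m n f g :
  max_pow x m f -> max_pow x n g -> max_pow x (m + n) (f * g).
Proof.
case=> [->|mf]; first by rewrite mul0r; left.
case=> [->|ng]; first by rewrite mulr0; left.
have [->|f0] := eqVneq f 0; first by rewrite mul0r; left.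
have [->|g0] := eqVneq g 0; first by rewrite mulr0; left.
by right; rewrite ordM //; lia.
Qed.

Lemma max_powMl x n f g : max_pow x 0 f -> max_pow x n g -> max_pow x n (f * g).
Proof. by move=> hf hg; have := max_powM hf hg; rewrite add0r. Qed.

Lemma max_powMr x n f g : max_pow x n f -> max_pow x 0 g -> max_pow x n (f * g).
Proof. by move=> hf hg; have := max_powM hf hg; rewrite addr0. Qed.

Lemma max_powX x n f (i : nat) : max_pow x n f -> max_pow x (n *+ i) (f ^+ i).
Proof.
move=> nf; elim: i => [|i IH]; first by rewrite mulr0n expr0; right; rewrite ord_one.
by rewrite mulrS exprS; apply: max_powM.
Qed.

Lemma max_pow_const x c : max_pow x 0 (iota c).
Proof. by right; rewrite ord_const. Qed.

Lemma max_pow_ordE x f : max_pow x (ord x f) f.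
Proof. by right. Qed.

Lemma max_powP x n f : f != 0 -> max_pow x n f <-> n <= ord x f.
Proof. by move=> f0; split; [apply: max_pow_ord|right]. Qed.

Lemma max_pow1 x n : max_pow x n 1 <-> n <= 0.
Proof. by rewrite max_powP ?oner_eq0 // ord_one. Qed.

Lemma max_pow_divl x n f g : f != 0 ->
  max_pow x n (f * g) <-> max_pow x (n - ord x f) g.
Proof.
move=> f0; split=> h.
  rewrite -(mulKf f0 g) [n - _]addrC; apply: max_powM => //.
  by right; rewrite ordV.
by have := max_powM (max_pow_ordE x f) h; rewrite addrC subrK.
Qed.

Lemma max_pow_all x f : (forall i : nat, max_pow x i%:Z f) -> f = 0.
Proof.
move=> H; apply: contrapT => /eqP f0.
by have := max_pow_ord f0 (H (`|ord x f|%N.+1)); lia.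
Qed.

Lemma ordD_le x f g : f != 0 -> g != 0 -> f + g != 0 ->
  ord x f <= ord x (f + g) \/ ord x g <= ord x (f + g).
Proof. by move=> f0 g0 /(ordD x f0 g0); rewrite ge_min => /orP. Qed.

Lemma ord_addl x f g : f != 0 -> max_pow x (ord x f + 1) g ->
  f + g != 0 /\ ord x (f + g) = ord x f.
Proof.
move=> f0 hg.
have fg0 : f + g != 0.
  apply/eqP => e; have gE : g = - f by apply/eqP; rewrite -addr_eq0 addrC e.
  have : g != 0 by rewrite gE oppr_eq0.
  by move/max_pow_ord=> /(_ _ _ hg); rewrite gE ordN; lia.
split=> //.
case: hg => [->|hg]; first by rewrite addr0.
have [->|g0] := eqVneq g 0; first by rewrite addr0.
have h1 := ordD_le x f0 g0 fg0.
have ng0 : - g != 0 by rewrite oppr_eq0.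
have h2 := @ordD_le x (f + g) (- g) fg0 ng0.
move: h2; rewrite addrK ordN => /(_ f0) h2.
by lia.
Qed.

Lemma ord_addr x f g : f != 0 -> max_pow x (ord x f + 1) g ->
  g + f != 0 /\ ord x (g + f) = ord x f.
Proof. by move=> f0 hg; rewrite [g + f]addrC; apply: ord_addl. Qed.

Lemma place_ext x y : (forall f, ord x f = ord y f) -> x = y.
Proof.
case: x => ox a1 a2 a3 a4 a5; case: y => oy b1 b2 b3 b4 b5 /= /funext e.
case: _ / e in b1 b2 b3 b4 b5 *.
by congr Place; apply: Prop_irrelevance.
Qed.

(* A discrete valuation ring is a maximal proper subring of its field. *)
Lemma place_inj x y : (forall f, 0 <= ord x f -> 0 <= ord y f) -> x = y.
Proof.
move=> H.
have H0 f : ord x f = 0 -> ord y f = 0.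
  by move=> e; have := H f; have := H f^-1; rewrite !ordV e; lia.
have [s hs] := ord_onto x.
have s0 : s != 0 by apply: contra_eq_neq hs => ->; rewrite ord0E.
(* Dividing [f] by a power of [s] leaves a unit at [x], hence at [y] by [H0]; so [ord y] is a
   multiple of [ord x], and the multiple is 1 because [ord y] is onto. *)
have E f : f != 0 -> ord y f = ord x f * ord y s.
  move=> f0; case e: (ord x f) => [i|i].
    have u0 : ord y (f / s ^+ i) = 0.
      by apply: H0; rewrite ord_div ?expf_neq0 // ordX e hs; lia.
    by move: u0; rewrite ord_div ?expf_neq0 // ordX -mulr_natr natz; lia.
  have u0 : ord y (f * s ^+ i.+1) = 0.
    by apply: H0; rewrite ordM ?expf_neq0 // ordX e hs; lia.
  by move: u0; rewrite ordM ?expf_neq0 // ordX -mulr_natr natz; lia.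
have [r hr] := ord_onto y.
have r0 : r != 0 by apply: contra_eq_neq hr => ->; rewrite ord0E.
have sy := H s.
have s1 : ord y s = 1.
  have := congr1 absz (E r r0); rewrite hr abszM => /esym/eqP.
  by rewrite muln_eq1 => /andP[_ /eqP]; move: sy; rewrite hs; lia.
apply: place_ext => f; have [->|f0] := eqVneq f 0; first by rewrite !ord0E.
by rewrite E // s1 mulr1.
Qed.

Lemma place_sep x y : x <> y -> exists f, ord x f < 0 /\ 0 < ord y f.
Proof.
move=> xy.
have [f fP] : exists f, ~ (0 <= ord x f -> 0 <= ord y f).
  by apply/existsNP => H; apply/xy/place_inj.
have [g gP] : exists g, ~ (0 <= ord y g -> 0 <= ord x g).
  by apply/existsNP => H; apply/xy/esym/place_inj.
have f0 : f != 0 by apply: contra_notN fP => /eqP->; rewrite !ord0E.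
have g0 : g != 0 by apply: contra_notN gP => /eqP->; rewrite !ord0E.
have [fx fy] : 0 <= ord x f /\ ord y f < 0 by split; lia.
have [gx gy] : 0 <= ord y g /\ ord x g < 0 by split; lia.
by exists (g / f); rewrite !ord_div //; lia.
Qed.

(** Let [f] serve for the first [d] places and let [h] separate [x] from the last one. If [f] has a
    zero at the last place, [f] serves; if it is a unit there, a high power of [f] times [h] does;
    if it has a pole there, that power [f^r] is first replaced by [f^r / (1 + f^r)], which has order
    0 at the poles of [f] and keeps its zeros. *)
Lemma place_sep_seq x (y : nat -> place iota) (d : nat) :
  (forall j, (j < d)%N -> y j <> x) ->
  exists f, ord x f < 0 /\ forall j, (j < d)%N -> 0 < ord (y j) f.
Proof.
elim: d => [_|d IH H].
  have [s hs] := ord_onto x; exists s^-1; rewrite ordV hs; split=> //; lia.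
have [f [fx fy]] : exists f, ord x f < 0 /\ forall j, (j < d)%N -> 0 < ord (y j) f.
  by apply: IH => j jd; apply: H; lia.
have f0 : f != 0 by apply: contraTneq fx => ->; rewrite ord0E.
have [h [hx hy]] := place_sep (fun e => H d (ltnSn d) (esym e)).
have h0 : h != 0 by apply: contraTneq hx => ->; rewrite ord0E.
(* The exponent must outweigh the poles that [h] may have at the first [d] places. *)
have [r hr] : exists r : nat, forall j, (j < d)%N -> 0 < ord (y j) f *+ r.+1 + ord (y j) h.
  exists (\max_(j < d) `|ord (y j) h|%N)%N => j jd.
  have := leq_bigmax (F := fun j : 'I_d => `|ord (y j) h|%N) (Ordinal jd) => /=.
  have := fy j jd; rewrite -mulr_natr natz.
  move: (\max_(j < d) _)%N (ord (y j) f) (ord (y j) h) => M a b; nia.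
have fr0 : f ^+ r.+1 != 0 by rewrite expf_neq0.
case: (ltrgtP (ord (y d) f) 0) => fd.
- have fr (z : place iota) : ord z f < 0 -> 1 + f ^+ r.+1 != 0 /\ ord z (1 + f ^+ r.+1) = ord z f *+ r.+1.
    move=> zf; rewrite -ordX; apply: ord_addr => //; apply/max_pow1.
    by rewrite ordX -mulr_natr natz; nia.
  have [u0 ux] := fr x fx; have [_ ud] := fr _ fd.
  exists (f ^+ r.+1 / (1 + f ^+ r.+1) * h).
  have E (z : place iota) : ord z (f ^+ r.+1 / (1 + f ^+ r.+1) * h)
     = ord z f *+ r.+1 - ord z (1 + f ^+ r.+1) + ord z h.
    by rewrite ordM ?mulf_neq0 ?invr_eq0 // ord_div // ordX.
  rewrite E ux subrr add0r; split=> // j; rewrite ltnS leq_eqVlt => /orP[/eqP->|jd].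
    by rewrite E ud subrr add0r.
  rewrite E; have [_ ->] : 1 + f ^+ r.+1 != 0 /\ ord (y j) (1 + f ^+ r.+1) = ord (y j) 1.
    apply: ord_addl; first exact: oner_neq0.
    by right; rewrite ord_one ordX -mulr_natr natz; have := fy j jd; nia.
  by rewrite ord_one subr0; apply: hr.
- exists f; split=> // j; rewrite ltnS leq_eqVlt => /orP[/eqP->//|]; exact: fy.
- exists (f ^+ r.+1 * h); have E (z : place iota) : ord z (f ^+ r.+1 * h) = ord z f *+ r.+1 + ord z h.
    by rewrite ordM // ordX.
  rewrite E -mulr_natr natz; split; first nia.
  move=> j; rewrite ltnS leq_eqVlt => /orP[/eqP->|jd].
    by rewrite E fd mul0rn add0r.
  by rewrite E; apply: hr.
Qed.

(** [f ^+ N.+1 / (1 + f ^+ N.+1)] is close to 1 at a pole of [f] and to 0 at its zeros. *)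
Lemma weak_approximation x (y : nat -> place iota) (d N : nat) :
  (forall j, (j < d)%N -> y j <> x) ->
  exists h, max_pow x 1 (h - 1) /\ forall j, (j < d)%N -> max_pow (y j) N h.
Proof.
move=> /place_sep_seq[f [fx fy]].
have f0 : f != 0 by apply: contraTneq fx => ->; rewrite ord0E.
have fN0 : f ^+ N.+1 != 0 by rewrite expf_neq0.
have [u0 ux] : 1 + f ^+ N.+1 != 0 /\ ord x (1 + f ^+ N.+1) = ord x (f ^+ N.+1).
  apply: ord_addr => //; apply/max_pow1.
  by rewrite ordX -mulr_natr natz; nia.
exists (f ^+ N.+1 / (1 + f ^+ N.+1)); split.
  have -> : f ^+ N.+1 / (1 + f ^+ N.+1) - 1 = - (1 + f ^+ N.+1)^-1.
    by move: (f ^+ N.+1) u0 => a u0; field.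
  by apply: max_powN; right; rewrite ordV ux ordX -mulr_natr natz; nia.
move=> j jd; right; rewrite ord_div // ordX.
have [_ ->] : 1 + f ^+ N.+1 != 0 /\ ord (y j) (1 + f ^+ N.+1) = ord (y j) 1.
  apply: ord_addl; first exact: oner_neq0.
  by right; rewrite ord_one ordX -mulr_natr natz; have := fy j jd; nia.
by rewrite ord_one subr0 -mulr_natr natz; have := fy j jd; nia.
Qed.

End Valuations.

(** * Function fields *)

Lemma linear_dependence (R : fieldType) (I J : finType) (A : I -> J -> R) :
  (#|J| < #|I|)%N ->
  exists c : I -> R, (exists i, c i != 0) /\ forall j, \sum_i c i * A i j = 0.
Proof.
move=> cardJI; pose M := \matrix_(i < #|I|, j < #|J|) A (enum_val i) (enum_val j).
have : ~~ row_free M.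
  by rewrite -row_leq_rank -ltnNge (leq_ltn_trans (rank_leq_col M)).
rewrite -kermx_eq0 => /rowV0Pn[u /sub_kermxP uM u0].
exists (fun i => u 0 (enum_rank i)); split.
  have /rV0Pn[i ui] := u0.
  by exists (enum_val i); rewrite enum_valK.
move=> j; have := congr1 (fun B : 'rV_#|J| => B 0 (enum_rank j)) uM.
rewrite !mxE => e0; rewrite -[RHS]e0 (reindex (fun i : 'I_#|I| => enum_val i)) /=; last first.
  exact/onW_bij/enum_val_bij.
by apply: eq_bigr => i _; rewrite mxE enum_valK enum_rankK.
Qed.

Section FunctionField.
Variables (k F : fieldType) (iota : {rmorphism k -> F}).

Definition peval (s : F) : {poly k} -> F := horner_eval s \o map_poly iota.
HB.instance Definition _ s :=
  GRing.RMorphism.copy (peval s) (horner_eval s \o map_poly iota).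

Lemma pevalC s c : peval s c%:P = iota c.
Proof. by rewrite /peval /= /horner_eval map_polyC hornerC. Qed.

Lemma pevalX s : peval s 'X = s.
Proof. by rewrite /peval /= /horner_eval map_polyX hornerX. Qed.

Lemma pevalZ s c P : peval s (c *: P) = iota c * peval s P.
Proof. by rewrite -mul_polyC rmorphM /= pevalC. Qed.

Lemma peval_coef s (P : {poly k}) n : (size P <= n)%N ->
  peval s P = \sum_(i < n) iota P`_i * s ^+ i.
Proof.
move=> sP; rewrite {1}(_ : P = \sum_(i < n) P`_i *: 'X^i).
  rewrite rmorph_sum /=; apply: eq_bigr => i _.
  by rewrite pevalZ rmorphXn /= pevalX.
apply/polyP => j; rewrite coef_sum.
have [jn|jn] := ltnP j n.
  rewrite (bigD1 (Ordinal jn)) //= coefZ coefXn eqxx mulr1 big1 ?addr0 // => i.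
  by rewrite -val_eqE /= coefZ coefXn eq_sym => /negPf->; rewrite mulr0.
rewrite nth_default ?(leq_trans sP) // big1 // => i _.
by rewrite coefZ coefXn gtn_eqF ?mulr0 // (leq_trans (ltn_ord i)).
Qed.

Lemma peval_poly s n (c : nat -> k) :
  peval s (\poly_(i < n) c i) = \sum_(i < n) iota (c i) * s ^+ i.
Proof.
rewrite (@peval_coef _ _ n) ?size_poly //.
by apply: eq_bigr => i _; rewrite coef_poly ltn_ord.
Qed.

Hypothesis hF : function_field iota.

(** One denominator for a whole finite family replaces coefficients in [k(t)] by polynomials in [t],
    whose degrees can be counted. *)
Lemma common_denominator : exists (t : F) (N : nat) (b : 'I_N -> F),
  (forall P, peval t P = 0 -> P = 0) /\
  forall (I : finType) (f : I -> F), exists (q : {poly k}) (A : I -> 'I_N -> {poly k}),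
    q != 0 /\ forall i, peval t q * f i = \sum_l peval t (A i l) * b l.
Proof.
have [t [tr [b gen]]] := hF; exists t, (size b), (fun j => b`_j); split=> // I f.
have tr' P : P != 0 -> peval t P != 0 by apply: contra_neq => /tr.
have gen' f' : exists P Q : 'I_(size b) -> {poly k}, (forall j, Q j != 0) /\
    f' = \sum_j peval t (P j) / peval t (Q j) * b`_j := gen f'.
have [P HP] := choice (fun i => gen' (f i)).
have [Q HQ] := choice HP.
pose q := \prod_i \prod_j Q i j.
have q0 : q != 0.
  apply/prodf_neq0 => i _; apply/prodf_neq0 => j _; exact: (HQ i).1.
exists q, (fun i j => P i j * (\prod_(i' | i' != i) \prod_j' Q i' j') *
   (\prod_(j' | j' != j) Q i j')); split=> // i.
rewrite {1}(HQ i).2 mulr_sumr; apply: eq_bigr => j _.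
rewrite !mulrA; congr (_ * _).
rewrite {1}/q (bigD1 i) //= (bigD1 j) //= !rmorphM /=.
have := tr' _ ((HQ i).1 j).
move: (peval t (Q i j)) (peval t (P i j)) => a c a0.
by rewrite !rmorph_prod; field.
Qed.

Lemma size_sum_leq (I : Type) (r : seq I) (P : pred I) (G : I -> {poly k}) n :
  (forall i, P i -> (size (G i) <= n)%N) -> (size (\sum_(i <- r | P i) G i)%R <= n)%N.
Proof.
move=> H; apply: (big_ind (fun p : {poly k} => (size p <= n)%N)) => //.
  by rewrite size_poly0.
by move=> p q hp hq; rewrite (leq_trans (size_polyD p q)) // geq_max hp.
Qed.

(* Up to a common denominator the products [f ^+ i * h j], [i < m], lie in a
   k-space of dimension [C * m + O(1)] with [C] independent of [h]. *)
Lemma poly_dependence (f : F) : exists C : nat, forall h : 'I_C.+1 -> F,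
  exists P : 'I_C.+1 -> {poly k},
    (exists j, P j != 0) /\ \sum_j peval f (P j) * h j = 0.
Proof.
have [t [N [b [tr cden]]]] := common_denominator.
have tr' P : P != 0 -> peval t P != 0 by apply: contra_neq => /tr.
have [q [A [q0 qA]]] := cden _ (fun l : 'I_N => f * b l).
(* Each multiplication by [f] costs one factor [q] and raises degrees by at most [D]. *)
pose D := (size q + \max_l \max_m size (A l m))%N.
have qD : (size q <= D)%N by rewrite leq_addr.
have AD l m : (size (A l m) <= D)%N.
  rewrite (leq_trans _ (leq_addl _ _)) //.
  rewrite (leq_trans _ (leq_bigmax l)) //.
  exact: (leq_bigmax (F := fun m => size (A l m)) m).
exists (N * D)%N => h.
have [q' [B [q'0 qB]]] := cden _ h.
pose S := (\max_j \max_m size (B j m))%N.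
have BS j m : (size (B j m) <= S)%N.
  rewrite (leq_trans _ (leq_bigmax j)) //.
  exact: (leq_bigmax (F := fun m => size (B j m)) m).
have step (i : nat) j : exists R : 'I_N -> {poly k},
    (forall l, (size (R l) <= S + i * D)%N) /\
    peval t (q' * q ^+ i) * (f ^+ i * h j) = \sum_l peval t (R l) * b l.
  elim: i => [|i [R [sR eR]]].
    exists (B j); split=> [l|]; first by rewrite mul0n addn0.
    by rewrite !expr0 mulr1 mul1r qB.
  exists (fun m => \sum_l R l * A l m); split=> [m|].
    apply: size_sum_leq => l _; apply: (leq_trans (size_polyMleq _ _)).
    have := sR l; have := AD l m; rewrite mulSn; lia.
  rewrite !exprS !rmorphM /=.
  transitivity (peval t q * f * (peval t (q' * q ^+ i) * (f ^+ i * h j))).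
    by rewrite rmorphM /=; ring.
  rewrite eR mulr_sumr.
  transitivity (\sum_l peval t (R l) * (peval t q * (f * b l))).
    by apply: eq_bigr => l _; ring.
  have qA' l : peval t q * (f * b l) = \sum_m peval t (A l m) * b m := qA l.
  transitivity (\sum_l \sum_m peval t (R l) * (peval t (A l m) * b m)).
    by apply: eq_bigr => l _; rewrite qA' mulr_sumr.
  rewrite exchange_big /=; apply: eq_bigr => m _.
  rewrite rmorph_sum mulr_suml /=; apply: eq_bigr => l _.
  by rewrite rmorphM /= mulrA.
(* There are [M * (N * D + 1)] unknown coefficients against [N * (S + M * D)] equations; the
   difference [M - N * S] is 1. *)
pose M := (N * S).+1.
have stepM (ij : 'I_M * 'I_(N * D).+1) : exists R : 'I_N -> {poly k},
    (forall l, (size (R l) <= S + M * D)%N) /\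
    peval t (q' * q ^+ M) * (f ^+ ij.1 * h ij.2) = \sum_l peval t (R l) * b l.
  case: ij => i j /=; have [R [sR eR]] := step i j.
  exists (fun l => q ^+ (M - i) * R l); split=> [l|].
    apply: (leq_trans (size_polyMleq _ _)).
    have h1 : (size (q ^+ (M - i)) <= (size q).-1 * (M - i) + 1)%N.
      by rewrite (leq_trans (size_poly_exp_leq _ _)) // addn1.
    have := sR l; have := ltn_ord i.
    move: (nat_of_ord i) h1 => i' h1 lt_i.
    have : ((size q).-1 * (M - i') <= D * (M - i'))%N.
      by rewrite leq_mul2r (leq_trans (leq_pred _)) ?orbT.
    have : (M * D = i' * D + D * (M - i'))%N.
      by rewrite mulnBr [(D * M)%N]mulnC [(D * i')%N]mulnC subnKC // leq_mul2r ltnW ?orbT.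
    lia.
  rewrite -{1}(subnKC (ltnW (ltn_ord i))) exprD [q' * _]mulrA rmorphM /=.
  rewrite [_ * peval t (q ^+ _)]mulrC -mulrA eR mulr_sumr.
  by apply: eq_bigr => l _; rewrite rmorphM /= mulrA.
have [R HR] := choice stepM.
have [|c [[[i0 j0] c0] Hc]] := @linear_dependence k
    ('I_M * 'I_(N * D).+1)%type ('I_N * 'I_(S + M * D))%type
    (fun ij le => (R ij le.1)`_le.2).
  rewrite !card_prod !card_ord /M; nia.
exists (fun j => \poly_(i < M) (if insub i is Some i' then c (i', j) else 0)); split.
  exists j0; apply: contra_neq c0 => /(congr1 (fun P : {poly k} => P`_i0)).
  by rewrite coef_poly ltn_ord coef0 (valK i0).
apply: (mulfI (tr' (q' * q ^+ M) _)); first by rewrite mulf_neq0 ?expf_neq0.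
rewrite mulr0 mulr_sumr.
transitivity (\sum_(ij : 'I_M * 'I_(N * D).+1) iota (c ij) *
    (peval t (q' * q ^+ M) * (f ^+ ij.1 * h ij.2))).
  transitivity (\sum_(ij : 'I_M * 'I_(N * D).+1) iota (c (ij.1, ij.2)) *
      (peval t (q' * q ^+ M) * (f ^+ ij.1 * h ij.2))); last first.
    by apply: eq_bigr => -[].
  rewrite -(pair_bigA _ (fun i j => iota (c (i, j)) *
    (peval t (q' * q ^+ M) * (f ^+ i * h j)))) exchange_big /=.
  apply: eq_bigr => j _; rewrite peval_poly mulr_suml mulr_sumr.
  apply: eq_bigr => i _; rewrite (valK i).
  by ring.
transitivity (\sum_ij \sum_l iota (c ij) * (peval t (R ij l) * b l)).
  by apply: eq_bigr => ij _; rewrite (HR ij).2 mulr_sumr.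
rewrite exchange_big big1 //= => l _.
transitivity (\sum_(e < S + M * D) iota (\sum_ij c ij * (R ij l)`_e) * t ^+ e * b l).
  transitivity (\sum_ij \sum_(e < S + M * D) iota (c ij * (R ij l)`_e) * t ^+ e * b l).
    apply: eq_bigr => ij _ /=.
    rewrite (peval_coef _ ((HR ij).1 l)) mulr_suml mulr_sumr.
    by apply: eq_bigr => e _; rewrite rmorphM; ring.
  rewrite exchange_big; apply: eq_bigr => e _ /=.
  by rewrite rmorph_sum !mulr_suml.
by rewrite big1 // => e _; rewrite (Hc (l, e)) rmorph0 !mul0r.
Qed.

(** If every [P j] has zero constant term, [f] can be divided out of the relation. A nonzero
    constant term makes the value of [P j] at [f] a unit at every zero of [f]. *)
Lemma poly_dependence0 (f : F) : f != 0 -> exists C : nat, forall h : 'I_C.+1 -> F,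
  exists P : 'I_C.+1 -> {poly k},
    (exists j, (P j)`_0 != 0) /\ \sum_j peval f (P j) * h j = 0.
Proof.
move=> f0; have [C HC] := poly_dependence f; exists C => h.
have [P [Pn0 rel]] := HC h.
have [n sP] : exists n, forall j, (size (P j) <= n)%N.
  exists (\max_j size (P j))%N => j; exact: (leq_bigmax (F := fun j => size (P j)) j).
elim: n P Pn0 rel sP => [|n IH] P Pn0 rel sP.
  by have [j] := Pn0; rewrite -size_poly_gt0 ltnNge sP.
have [[j Pj0]|all0] := pselect (exists j, (P j)`_0 != 0); first by exists P; split=> //; exists j.
have QX j : P j = (drop_poly 1 (P j)) * 'X.
  rewrite -{1}(poly_take_drop 1 (P j)) expr1 -[RHS]add0r; congr (_ + _).
  apply/polyP => i; rewrite coef_take_poly coef0; case: i => [|i] //=.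
  by apply/eqP; apply: contrapT => /negP nz; apply: all0; exists j.
apply: (IH (fun j => drop_poly 1 (P j))).
- have [j Pj] := Pn0; exists j; apply: contra_neq Pj => e.
  by rewrite QX e mul0r.
- apply: (mulfI f0); rewrite mulr0 mulr_sumr -[RHS]rel.
  by apply: eq_bigr => j _; rewrite {2}QX rmorphM /= pevalX; ring.
- by move=> j; rewrite size_drop_poly; have := sP j; lia.
Qed.

End FunctionField.

(** * Values of polynomials at a place *)

Section Expansions.
Variables (k F : fieldType) (iota : {rmorphism k -> F}).
Implicit Types (x : place iota) (f g s : F) (P Q : {poly k}) (n : int).

Lemma max_pow_peval x f P : max_pow x 0 f -> max_pow x 0 (peval iota f P).
Proof.
move=> hf; rewrite (peval_coef _ _ (leqnn _)); apply: max_pow_sum => i _.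
apply: max_powMl; first exact: max_pow_const.
by have := max_powX i hf; rewrite mul0rn.
Qed.

Lemma peval_congr x n f g P : max_pow x 0 f -> max_pow x 0 g ->
  max_pow x n (f - g) -> max_pow x n (peval iota f P - peval iota g P).
Proof.
move=> hf hg hn; rewrite !(peval_coef _ _ (leqnn _)) -sumrB.
apply: max_pow_sum => i _; rewrite -mulrBr; apply: max_powMl; first exact: max_pow_const.
rewrite subrXX; apply: max_powMr => //; apply: max_pow_sum => j _.
by apply: max_powMl; [have := max_powX (i.-1 - j) hf|have := max_powX j hg]; rewrite mul0rn.
Qed.

Lemma peval0 P : peval iota 0 P = iota P`_0.
Proof. by rewrite /peval /= /horner_eval horner_coef0 coef_map. Qed.

Lemma peval_unit x s Q : 0 < ord x s -> Q`_0 != 0 ->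
  peval iota s Q != 0 /\ ord x (peval iota s Q) = 0.
Proof.
move=> hs Q0.
have c0 : iota Q`_0 != 0 by rewrite fmorph_eq0.
rewrite -(subrK (iota Q`_0) (peval iota s Q)) -(ord_const x Q`_0).
apply: ord_addr => //; rewrite ord_const -peval0; apply: peval_congr.
- by right; apply: ltW.
- exact: max_pow0.
- by rewrite subr0; right; lia.
Qed.

(** The lowest nonzero coefficient of [P] alone fixes the order of [P(s)]. *)
Lemma peval_coef0 x s P (M : nat) : 0 < ord x s ->
  max_pow x (ord x s *+ M) (peval iota s P) -> forall i, (i < M)%N -> P`_i = 0.
Proof.
move=> hs hP i; elim/ltn_ind: i => i IH iM.
have e : P = drop_poly i P * 'X^i.
  rewrite -{1}(poly_take_drop i P) -[RHS]add0r; congr (_ + _).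
  apply/polyP => j; rewrite coef_take_poly coef0; case: ifP => // ji.
  by apply: IH => //; apply: ltn_trans iM.
apply: contrapT => /eqP Pi0.
have s0 : s != 0 by apply: contraTneq hs => ->; rewrite ord0E.
have [] := @peval_unit x s (drop_poly i P) hs _.
  by rewrite coef_drop_poly.
move=> d0 od; move: hP; rewrite e rmorphM rmorphXn /= pevalX.
rewrite max_powP ?mulf_neq0 ?expf_neq0 // ordM ?expf_neq0 // ordX od add0r.
by rewrite ler_pMn2l // leqNgt iM.
Qed.

Lemma ord_prod x (I : eqType) (r : seq I) (G : I -> F) : (forall i, i \in r -> G i != 0) ->
  ord x (\prod_(i <- r) G i) = \sum_(i <- r) ord x (G i).
Proof.
elim: r => [|i r IH] H; first by rewrite !big_nil ord_one.
rewrite !big_cons ordM ?IH //.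
- by move=> j jr; apply: H; rewrite inE jr orbT.
- by apply: H; rewrite inE eqxx.
- by rewrite prodf_seq_neq0; apply/allP => j jr; apply: H; rewrite inE jr orbT.
Qed.

End Expansions.

(** * Zeros and residues over an algebraically closed field *)

Section FunctionFieldPlaces.
Variables (k : closedFieldType) (F : fieldType) (iota : {rmorphism k -> F}).
Implicit Types (x : place iota) (f g s : F) (P Q : {poly k}) (n : int).
Hypothesis hF : function_field iota.

(* Functions [h j] equal to 1 at the zero [x_j] of [f] and to 0 at the others are
   independent over k(f), so there are at most [K : k(f)] zeros. *)
Lemma finite_zeros f : f != 0 -> finite_set [set x : place iota | 0 < ord x f].
Proof.
move=> f0; have [C HC] := poly_dependence0 hF f0.
apply: contrapT => /infiniteP/card_leP[u].
pose y (i : nat) : place iota := \val (u (exist _ i (mem_setT i))).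
have yZ' j : 0 < ord (y j) f by apply: (set_mem (valP (u (exist _ j (mem_setT j))))).
have yinj : injective y 
  by move=> i j /val_inj/(@inj _ _ _ u (exist _ i _) (exist _ j _) (in_setT _) (in_setT _))[].
have sep (j : 'I_C.+1) : exists h, max_pow (y j) 1 (h - 1) /\
    forall i : 'I_C.+1, i != j -> max_pow (y i) 1 h.
  (* [y'] enumerates the places [y i] other than [y j], skipping the index [j]. *)
  pose y' i := if (i < j)%N then y i else y i.+1.
  have [|h [h1 h2]] := @weak_approximation _ _ _ (y j) y' C 1.
    by move=> i _; rewrite /y'; case: ltnP => ij /yinj; lia.
  exists h; split=> // i ij; have := ltn_ord i.
  case: (ltngtP i j) => // [lt _|lt iC|/val_inj e]; last by rewrite e eqxx in ij.
  - by have := h2 i; rewrite /y' lt; apply; have := ltn_ord j; lia.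
  - have := h2 i.-1; rewrite /y' (_ : (i.-1 < j)%N = false); last by lia.
    by rewrite prednK; [apply; lia|lia].
have [h Hh] := choice sep.
have [P [[j Pj] rel]] := HC h.
have int0 i : max_pow (y i) 0 f by right; apply: ltW.
(* The relation makes this value vanish at [y j], where [h j] is 1 and the other [h i] are 0; its
   nonzero constant term makes it a unit. *)
suff : max_pow (y j) 1 (peval iota f (P j)).
  have [d0 od] := peval_unit (yZ' j) Pj.
  by rewrite max_powP // od.
have -> : peval iota f (P j) =
    - (\sum_(i | i != j) peval iota f (P i) * h i) - peval iota f (P j) * (h j - 1).
  move: rel; rewrite (bigD1 j) //= => /eqP; rewrite addr_eq0 => /eqP e.
  by rewrite -e; ring.
apply: max_powB; last first.
  by apply: max_powMl; [apply: max_pow_peval|apply: (Hh j).1].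
apply/max_powN/max_pow_sum => i ij; apply: max_powMl; first exact: max_pow_peval.
by apply: (Hh i).2; rewrite eq_sym.
Qed.

Lemma finite_ord_neq0 f : f != 0 -> finite_set [set x : place iota | ord x f != 0].
Proof.
move=> f0; apply: (@sub_finite_set _ _ ([set x : place iota | 0 < ord x f] `|` [set x : place iota | 0 < ord x f^-1])).
  by move=> x /=; rewrite ordV; lia.
by rewrite finite_setU; split; apply: finite_zeros; rewrite ?invr_eq0.
Qed.

(** The residue field is algebraic over [k]: a relation among the powers of [f] over [k[s]], reduced
    modulo [s], is a nonzero polynomial [R] over [k] with [R(f)] in the maximal ideal. Since [k] is
    algebraically closed, a linear factor of [R(f)] lies there too. *)
Lemma residue x f : max_pow x 0 f -> exists c, max_pow x 1 (f - iota c).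
Proof.
move=> hf; have [s hs] := ord_onto x.
have s0 : s != 0 by apply: contra_eq_neq hs => ->; rewrite ord0E.
have [C HC] := poly_dependence0 hF s0.
have [P [[j Pj] rel]] := HC (fun j => f ^+ j).
pose R := \poly_(i < C.+1) (if insub i is Some i' then (P i')`_0 else 0).
have R0 : R != 0.
  apply: contra_neq Pj => /(congr1 (fun Q : {poly k} => Q`_j)).
  by rewrite coef_poly ltn_ord coef0 (valK j).
have Rf : max_pow x 1 (peval iota f R).
  have -> : peval iota f R = \sum_j (iota (P j)`_0 - peval iota s (P j)) * f ^+ j.
    rewrite -[LHS]subr0 -[X in _ - X]rel peval_poly -sumrB; apply: eq_bigr => i _.
    by rewrite (valK i) mulrBl.
  apply: max_pow_sum => i _; apply: max_powMr; last first.
    by have := max_powX i hf; rewrite mul0rn.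
  rewrite -opprB -peval0; apply: max_powN; apply: peval_congr.
  - by right; rewrite hs.
  - exact: max_pow0.
  - by rewrite subr0; right; rewrite hs.
have [r Rr] := closed_field_poly_normal R.
apply: contrapT => H.
have nz c : f - iota c != 0 /\ ord x (f - iota c) = 0.
  have c0 : f - iota c != 0 by apply/eqP => e; apply: H; exists c; rewrite e; left.
  split=> //; have : max_pow x 0 (f - iota c) by apply: max_powB => //; apply: max_pow_const.
  move/(max_pow_ord c0).
  have : ~ 1 <= ord x (f - iota c) by move=> h; apply: H; exists c; right.
  by lia.
move: Rf; rewrite Rr pevalZ rmorph_prod.
have E c : peval iota f ('X - c%:P) = f - iota c by rewrite rmorphB /= pevalX pevalC.
rewrite (eq_bigr (fun c => f - iota c)) => [|c _]; last exact: E.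
have p0 : \prod_(c <- r) (f - iota c) != 0.
  by rewrite prodf_seq_neq0; apply/allP => c _ /=; case: (nz c).
have l0 : iota (lead_coef R) != 0 by rewrite fmorph_eq0 lead_coef_eq0.
rewrite max_powP ?mulf_neq0 // ordM // ord_const ord_prod => [|c _]; last by case: (nz c).
by rewrite big1 // => c _; case: (nz c).
Qed.

Lemma expansion x s f (M : nat) : ord x s = 1 -> max_pow x 0 f ->
  exists g : {poly k}, max_pow x M (f - peval iota s g).
Proof.
move=> hs hf; have s0 : s != 0 by apply: contra_eq_neq hs => ->; rewrite ord0E.
elim: M => [|M [g hg]]; first by exists 0; rewrite (rmorph0 (peval iota s)) subr0.
have [|c hc] := @residue x ((f - peval iota s g) / s ^+ M).
  rewrite -[0](subrr M%:Z); apply: max_powM => //.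
  by right; rewrite ordV ordX hs natz.
exists (g + c *: 'X^M); rewrite rmorphD /= pevalZ rmorphXn /= pevalX opprD addrA.
have -> : f - peval iota s g - iota c * s ^+ M =
    s ^+ M * ((f - peval iota s g) / s ^+ M - iota c).
  by rewrite mulrBr mulrCA mulfV ?expf_neq0 // mulr1 [_ * iota c]mulrC.
rewrite -addn1 PoszD; apply: max_powM => //.
by right; rewrite ordX hs natz.
Qed.

End FunctionFieldPlaces.

(** * Derivations *)

Section Derivations.

(** Frobenius is additive. The coefficient ring is general because both [k] and [{poly k}] occur. *)
Lemma poly_pth_root (R : comNzRingType) (p : nat) (P : {poly R}) (r : nat -> R) :
  p \in [pchar R] -> (forall i, ~~ (p %| i)%N -> P`_i = 0) ->
  (forall i, r i ^+ p = P`_(p * i)) -> (\poly_(i < size P) r i) ^+ p = P.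
Proof.
move=> hp h0 hr; have p_gt0 : (0 < p)%N by rewrite prime_gt0 // (pcharf_prime hp).
have hpP : p \in [pchar {poly R}] by rewrite pchar_poly.
rewrite poly_def -(pFrobenius_autE hpP) rmorph_sum /=.
transitivity (\sum_(i < size P) P`_(p * i) *: 'X^(p * i)).
  by apply: eq_bigr => i _; rewrite pFrobenius_autE exprZn hr -exprM mulnC.
apply/polyP => n; rewrite coef_sum.
have [/dvdnP[m e]|ndvd] := boolP (p %| n)%N; last first.
  rewrite h0 // big1 // => i _; rewrite coefZ coefXn.
  by case: eqP => [e|_]; rewrite ?mulr0 //; rewrite e dvdn_mulr in ndvd.
have [ms|ms] := ltnP m (size P).
  rewrite (bigD1 (Ordinal ms)) //= big1 => [|i].
    by rewrite coefZ coefXn e [(m * p)%N]mulnC eqxx mulr1 addr0.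
  rewrite -val_eqE /= => im; rewrite coefZ coefXn e [(m * p)%N]mulnC eqn_pmul2l // eq_sym.
  by rewrite (negPf im) mulr0.
rewrite nth_default; last by rewrite e (leq_trans ms) // leq_pmulr.
rewrite big1 // => i _; rewrite coefZ coefXn e [(m * p)%N]mulnC eqn_pmul2l //.
by rewrite gtn_eqF ?mulr0 // (leq_trans (ltn_ord i)).
Qed.

Section Bivariate.
Variables (k F : fieldType) (iota : {rmorphism k -> F}).
Implicit Types (s f g : F) (P Q : {poly {poly k}}).

Definition peval2 s f : {poly {poly k}} -> F := horner_eval f \o map_poly (peval iota s).
HB.instance Definition _ s f :=
  GRing.RMorphism.copy (peval2 s f) (horner_eval f \o map_poly (peval iota s)).

Lemma peval2C s f c : peval2 s f c%:P = peval iota s c.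
Proof. by rewrite /peval2 /= /horner_eval map_polyC hornerC. Qed.

Lemma peval2X s f : peval2 s f 'X = f.
Proof. by rewrite /peval2 /= /horner_eval map_polyX hornerX. Qed.

Lemma peval2E s f P : peval2 s f P = \sum_(i < size P) peval iota s P`_i * f ^+ i.
Proof.
rewrite {1}(_ : P = \sum_(i < size P) P`_i *: 'X^i); last by rewrite -poly_def coefK.
rewrite rmorph_sum; apply: eq_bigr => i _ /=.
by rewrite -mul_polyC rmorphM /= peval2C rmorphXn /= peval2X.
Qed.

Lemma peval2_horner s P (g : {poly k}) : peval2 s (peval iota s g) P = peval iota s P.[g].
Proof. by rewrite /peval2 /= /horner_eval horner_map. Qed.

(** The partial derivative in the inner variable, which [peval2] evaluates at [s]. *)
Definition derivS (P : {poly {poly k}}) : {poly {poly k}} := map_poly (@deriv k) P.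

Lemma derivSMXaddC P c : derivS (P * 'X + c%:P) = derivS P * 'X + c^`()%:P.
Proof.
apply/polyP => i; rewrite coefD coefMX coefC !coef_map_id0 ?linear0 //.
by rewrite coefD coefMX coefC; case: i => [|i] /=; rewrite ?add0r ?addr0 // coef_map_id0 ?linear0.
Qed.

Lemma deriv_horner2 P (g : {poly k}) :
  (P.[g])^`() = (derivS P).[g] + (P^`()).[g] * g^`().
Proof.
elim/poly_ind: P => [|P c IH].
  by rewrite /derivS map_poly0 linear0 !horner0 mul0r addr0 linear0.
rewrite derivSMXaddC derivD derivC derivM derivX !(hornerE, derivE) IH.
by ring.
Qed.

(** With values in an extension [F'], the notion also covers the restriction to [F] of a derivation
    of [F'], as the cover requires. *)
Definition derivation_along (F' : fieldType) (j : {rmorphism F -> F'}) (d : F -> F') :=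
  [/\ forall f h, d (f + h) = d f + d h,
      forall f h, d (f * h) = d f * j h + j f * d h
    & forall c, d (iota c) = 0].

Lemma derivation_along_id (D : der iota) : derivation_along idfun D.
Proof. by case: (derP D). Qed.

Lemma der_0 (D : der iota) : D 0 = 0.
Proof. by case: (derP D) => _ _ /(_ 0); rewrite rmorph0. Qed.

Section Along.
Variables (F' : fieldType) (j : {rmorphism F -> F'}) (d : F -> F').
Hypothesis hd : derivation_along j d.

Lemma along0 : d 0 = 0.
Proof. by case: hd => _ _ /(_ 0); rewrite rmorph0. Qed.

Lemma along_peval s (P : {poly k}) : d (peval iota s P) = j (peval iota s P^`()) * d s.
Proof.
have [dD dM dC] := hd; elim/poly_ind: P => [|P c IH].
  by rewrite linear0 !rmorph0 mul0r along0.
rewrite !rmorphD !rmorphM /= pevalX pevalC dD dC addr0 dM IH.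
by rewrite derivD derivC derivM derivX mulr1 addr0 !rmorphD !rmorphM /= pevalX; ring.
Qed.

Lemma along_peval2 s f P : d (peval2 s f P) =
  j (peval2 s f (derivS P)) * d s + j (peval2 s f P^`()) * d f.
Proof.
have [dD dM dC] := hd; elim/poly_ind: P => [|P c IH].
  by rewrite /derivS map_poly0 linear0 !rmorph0 !mul0r addr0 along0.
rewrite derivSMXaddC derivD derivC derivM derivX mulr1 addr0.
rewrite !(rmorphD, rmorphM) /= !peval2X !peval2C dD dM IH along_peval.
by ring.
Qed.

End Along.
End Bivariate.

(** * Separating relations and derivatives at a place *)

Section Separating.
Variables (k : closedFieldType) (F : fieldType) (iota : {rmorphism k -> F}).
Variables (p : nat) (hp : p \in [pchar k]).
Implicit Types (x : place iota) (s f g : F) (P Q : {poly {poly k}}).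
Hypothesis hF : function_field iota.

Lemma pth_root (c : k) : exists r, r ^+ p = c.
Proof.
have p_gt0 : (0 < p)%N by rewrite prime_gt0 // (pcharf_prime hp).
have [r hr] := solve_monicpoly (fun i => if i == 0%N then c else 0) p_gt0.
exists r; rewrite hr; case: (p) p_gt0 => // q _.
rewrite big_ord_recl big1 ?addr0 ?mulr1 //= => i _; exact: mul0r.
Qed.

(* A relation of minimal total degree: if both partial derivatives vanish
   identically, the relation is a p-th power. *)
Lemma separating_relation s f : exists P, peval2 iota s f P = 0 /\
  (peval2 iota s f (derivS P) != 0 \/ peval2 iota s f P^`() != 0).
Proof.
have [P [P0 rel]] : exists P, P != 0 /\ peval2 iota s f P = 0.
  have [C HC] := poly_dependence hF s.
  have [P [[j Pj] rel]] := HC (fun j => f ^+ j).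
  exists (\sum_(i < C.+1) (P i) *: 'X^i); split.
    apply: contra_neq Pj => /(congr1 (fun Q : {poly {poly k}} => Q`_j)).
    rewrite coef0 coef_sum (bigD1 j) //= coefZ coefXn eqxx mulr1 big1 ?addr0 // => i.
    by rewrite -val_eqE /= coefZ coefXn eq_sym => /negPf->; rewrite mulr0.
  rewrite rmorph_sum -[RHS]rel; apply: eq_bigr => i _ /=.
  by rewrite -mul_polyC rmorphM /= peval2C rmorphXn /= peval2X.
have [n tdeg] : exists n, forall i j, P`_i`_j != 0 -> (i + j < n)%N.
  exists (size P + \max_(i < size P) size (P`_i)%R)%N => i j Pij.
  have iP : (i < size P)%N.
    by rewrite ltnNge; apply: contraNN Pij => /(nth_default 0)->; rewrite coef0.
  have jP : (j < size (P`_i)%R)%N.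
    by rewrite ltnNge; apply: contraNN Pij => /(nth_default 0)->.
  have h := leq_bigmax (F := fun i : 'I_(size P) => size (P`_i)%R) (Ordinal iP).
  by rewrite -addSn leq_add // (leq_trans (ltnW jP) h).
have tdeg0 Q m : (forall i j, Q`_i`_j != 0 -> (i + j < m)%N) -> (m <= 1)%N ->
    Q = (Q`_0`_0)%:P%:P.
  move=> H m1; apply/polyP => i; apply/polyP => j; rewrite coefC.
  have [->|i0] := eqVneq i 0%N; rewrite ?coefC ?coef0.
    have [->//|j0] := eqVneq j 0%N.
    by apply/eqP; apply: contraT => h; have := H _ _ h; lia.
  by rewrite if_same; apply/eqP; apply: contraT => h; have := H _ _ h; lia.
have p_pr : prime p := pcharf_prime hp.
elim: n P P0 rel tdeg => [|n IH] P P0 rel tdeg.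
  have e := tdeg0 _ _ tdeg isT; case: (negP P0); apply/eqP; rewrite e.
  have [->//|/tdeg//] := eqVneq P`_0`_0 0.
have [n0|n_gt0] := posnP n.
  subst n; have e := tdeg0 _ _ tdeg isT.
  move: rel; rewrite e peval2C pevalC => /eqP; rewrite fmorph_eq0 => /eqP c0.
  by rewrite e c0 in P0; rewrite eqxx in P0.
have [PS|PS0] := eqVneq (peval2 iota s f (derivS P)) 0; last by exists P; split=> //; left.
have [PF|PF0] := eqVneq (peval2 iota s f P^`()) 0; last by exists P; split=> //; right.
have coefS Q i j : (derivS Q)`_i`_j = Q`_i`_j.+1 *+ j.+1.
  by rewrite coef_map_id0 ?linear0 // coef_deriv.
(* A nonzero partial derivative that vanishes at [(s, f)] is a relation of smaller total degree, so
   both may be assumed to be zero as polynomials. *)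
have [S0|S0] := eqVneq (derivS P) 0; last first.
  apply: (IH (derivS P)) => // i j; rewrite coefS => h.
  by have /tdeg : P`_i`_j.+1 != 0 by [apply: contraNneq h => ->; rewrite mul0rn]; lia.
have [F0|F0] := eqVneq P^`() 0; last first.
  apply: (IH P^`()) => // i j; rewrite coef_deriv coefMn => h.
  by have /tdeg : P`_i.+1`_j != 0 by [apply: contraNneq h => ->; rewrite mul0rn]; lia.
have mulk (c : k) m : ~~ (p %| m)%N -> c *+ m = 0 -> c = 0.
  move=> pm /eqP; rewrite -mulr_natr mulf_eq0 => /orP[/eqP//|].
  by rewrite -(dvdn_pcharf hp) (negPf pm).
have hi i j : ~~ (p %| i)%N -> P`_i`_j = 0.
  case: i => [|i pi]; first by rewrite dvdn0.
  apply: (mulk _ i.+1) => //.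
  by have := congr1 (fun Q : {poly {poly k}} => Q`_i`_j) F0; rewrite /= coef_deriv coefMn !coef0.
have hj i j : ~~ (p %| j)%N -> P`_i`_j = 0.
  case: j => [|j pj]; first by rewrite dvdn0.
  apply: (mulk _ j.+1) => //.
  by have := congr1 (fun Q : {poly {poly k}} => Q`_i`_j) S0; rewrite /= coefS !coef0.
have [r hr] := choice pth_root.
pose R i := \poly_(j < size (P`_(p * i))%R) r P`_(p * i)`_(p * j).
have hR i : R i ^+ p = P`_(p * i).
  by apply: poly_pth_root => // j; apply: hj.
pose Q := \poly_(i < size P) R i.
have hQ : Q ^+ p = P.
  apply: poly_pth_root => // [|i pi]; first by rewrite pchar_poly.
  by apply/polyP => j; rewrite coef0 hi.
apply: (IH Q).
- by apply: contraNneq P0 => e; rewrite -hQ e expr0n -leqn0 leqNgt prime_gt0.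
- by apply/eqP; have := rel; rewrite -hQ rmorphXn /= => /eqP; rewrite expf_eq0 prime_gt0.
move=> i j; rewrite coef_poly; case: ltnP => _; last by rewrite coef0 eqxx.
rewrite coef_poly; case: ltnP => _; last by rewrite eqxx.
move=> rn; have /tdeg : P`_(p * i)`_(p * j) != 0.
  by rewrite -(hr P`_(p * i)`_(p * j)) expf_neq0.
by have := prime_gt1 p_pr; nia.
Qed.

(** Differentiating [P(t, f) = 0] with [d] and with [D] gives the same linear equation, up to the
    factor [d t], for [d f] and [D f]. Its leading coefficient is nonzero: if the partial derivative
    in [f] vanished, [D t = 1] would make the other one vanish as well. *)
Lemma derivation_unique (F' : fieldType) (j : {rmorphism F -> F'}) (d : F -> F')
    (D : der iota) t f : derivation_along iota j d -> D t = 1 -> d f = j (D f) * d t.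
Proof.
move=> hd Dt; have [P [rel sep]] := separating_relation t f.
have e1 := along_peval2 hd t f P; have e2 := along_peval2 (derivation_along_id D) t f P.
have [_ _ dC] := hd; have [_ _ DC] := derP D.
rewrite rel (along0 hd) in e1.
rewrite rel der_0 Dt mulr1 /= in e2.
have PF0 : peval2 iota t f P^`() != 0.
  case: sep => // PS; apply: contraNneq PS => PF.
  by rewrite PF mul0r addr0 in e2; rewrite -e2.
have jPF0 : j (peval2 iota t f P^`()) != 0 by rewrite fmorph_eq0.
apply: (mulfI jPF0); move/eqP: e2; rewrite eq_sym addr_eq0 => /eqP e2.
rewrite e2 rmorphN rmorphM mulNr /= in e1.
by move/eqP: e1; rewrite eq_sym addrC subr_eq0 => /eqP->; ring.
Qed.

Lemma max_pow_peval2 x n s f g P : max_pow x 0 s -> max_pow x 0 f -> max_pow x 0 g ->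
  max_pow x n (f - g) -> max_pow x n (peval2 iota s f P - peval2 iota s g P).
Proof.
move=> hs hf hg hn; rewrite !peval2E -sumrB.
apply: max_pow_sum => i _; rewrite -mulrBr; apply: max_powMl; first exact: max_pow_peval.
rewrite subrXX; apply: max_powMr => //; apply: max_pow_sum => j _.
by apply: max_powMl; [have := max_powX (i.-1 - j) hf|have := max_powX j hg]; rewrite mul0rn.
Qed.

Lemma max_pow_peval2_0 x s f P : max_pow x 0 s -> max_pow x 0 f ->
  max_pow x 0 (peval2 iota s f P).
Proof.
move=> hs hf; rewrite peval2E; apply: max_pow_sum => i _.
apply: max_powMl; first exact: max_pow_peval.
by have := max_powX i hf; rewrite mul0rn.
Qed.

(* Differentiating P(s, g(s)) = O(s^(M+1)), where [g] is a truncated expansion of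
   [f], shows that [P_F(s,f)] is nonzero. *)
Lemma local_relation x s f : ord x s = 1 -> max_pow x 0 f ->
  exists P, [/\ peval2 iota s f P = 0, peval2 iota s f P^`() != 0 &
    forall M : nat, exists g : {poly k}, max_pow x M (f - peval iota s g) /\
      max_pow x M (peval2 iota s f (derivS P) +
                   peval2 iota s f P^`() * peval iota s g^`())].
Proof.
move=> hs hf; have [P [rel sep]] := separating_relation s f.
have hs0 : max_pow x 0 s by right; rewrite hs.
have approx (M : nat) : exists g : {poly k}, max_pow x M (f - peval iota s g) /\
    max_pow x M (peval2 iota s f (derivS P) + peval2 iota s f P^`() * peval iota s g^`()).
  (* One order more than [M], since differentiation loses one. *)
  have [g hg] := expansion hF M.+1 hs hf; exists g.
  have hg0 := max_pow_peval g hs0.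
  have small Q : max_pow x M.+1 (peval2 iota s f Q - peval2 iota s (peval iota s g) Q).
    exact: max_pow_peval2.
  split; first by apply: max_powW hg; lia.
  have c0 i : (i < M.+1)%N -> (P.[g])`_i = 0.
    apply: (@peval_coef0 _ _ _ x s); rewrite hs // natz -peval2_horner.
    by have := small P; rewrite rel sub0r => /max_powN; rewrite opprK.
  have : max_pow x M (peval iota s (P.[g])^`()).
    rewrite (peval_coef _ _ (leqnn _)); apply: max_pow_sum => i _.
    have [iM|Mi] := ltnP i M.
      by rewrite coef_deriv c0 // mul0rn rmorph0 mul0r; left.
    apply: max_powMl; first exact: max_pow_const.
    by right; rewrite ordX hs natz; lia.
  rewrite deriv_horner2 rmorphD rmorphM /= -!peval2_horner => h.
  have := max_powD (max_powD h (max_powW _ (small (derivS P))))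
    (max_powMr (max_powW _ (small P^`())) (max_pow_peval g^`() hs0)).
  have E (u v a b c : F) : u + v * c + (a - u) + (b - v) * c = a + b * c by ring.
  rewrite E.
  by apply; lia.
(* Otherwise [derivS P] vanishes at [(s, f)] to every order, against the choice of [P]. *)
have PF0 : peval2 iota s f P^`() != 0.
  case: sep => // PS; apply: contraNneq PS => PF; apply/eqP/(@max_pow_all _ _ _ x) => M.
  by have [g [_]] := approx M; rewrite PF mul0r addr0.
by exists P.
Qed.

(** If [D s = 0], the relation of [local_relation] shows that [D] kills every function integral at
    [x], and every nonzero function or its inverse is integral there. *)
Lemma der_uniformizer x s (D : der iota) : ord x s = 1 -> (exists f, D f != 0) -> D s != 0.
Proof.
move=> hs [f]; apply: contraNneq => Ds.
have [dD dM dC] := derP D.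
have D0 h : max_pow x 0 h -> D h = 0.
  move=> hh; have [P [rel PF _]] := local_relation hs hh.
  have := along_peval2 (derivation_along_id D) s h P.
  rewrite rel Ds mulr0 add0r der_0 => /esym/eqP.
  by rewrite /= mulf_eq0 (negPf PF) => /eqP.
have [->|f0] := eqVneq f 0; first by rewrite der_0.
have [h|h] := leP 0 (ord x f); first by rewrite D0 //; right.
have := dM f f^-1; rewrite mulfV // -(rmorph1 iota) dC (D0 f^-1); last first.
  by right; rewrite ordV; lia.
by rewrite mulr0 addr0 => /esym/eqP; rewrite mulf_eq0 invr_eq0 (negPf f0) orbF.
Qed.

(** Let [P_S], [P_F] be the values of the partial derivatives. Then [P_F D f] equals [- P_S], and so
    does [P_F g'(s)] up to a small error; dividing by [P_F] costs its order, which is added to the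
    precision in advance. *)
Lemma der_expansion x s (D : der iota) f (M : nat) : ord x s = 1 -> D s = 1 -> max_pow x 0 f ->
  exists g : {poly k}, max_pow x M (f - peval iota s g) /\
    max_pow x M (D f - peval iota s g^`()).
Proof.
move=> hs Ds hf; have [P [rel PF approx]] := local_relation hs hf.
have hPF := max_pow_ord PF (max_pow_peval2_0 P^`() (or_intror _) hf); rewrite hs in hPF.
have [g [g1 g2]] := approx (M + `|ord x (peval2 iota s f P^`())|)%N; exists g; split.
  by apply: max_powW g1; lia.
have [_ _ dC] := derP D.
have := along_peval2 (derivation_along_id D) s f P.
rewrite rel Ds mulr1 der_0 => /esym/eqP; rewrite addr_eq0 /= => /eqP e.
move: g2; rewrite e addrC -mulrBr -opprB mulrN => /max_powN; rewrite opprK.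
by rewrite max_pow_divl //; apply: max_powW; have := hPF isT; lia.
Qed.

Lemma der_integral x s (D : der iota) f : ord x s = 1 -> D s = 1 ->
  max_pow x 0 f -> max_pow x 0 (D f).
Proof.
move=> hs Ds hf; have [g [_ h]] := der_expansion 0 hs Ds hf.
rewrite -(subrK (peval iota s g^`()) (D f)); apply: max_powD h _.
by apply: max_pow_peval; right; rewrite hs.
Qed.

Lemma dlog_mul (D : der iota) f g : f != 0 -> g != 0 ->
  D (f * g) / (f * g) = D f / f + D g / g.
Proof.
by case: (derP D) => _ dM _ f0 g0; rewrite dM; field; rewrite f0 g0.
Qed.

Lemma dlog_exp (D : der iota) f (i : nat) : f != 0 ->
  D (f ^+ i) / f ^+ i = i%:R * (D f / f).
Proof.
move=> f0; elim: i => [|i IH].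
  by case: (derP D) => _ _ dC; rewrite expr0 -(rmorph1 iota) dC !mul0r.
by rewrite exprS dlog_mul ?expf_neq0 // IH -addn1 natrD; ring.
Qed.

(** The residue of [df / f] is the order of [f]: a power of [s] contributes its exponent, a unit
    nothing. *)
Lemma der_dlog x s (D : der iota) f : ord x s = 1 -> D s = 1 -> f != 0 ->
  max_pow x 1 (s * (D f / f) - (ord x f)%:~R).
Proof.
move=> hs Ds f0; have s0 : s != 0 by apply: contra_eq_neq hs => ->; rewrite ord0E.
have unit u : u != 0 -> ord x u = 0 -> max_pow x 1 (s * (D u / u)).
  move=> u0 ou; rewrite -[1]addr0; apply: max_powM; first by right; rewrite hs.
  apply: max_powMl; last by right; rewrite ordV ou.
  by apply: (der_integral hs Ds); right; rewrite ou.
have sE (i : nat) : s * (i%:R * (1 / s)) = i%:R by field.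
case e: (ord x f) => [i|i].
  have := unit (f / s ^+ i); rewrite mulf_neq0 ?invr_eq0 ?expf_neq0 //.
  rewrite ord_div ?expf_neq0 // ordX e hs natz subrr => /(_ isT erefl).
  have := dlog_exp D i s0; rewrite Ds.
  have := @dlog_mul D (f / s ^+ i) (s ^+ i).
  rewrite mulf_neq0 ?invr_eq0 ?expf_neq0 // divfK ?expf_neq0 // => -> // -> h.
  by rewrite mulrDr sE addrK.
have := unit (f * s ^+ i.+1); rewrite mulf_neq0 ?expf_neq0 //.
rewrite ordM ?expf_neq0 // ordX e hs NegzE natz addNr => /(_ isT erefl).
rewrite dlog_mul ?expf_neq0 // dlog_exp // Ds mulrDr sE.
by rewrite rmorphN opprK.
Qed.

Lemma der_local x s (D : der iota) n f : ord x s = 1 -> D s = 1 ->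
  max_pow x n f -> max_pow x (n - 1) (D f).
Proof.
move=> hs Ds; have s0 : s != 0 by apply: contra_eq_neq hs => ->; rewrite ord0E.
have [->|f0] := eqVneq f 0; first by rewrite der_0; left.
move/(max_pow_ord f0) => nf.
have h : max_pow x 0 (s * (D f / f)).
  rewrite -(subrK ((ord x f)%:~R) (s * _)); apply: max_powD.
    by apply: max_powW (der_dlog hs Ds f0).
  by rewrite -(rmorph_int iota); apply: max_pow_const.
have -> : D f = (f / s) * (s * (D f / f)) by field; rewrite f0 s0.
by apply: max_powMr => //; right; rewrite ord_div // hs; lia.
Qed.

End Separating.
End Derivations.

(** * Jacobson's formula *)

Section Jacobson.
Variables (k F : fieldType) (iota : {rmorphism k -> F}) (D : der iota) (w : F).

(* The coefficient of [lambda ^ i] in [(D + lambda w)^m 1]. *)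
Fixpoint bell (m i : nat) : F :=
  if m is m'.+1 then D (bell m' i) + w * (if i is i'.+1 then bell m' i' else 0)
  else (i == 0%N)%:R.

Let dD : {morph D : f h / f + h}. Proof. by case: (derP D). Qed.
Let dM f h : D (f * h) = D f * h + f * D h. Proof. by case: (derP D). Qed.
Let d0 : D 0 = 0. Proof. exact: der_0. Qed.

Lemma der_natmul f (n : nat) : D (f *+ n) = D f *+ n.
Proof. by elim: n => [|n IH]; rewrite ?mulr0n // !mulrS dD IH. Qed.

Lemma der_1 : D 1 = 0.
Proof. by case: (derP D) => _ _ /(_ 1); rewrite rmorph1. Qed.

(** These are the coefficients of the derivative in [lambda] of [(D + lambda w)^m 1], which is the
    sum of [C(m, j+1) D^j(w) (D + lambda w)^(m-j-1) 1]. For [m = p] all binomials but the last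
    vanish. *)
Lemma bell_deriv m i : bell m i.+1 *+ i.+1 =
  \sum_(j < m) (iter j D w * bell (m - j.+1) i) *+ 'C(m, j.+1).
Proof.
elim: m i => [|m IH] i; first by rewrite big_ord0 /= mul0rn.
transitivity (w * bell m i +
    \sum_(j < m) (iter j.+1 D w * bell (m - j.+1) i) *+ 'C(m, j.+1) +
    \sum_(j < m) (iter j D w * bell (m - j) i) *+ 'C(m, j.+1)).
  rewrite /= mulrnDl -der_natmul IH (big_morph D dD d0).
  have -> : w * bell m i *+ i.+1 = w * bell m i +
      \sum_(j < m) (iter j D w * (w * (if i is i'.+1 then bell (m - j.+1) i' else 0)))
        *+ 'C(m, j.+1).
    rewrite mulrS; congr (_ + _); case: i => [|i].
      by rewrite mulr0n big1 // => j _; rewrite !mulr0 mul0rn.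
    rewrite -mulrnAr IH mulr_sumr; apply: eq_bigr => j _.
    by rewrite mulrnAr mulrCA.
  rewrite addrCA -addrA; congr (_ + _); rewrite -!big_split /=.
  apply: eq_bigr => j _; rewrite der_natmul dM -!mulrnDl; congr (_ *+ _).
  rewrite -addrA -mulrDr; congr (_ + _ * _).
  by have -> : (m - j = (m - j.+1).+1)%N by rewrite subnSK.
pose T j := iter j D w * bell (m - j) i.
transitivity (\sum_(j < m.+1) T j *+ 'C(m, j.+1) + \sum_(j < m.+1) T j *+ 'C(m, j)).
  rewrite big_ord_recr bin_small // mulr0n /= addr0.
  by rewrite [X in _ = _ + X]big_ord_recl /= bin0 /T subn0 addrC.
by rewrite -big_split /=; apply: eq_bigr => j _; rewrite binS mulrnDr.
Qed.

Lemma bell_gt m i : (m < i)%N -> bell m i = 0.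
Proof.
elim: m i => [|m IH] [|i] //= mi; rewrite !IH ?d0 ?mulr0 ?addr0 //; exact: ltnW.
Qed.

Lemma bell_diag m : bell m m = w ^+ m.
Proof. by elim: m => [|m IH] //=; rewrite bell_gt // d0 add0r IH exprS. Qed.

Lemma bell_0 m : bell m.+1 0 = 0.
Proof.
elim: m => [|m IH]; first by rewrite /= mulr0 addr0; exact: der_1.
by rewrite -[LHS]/(D (bell m.+1 0) + w * 0) IH d0 mulr0 addr0.
Qed.

Lemma sum_bellS m : \sum_(i < m.+2) bell m.+1 i =
  D (\sum_(i < m.+1) bell m i) + w * \sum_(i < m.+1) bell m i.
Proof.
rewrite /= big_split /= big_ord_recr /= bell_gt // d0 addr0.
rewrite -(big_morph D dD d0) [X in _ + X]big_ord_recl mulr0 add0r; congr (_ + _).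
by rewrite mulr_sumr.
Qed.

Lemma iter_der_bell u m : D u = w * u -> iter m D u = u * \sum_(i < m.+1) bell m i.
Proof.
move=> Du; elim: m => [|m IH]; first by rewrite big_ord1 mulr1.
by rewrite iterS IH sum_bellS dM Du; ring.
Qed.

Lemma jacobson_formula (p : nat) u : p \in [pchar k] -> D u = w * u ->
  iter p D u = u * (iter p.-1 D w + w ^+ p).
Proof.
move=> hp Du; rewrite (iter_der_bell _ Du); congr (_ * _).
have hpF : p \in [pchar F] by rewrite (fmorph_pchar iota).
have p_pr := pcharf_prime hp.
have E i : bell p i.+1 *+ i.+1 = iter p.-1 D w * (i == 0%N)%:R.
  rewrite bell_deriv; case: p hp p_pr hpF => // q _ p_pr hpF.
  rewrite big_ord_recr big1 /= => [|j _]; first by rewrite binn subnn add0r mulr1n.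
  have /dvdnP[c ->] : (q.+1 %| 'C(q.+1, j.+1))%N by apply: prime_dvd_bin; rewrite //= ltnS.
  by rewrite mulrnA (mulrn_pchar hpF).
have p_gt1 := prime_gt1 p_pr.
have b1 : bell p 1 = iter p.-1 D w by rewrite -[LHS]mulr1n E mulr1.
(* For these [i] the factor [i] is invertible; only the coefficients of index 0, 1 and [p]
   remain. *)
have bi i : (1 < i < p)%N -> bell p i = 0.
  case: i => // i /andP[i1 ip]; have /eqP := E i.
  rewrite gtn_eqF // mulr0 -mulr_natr mulf_eq0 => /orP[/eqP//|].
  by rewrite -(dvdn_pcharf hpF) => /dvdn_leq => /(_ isT); rewrite leqNgt ip.
case: p p_gt1 b1 bi {hp p_pr hpF E} => [|[|q]] // _ b1 bi.
rewrite -b1 -bell_diag big_ord_recr; congr (_ + _).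
rewrite big_ord_recl -[RHS]add0r; congr (_ + _); first exact: bell_0.
rewrite big_ord_recl big1 => [|i _]; first exact: addr0.
by apply: bi; rewrite /= /bump !add1n !ltnS /=.
Qed.

End Jacobson.

(** * Finiteness of ramification *)

Section Ramification.
Variables (k : closedFieldType) (F : fieldType) (iota : {rmorphism k -> F}).
Variables (p : nat) (hp : p \in [pchar k]).
Implicit Types (x : place iota) (s t f g : F).
Hypothesis hF : function_field iota.
Variables (D : der iota) (t : F).
Hypothesis Dt : D t = 1.

Lemma der_const c : D (iota c) = 0. Proof. by case: (derP D). Qed.

(** Over an algebraically closed field a nontrivial equation [P(t) = 0] would make [t] a constant,
    which [D] kills. *)
Lemma peval_eq0 (P : {poly k}) : peval iota t P = 0 -> P = 0.
Proof.
have [r ->] := closed_field_poly_normal P.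
rewrite pevalZ rmorph_prod => /eqP; rewrite mulf_eq0 fmorph_eq0 => /orP[/eqP->|].
  by rewrite scale0r.
rewrite prodf_seq_eq0 => /hasP[c _ /=].
rewrite rmorphB /= pevalX pevalC subr_eq0 => /eqP tc.
by have := Dt; rewrite tc der_const => /esym/eqP; rewrite oner_eq0.
Qed.

(** The generators supplied by [function_field] may belong to another transcendental element. A
    maximal family independent over [k[t]] replaces them; it exists because [poly_dependence] bounds
    the length. *)
Lemma generators : exists (N : nat) (b : 'I_N -> F), forall f,
  exists (q : {poly k}) (A : 'I_N -> {poly k}),
    q != 0 /\ peval iota t q * f = \sum_j peval iota t (A j) * b j.
Proof.
have [C HC] := poly_dependence hF t.
pose indep n := exists b : 'I_n -> F, forall P : 'I_n -> {poly k},
  \sum_j peval iota t (P j) * b j = 0 -> forall j, P j = 0.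
have [N [[b bfree] Nmax]] : exists n, indep n /\ ~ indep n.+1.
  apply: contrapT => H.
  have all_indep n : indep n.
    elim: n => [|n IH]; first by exists (fun=> 0) => P _ [].
    by apply: contrapT => Hn; apply: H; exists n.
  have [b bfree] := all_indep C.+1; have [P [[j /eqP Pj] rel]] := HC b.
  exact/Pj/bfree.
exists N, b => f.
pose b' (i : 'I_N.+1) := if unlift ord0 i is Some j then b j else f.
have b'0 : b' ord0 = f by rewrite /b' unlift_none.
have b'S j : b' (lift ord0 j) = b j by rewrite /b' liftK.
have [P nP] : exists P : 'I_N.+1 -> {poly k},
    ~ (\sum_j peval iota t (P j) * b' j = 0 -> forall j, P j = 0).
  by apply/existsNP => H; apply: Nmax; exists b'.
have [rel /existsNP[j Pj]] : \sum_j peval iota t (P j) * b' j = 0 /\ ~ forall j, P j = 0.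
  by split; [apply: contrapT => h|move=> h]; apply: nP.
rewrite big_ord_recl b'0 in rel.
have eqS : \sum_(i < N) peval iota t (P (lift ord0 i)) * b' (lift ord0 i) =
   \sum_(i < N) peval iota t (P (lift ord0 i)) * b i.
  by apply: eq_bigr => i _; rewrite b'S.
rewrite eqS in rel.
exists (P ord0), (fun i => - P (lift ord0 i)); split.
  apply/eqP => P0; apply: Pj; rewrite P0 rmorph0 mul0r add0r in rel.
  have := bfree (fun i => P (lift ord0 i)) rel => PS.
  by have [i ->|->] := unliftP ord0 j.
apply/eqP; rewrite -subr_eq0 -[X in _ == X]rel; apply/eqP; congr (_ + _).
by rewrite -sumrN; apply: eq_bigr => i _; rewrite /= rmorphN mulNr opprK.
Qed.

Lemma taylor2 x y d P : max_pow x 0 t -> max_pow x 0 y -> max_pow x 0 d ->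
  exists R, max_pow x 0 R /\ peval2 iota t (y + d) P =
    peval2 iota t y P + d * peval2 iota t y P^`() + d ^+ 2 * R.
Proof.
move=> ht hy hd; elim/poly_ind: P => [|P c [R [hR IH]]].
  by exists 0; split; [left|rewrite linear0 !rmorph0; ring].
exists (R * (y + d) + peval2 iota t y P^`()); split.
  apply: max_powD; last exact: max_pow_peval2_0.
  by apply: max_powMl => //; apply: max_powD.
rewrite derivD derivC derivM derivX mulr1 addr0.
rewrite !(rmorphD, rmorphM) /= !peval2X !peval2C IH; ring.
Qed.

(** * Expansions in [t - t0] at a place *)

Section AtPlace.
Variables (x : place iota) (t0 : k).
Hypothesis ht0 : max_pow x 1 (t - iota t0).
Let tau := t - iota t0.
Let e := ord x tau.

Let tau_neq0 : tau != 0.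
Proof.
apply: contra_eq_neq Dt => /eqP; rewrite subr_eq0 => /eqP->.
by rewrite der_const eq_sym oner_eq0.
Qed.

Let e_gt0 : 0 < e.
Proof. by have := max_pow_ord tau_neq0 ht0; rewrite -/e; lia. Qed.

Let ht : max_pow x 0 t.
Proof.
rewrite -(subrK (iota t0) t); apply: max_powD; last exact: max_pow_const.
by apply: max_powW ht0.
Qed.

(** Each linear factor of [q] evaluates to [tau] or to a unit. *)
Lemma dvd_ord_peval q : peval iota t q != 0 -> (e %| ord x (peval iota t q))%Z.
Proof.
have [r ->] := closed_field_poly_normal q.
rewrite pevalZ mulf_eq0 => /norP[c0 r0]; rewrite ordM // ord_const add0r.
rewrite rmorph_prod /= in r0 *.
rewrite ord_prod => [|a ar]; last first.
  by move: r0; rewrite prodf_seq_neq0 => /allP/(_ _ ar).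
apply: rpred_sum => a _; rewrite rmorphB /= pevalX pevalC.
have [->|at0] := eqVneq a t0; first exact: dvdzz.
have -> : t - iota a = iota (t0 - a) + tau by rewrite rmorphB /tau; ring.
have c1 : iota (t0 - a) != 0 by rewrite fmorph_eq0 subr_eq0 eq_sym.
have [] := @ord_addl _ _ _ x (iota (t0 - a)) tau c1.
  by rewrite ord_const.
by move=> _ ->; rewrite ord_const dvdz0.
Qed.

Section Root.
Variables (y : F) (P : {poly {poly k}}).
Hypothesis hy : max_pow x 0 y.
Hypothesis rel : peval2 iota t y P = 0.
Hypothesis PF0 : peval2 iota t y P^`() != 0.
Hypothesis PFu : ord x (peval2 iota t y P^`()) = 0.

(* By Taylor's formula [P(t, G(t))] and [y - G(t)] have the same order. *)
Lemma dvd_ord_root G : max_pow x 1 (y - peval iota t G) -> y != peval iota t G ->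
  (e %| ord x (y - peval iota t G))%Z.
Proof.
move=> hG yG; pose d := peval iota t G - y.
have d0 : d != 0 by rewrite subr_eq0 eq_sym.
have hd : max_pow x 1 d by rewrite /d -opprB; apply: max_powN.
have [R [hR]] := @taylor2 x y d P ht hy (max_powW ler01 hd).
rewrite {1}/d addrC subrK peval2_horner rel add0r => E.
have [|u0 ou] := @ord_addl _ _ _ x (peval2 iota t y P^`()) (d * R) PF0.
  by rewrite PFu add0r; apply: max_powMr.
have {}E : peval iota t P.[G] = d * (peval2 iota t y P^`() + d * R) by rewrite E; ring.
have -> : ord x (y - peval iota t G) = ord x (peval iota t P.[G]).
  by rewrite E ordM // ou PFu addr0 -opprB ordN.
by apply: dvd_ord_peval; rewrite E mulf_neq0.
Qed.

(** Hensel's lemma by truncations. Since [e] divides the order of [y - G(t)], an order above [e * M]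
    is at least [e * M.+1], and the residue after division by [tau ^+ M.+1] is the next
    coefficient. *)
Lemma root_expansion (M : nat) : exists G, max_pow x (e * M + 1) (y - peval iota t G).
Proof.
elim: M => [|M [G hG]].
  have [c hc] := residue hF hy; exists c%:P.
  by rewrite mulr0 add0r pevalC.
have [yG|yG] := eqVneq y (peval iota t G); first by exists G; rewrite -yG subrr; left.
have hG1 : max_pow x 1 (y - peval iota t G) by apply: max_powW hG; move: e_gt0; nia.
have dvd := dvd_ord_root hG1 yG.
have yG0 : y - peval iota t G != 0 by rewrite subr_eq0.
have tM0 : tau ^+ M.+1 != 0 by rewrite expf_neq0.
have hM : max_pow x (e * M.+1) (y - peval iota t G).
  right; have := max_pow_ord yG0 hG.
  case/dvdzP: dvd => m ->.
  by rewrite [m * _]mulrC lezD1 ltr_pM2l // ler_pM2l //; lia.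
have [|c hc] := residue hF (x := x) (f := (y - peval iota t G) / tau ^+ M.+1).
  rewrite mulrC max_pow_divl ?invr_eq0 // ordV ordX -/e.
  by apply: max_powW hM; rewrite -mulr_natr natz; lia.
exists (G + c *: ('X - t0%:P) ^+ M.+1).
rewrite rmorphD /= pevalZ rmorphXn /= rmorphB /= pevalX pevalC -/tau.
have -> : y - (peval iota t G + iota c * tau ^+ M.+1) =
    tau ^+ M.+1 * ((y - peval iota t G) / tau ^+ M.+1 - iota c).
  by field.
by apply: max_powM => //; right; rewrite ordX -mulr_natr natz.
Qed.

End Root.

End AtPlace.

(** Away from the zeros and poles of [t], of the generators and of the partial derivatives of their
    relations, every generator is a power series in [t - t0]. Then [e], the order of [t - t0],
    divides the order of every function, so [e = 1] and [D s] is a unit. *)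
Lemma finite_ramification :
  finite_set [set x : place iota | exists2 s, ord x s = 1 & ord x (D s) != 0].
Proof.
have [N [b gen]] := generators.
have HP j : exists P, peval2 iota t (b j) P = 0 /\ peval2 iota t (b j) P^`() != 0.
  have [P [rel sep]] := separating_relation hp hF t (b j); exists P; split=> //.
  case: sep => // PS; apply: contraNneq PS => PF.
  have := along_peval2 (derivation_along_id D) t (b j) P.
  by rewrite rel der_0 /= PF mul0r addr0 Dt mulr1 => <-.
have [P {}HP] := choice HP.
pose poles f := [set x : place iota | ord x f != 0].
have t_neq0 : t != 0 by apply: contra_eq_neq Dt => ->; rewrite der_0 eq_sym oner_eq0.
(* A zero generator has order 0 everywhere by convention, but [finite_ord_neq0] requires a nonzero
   function. *)
pose f j := if b j == 0 then 1 else b j.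
have f0 j : f j != 0 by rewrite /f; have [_|//] := eqVneq (b j) 0; exact: oner_neq0.
apply: (@sub_finite_set _ _ (poles t `|`
   \bigcup_(j in [set: 'I_N]) (poles (f j) `|` poles (peval2 iota t (b j) (P j)^`())))).
  move=> x [s hs]; apply: contra_neqP => /not_orP[/negP]; rewrite negbK => /eqP xt H.
  have {}H j : ord x (b j) = 0 /\ ord x (peval2 iota t (b j) (P j)^`()) = 0.
    split; apply/eqP; apply: contrapT => h; apply: H; exists j => //.
      left; rewrite /poles /= /f; have [b0|_] := eqVneq (b j) 0; last exact/negP.
      by case: h; rewrite b0 ord0E.
    by right; apply/negP.
  have ht : max_pow x 0 t by right; rewrite xt.
  have hb j : max_pow x 0 (b j) by right; rewrite (H j).1.
  have [t0 ht0] := residue hF ht.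
  pose e := ord x (t - iota t0).
  have tau0 : t - iota t0 != 0.
    apply: contra_eq_neq Dt => /eqP; rewrite subr_eq0 => /eqP->.
    by rewrite der_const eq_sym oner_eq0.
  have e_gt0 : 0 < e by have := max_pow_ord tau0 ht0; rewrite -/e; lia.
  have e1 : e = 1.
    have s0 : s != 0 by apply: contra_eq_neq hs => ->; rewrite ord0E.
    have [q [A [q0 E]]] := gen s.
    have qt0 : peval iota t q != 0 by apply: contra_neq q0 => /peval_eq0.
    have dq := dvd_ord_peval ht0 qt0.
    (* The sum [h] is replaced by a polynomial in [t] that agrees with it beyond its order. *)
    have dqs : (e %| ord x (peval iota t q * s))%Z.
      rewrite E; set h := \sum_j _.
      have h0 : h != 0 by rewrite /h -E mulf_neq0.
      pose M := `|ord x h|%N.+1.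
      have [G HG] := choice (fun j =>
        root_expansion ht0 (hb j) (HP j).1 (HP j).2 (H j).2 M).
      have [|Q0 oQ] := @ord_addl _ _ _ x h (peval iota t (\sum_j A j * G j) - h) h0.
        rewrite rmorph_sum -sumrB; apply: max_pow_sum => j _.
        rewrite rmorphM /= -mulrBr; apply: max_powMl; first exact: max_pow_peval.
        rewrite -opprB; apply: max_powN; apply: max_powW (HG j).
        by rewrite -/e /M; move: (ord x h) => m; nia.
      rewrite addrC subrK in Q0 oQ; rewrite -oQ; exact: dvd_ord_peval.
    have : (e %| 1)%Z.
      rewrite (_ : 1%Z = ord x (peval iota t q * s) - ord x (peval iota t q)).
        exact: (rpredB dqs dq).
      by rewrite ordM // hs addrC addKr.
    by rewrite dvdz1; lia.
  (* Now [t - t0] is a parameter, and the logarithmic derivative of [s] with respect to it has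
     residue 1. *)
  have := der_dlog hp hF e1 (_ : D (t - iota t0) = 1) (_ : s != 0).
  have [dD _ _] := derP D; have s0 : s != 0 by apply: contra_eq_neq hs => ->; rewrite ord0E.
  have -> : D (t - iota t0) = 1 by rewrite -(rmorphN iota) dD Dt der_const addr0.
  move=> /(_ erefl s0); rewrite hs => h.
  have [|u0 ou] := @ord_addl _ _ _ x 1 ((t - iota t0) * (D s / s) - 1) (oner_neq0 _).
    by rewrite ord_one.
  rewrite addrC subrK ord_one in u0 ou.
  have Ds0 : D s != 0 by apply: contraNneq u0 => ->; rewrite mul0r mulr0.
  by move: ou; rewrite ordM ?mulf_neq0 ?invr_eq0 // ord_div // -/e e1 hs; lia.
rewrite finite_setU; split; first exact: finite_ord_neq0.
apply: bigcup_finite; first exact: finite_finset.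
by move=> j _; rewrite finite_setU; split; apply: finite_ord_neq0 => //; case: (HP j).
Qed.

End Ramification.

(** * Extension of places *)

Section Chevalley.
Variables (F E : fieldType) (j : {rmorphism F -> E}) (O : set F) (s : F).

(* Subrings of [E] containing the image of [O] in which [s] is not invertible;
   a maximal one is a valuation ring of [E]. *)
Definition extension_ring (B : set E) : Prop :=
  [/\ forall a b, B a -> B b -> B (a - b), forall a b, B a -> B b -> B (a * b),
      forall f, O f -> B (j f) & ~ B (j s^-1)].

Hypothesis O1 : O 1.
Hypothesis Os : O s.
Hypothesis s_neq0 : s != 0.

Lemma maximal_extension_ring : (exists B, extension_ring B) ->
  exists B, extension_ring B /\ forall B', extension_ring B' -> B `<=` B' -> B' `<=` B.
Proof.
move=> [B0 hB0].
have [|A [hA maxA]] := @Zorn_bigcup E [set B | B = set0 \/ extension_ring B].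
  move=> C CP Ctot.
  have [C0|/existsNP[X /not_implyP[CX X0]]] := pselect (forall X, C X -> X = set0).
    left; apply/seteqP; split=> // a [X CX Xa]; by rewrite (C0 X CX) in Xa.
  have good Y a : C Y -> Y a -> extension_ring Y.
    by move=> CY Ya; case: (CP Y CY) => // Y0; rewrite Y0 in Ya.
  have [b Xb] : exists b, X b.
    by apply: contrapT => H; apply: X0; apply/seteqP; split=> // a Xa; apply: H; exists a.
  right; split.
  - move=> a c [Y CY Ya] [Z CZ Zc]; have [YZ|ZY] := Ctot Y Z CY CZ.
      by have [zB _ _ _] := good Z c CZ Zc; exists Z => //; apply: zB => //; apply: YZ.
    by have [zB _ _ _] := good Y a CY Ya; exists Y => //; apply: zB => //; apply: ZY.
  - move=> a c [Y CY Ya] [Z CZ Zc]; have [YZ|ZY] := Ctot Y Z CY CZ.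
      by have [_ zM _ _] := good Z c CZ Zc; exists Z => //; apply: zM => //; apply: YZ.
    by have [_ zM _ _] := good Y a CY Ya; exists Y => //; apply: zM => //; apply: ZY.
  - by move=> f Of; exists X => //; have [_ _ + _] := good X b CX Xb; apply.
  - by move=> [Y CY Ys]; have [_ _ _] := good Y _ CY Ys; apply.
have max B' : extension_ring B' -> A `<=` B' -> B' `<=` A.
  move=> hB' AB'; apply: contrapT => nB'A.
  by apply: (maxA B'); [split|right].
case: hA => [A0|hA]; last by exists A.
have := max B0 hB0; rewrite A0 => /(_ (@sub0set _ _)) B00.
by have [_ _ /(_ 1 O1) h _] := hB0; have := B00 _ h.
Qed.

Section Maximal.
Variable B : set E.
Hypothesis hB : extension_ring B.
Hypothesis maxB : forall B', extension_ring B' -> B `<=` B' -> B' `<=` B.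

Let BB a b : B a -> B b -> B (a - b).
Proof. by case: hB => + _ _ _; apply. Qed.
Let BM a b : B a -> B b -> B (a * b).
Proof. by case: hB => _ + _ _; apply. Qed.
Let BO f : O f -> B (j f). Proof. by case: hB => _ _ + _; apply. Qed.
Let Bs : ~ B (j s^-1). Proof. by case: hB. Qed.
Let B1 : B 1. Proof. by rewrite -(rmorph1 j); exact: BO. Qed.
Let B0 : B 0. Proof. by rewrite -(subrr 1); apply: BB. Qed.
Let BN a : B a -> B (- a). Proof. by move=> h; rewrite -sub0r; apply: BB. Qed.
Let BD a b : B a -> B b -> B (a + b).
Proof. by move=> ha hb; rewrite -[b]opprK; apply: BB => //; apply: BN. Qed.
Let Bsum (I : Type) (r : seq I) (P : pred I) (G : I -> E) :
  (forall i, P i -> B (G i)) -> B (\sum_(i <- r | P i) G i).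
Proof. by move=> H; apply: (big_ind B). Qed.
Let BX a (n : nat) : B a -> B (a ^+ n).
Proof. by move=> ha; elim: n => [|n IH]; rewrite ?expr0 // exprS; apply: BM. Qed.
Let js0 : j s != 0. Proof. by rewrite fmorph_eq0. Qed.

Definition over_ring (P : {poly E}) := forall i, B P`_i.

(** By maximality [B[f]] is no longer an extension ring, and the only condition it can violate is
    the one on [s^-1]. *)
Lemma adjoin_inv f : ~ B f -> exists P, over_ring P /\ P.[f] = j s^-1.
Proof.
move=> nBf; apply: contrapT => H.
pose B' := [set a | exists P, over_ring P /\ P.[f] = a].
have hB' : extension_ring B'.
  split.
  - move=> a b [P [hP <-]] [Q [hQ <-]]; exists (P - Q); split; last by rewrite !hornerE.
    by move=> i; rewrite coefB; apply: BB.
  - move=> a b [P [hP <-]] [Q [hQ <-]]; exists (P * Q); split; last by rewrite !hornerE.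
    by move=> i; rewrite coefM; apply: Bsum => l _; apply: BM.
  - move=> a Oa; exists (j a)%:P; split; last by rewrite hornerC.
    by move=> i; rewrite coefC; case: eqP => _ //; apply: BO.
  - exact: H.
apply/nBf/(maxB hB').
  move=> a Ba; exists a%:P; split; last by rewrite hornerC.
  by move=> i; rewrite coefC; case: eqP.
exists 'X; split; last by rewrite hornerX.
by move=> i; rewrite coefX; case: eqP.
Qed.

(** [s] lies in the Jacobson radical. If [u^-1] were missing from [B], then [s^-1 = P(u^-1)];
    multiplied by a high power of [u], which is 1 modulo [s B], this would put [s^-1] into [B]. *)
Lemma one_sub_inv b : B b -> 1 - j s * b != 0 /\ B (1 - j s * b)^-1.
Proof.
move=> Bb; set u := 1 - j s * b.
have u0 : u != 0.
  apply/eqP => /eqP; rewrite subr_eq0 => /eqP e; apply: Bs.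
  by rewrite fmorphV -[_^-1]mulr1 e mulKf.
split=> //; apply: contrapT => /adjoin_inv[P [hP eP]].
have uX (n : nat) : exists c, B c /\ u ^+ n = 1 + j s * c.
  elim: n => [|n [c [Bc IH]]]; first by exists 0; rewrite mulr0 addr0 expr0.
  exists (c - b - j s * c * b); split; last by rewrite exprSr IH /u; ring.
  by apply: BB; [apply: BB|do 2!apply: BM => //; apply: BO].
have [c [Bc uc]] := uX (size P).
apply: Bs; have -> : j s^-1 = j s^-1 * u ^+ size P - c.
  by rewrite uc mulrDr mulr1 mulrA -rmorphM mulVf // rmorph1 mul1r addrK.
apply: BB => //; rewrite -eP horner_coef mulr_suml; apply: Bsum => i _.
rewrite -mulrA; apply: BM => //.
rewrite -[X in u ^+ X](subnKC (ltnW (ltn_ord i))) exprD mulrA exprVn mulVf ?expf_neq0 // mul1r.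
apply: BX; apply: BB => //; apply: BM => //; exact: BO.
Qed.

(** Since [1 - s Q_0] is a unit of [B], multiplying [Q(f^-1) = s^-1] by a power of [f] writes
    [f ^+ n.+1] as a combination [W(f)] of lower powers, which replaces the leading term of [P]. *)
Lemma degree_reduction f (n m : nat) : f != 0 ->
  (exists P, [/\ over_ring P, (size P <= n.+2)%N & P.[f] = j s^-1]) ->
  (exists P, [/\ over_ring P, (size P <= m)%N & P.[f^-1] = j s^-1]) -> (m <= n.+2)%N ->
  exists P, [/\ over_ring P, (size P <= n.+1)%N & P.[f] = j s^-1].
Proof.
move=> f0 [P [hP sP eP]] [Q [hQ sQ eQ]] mn.
have {sQ mn} sQ := leq_trans sQ mn.
have [u0 Bv] := one_sub_inv (hQ 0%N).
set u := 1 - _ in u0 Bv.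
pose W := \poly_(i < n.+1) (j s * u^-1 * Q`_(n.+1 - i)).
have eW : W.[f] = f ^+ n.+1.
  rewrite horner_poly.
  have e1 : \sum_(i < n.+1) Q`_i.+1 * f^-1 ^+ i.+1 = j s^-1 * u.
    move: eQ; rewrite (horner_coef_wide _ sQ) big_ord_recl expr0 mulr1 => e.
    have -> : j s^-1 * u = j s^-1 - Q`_0.
      by rewrite /u mulrBr mulr1 mulrA -rmorphM mulVf // rmorph1 mul1r.
    by rewrite -e addrC addKr.
  transitivity (j s * u^-1 * f ^+ n.+1 * \sum_(i < n.+1) Q`_i.+1 * f^-1 ^+ i.+1); last first.
    by rewrite e1 fmorphV; field; rewrite js0.
  rewrite mulr_sumr (reindex_inj rev_ord_inj) /=; apply: eq_bigr => i _.
  rewrite subKn // -!mulrA; congr (_ * (_ * _)).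
  rewrite [in RHS]mulrCA; congr (_ * _).
  apply: (mulIf (expf_neq0 i.+1 f0)); rewrite -exprD subnK ?ltn_ord //.
  by rewrite exprVn divfK ?expf_neq0.
exists (\poly_(i < n.+1) P`_i + P`_n.+1 *: W); split.
- move=> i; rewrite coefD coefZ !coef_poly; case: ifP => _; last by rewrite mulr0 addr0.
  by apply: BD => //; do 3!apply: BM => //; apply: BO.
- rewrite (leq_trans (size_polyD _ _)) // geq_max size_poly.
  by rewrite (leq_trans (size_scale_leq _ _)) ?size_poly.
- by rewrite hornerD hornerZ eW -eP horner_poly (horner_coef_wide _ sP) [RHS]big_ord_recr.
Qed.

(** If [f] and [f^-1] are both missing, each gives a polynomial with value [s^-1]; the longer one
    can be shortened by means of the other, until a constant puts [s^-1] into [B]. *)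
Lemma valuation_ring f : B f \/ B f^-1.
Proof.
have [->|f0] := eqVneq f 0; first by left.
apply: contrapT => /not_orP[/adjoin_inv[P [hP eP]] /adjoin_inv[Q [hQ eQ]]].
have [N] : exists N, (size P + size Q <= N)%N by exists (size P + size Q)%N.
elim: N f f0 P Q hP eP hQ eQ => [|N IH] f f0 P Q hP eP hQ eQ sN.
  have P0 : P = 0 by apply/eqP; rewrite -size_poly_eq0; lia.
  move: eP; rewrite P0 horner0 => /esym/eqP; rewrite fmorph_eq0 invr_eq0.
  by rewrite (negPf s_neq0).
wlog QP : f f0 P Q hP eP hQ eQ sN / (size Q <= size P)%N.
  move=> H; case: (leqP (size Q) (size P)) => QP; first exact: (H f f0 P Q).
  apply: (H f^-1 _ Q P) => //; rewrite ?invr_eq0 ?invrK //; [lia|exact: ltnW].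
case sP: (size P) => [|[|n]].
- move/eqP: sP; rewrite size_poly_eq0 => /eqP P0.
  move: eP; rewrite P0 horner0 => /esym/eqP; rewrite fmorph_eq0 invr_eq0.
  by rewrite (negPf s_neq0).
- have := hP 0%N; have /eqP/size_poly1P[c _ Pc] := sP.
  by move: eP; rewrite Pc hornerC coefC eqxx => ->.
have [|||P' [hP' sP' eP']] := @degree_reduction f n (size Q) f0 _ _ _.
- by exists P; split=> //; rewrite sP.
- by exists Q; split.
- by rewrite -sP.
by apply: (IH f f0 P' Q) => //; lia.
Qed.


Definition unit_of (B : set E) f := B f /\ B f^-1.

Lemma unit_ofM f g : unit_of B f -> unit_of B g -> unit_of B (f * g).
Proof. by move=> [h1 h2] [h3 h4]; split; rewrite ?invfM; apply: BM. Qed.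

Lemma unit_ofV f : unit_of B f -> unit_of B f^-1.
Proof. by move=> [h1 h2]; split; rewrite ?invrK. Qed.

Lemma unit_ofX f (n : nat) : unit_of B f -> unit_of B (f ^+ n).
Proof. by move=> [h1 h2]; split; rewrite -?exprVn; apply: BX. Qed.

(** The non-units of a valuation ring form an ideal. Zero is a separate alternative because
    [0^-1 = 0] belongs to [B]. *)
Lemma nonunit_sum (I : eqType) (r : seq I) (G : I -> E) :
  (forall i, i \in r -> B (G i) /\ ~ B (G i)^-1 \/ G i = 0) ->
  B (\sum_(i <- r) G i) /\ ~ B (\sum_(i <- r) G i)^-1 \/ \sum_(i <- r) G i = 0.
Proof.
elim: r => [|i r IH] H; first by right; rewrite big_nil.
rewrite big_cons; have [||a0] := H i; first by rewrite inE eqxx.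
  have [|[Bb nb]|b0] := IH; first by move=> l lr; apply: H; rewrite inE lr orbT.
    move: (\sum_(l <- r) G l) Bb nb => b Bb nb.
    have [ab0|ab0] := eqVneq (G i + b) 0; first by right.
    move=> [Ba na]; left; split; first exact: BD.
    have [a0|a0] := eqVneq (G i) 0; first by rewrite a0 add0r.
    have [b0|b0] := eqVneq b 0; first by rewrite b0 addr0.
    move=> h; have [c|c] := valuation_ring (G i / b).
      apply: nb; have -> : b^-1 = (G i / b + 1) * (G i + b)^-1 by field; rewrite ab0 b0.
      by apply: BM => //; apply: BD.
    apply: na; have -> : (G i)^-1 = ((G i / b)^-1 + 1) * (G i + b)^-1.
      by field; rewrite ab0 a0 b0.
    by apply: BM => //; apply: BD.
  by rewrite b0 addr0; left.
rewrite a0 add0r; apply: IH => l lr; apply: H; by rewrite inE lr orbT.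
Qed.

(** In a vanishing sum two terms share the least valuation: if the term [T l] of least valuation
    were alone, the other quotients [T i / T l] would be non-units with sum -1. *)
Lemma associate_terms f (P : {poly F}) : f != 0 -> P != 0 -> (map_poly j P).[f] = 0 ->
  exists i l, [/\ (i < l < size P)%N, P`_i != 0, P`_l != 0 &
    unit_of B (f ^+ (l - i) * j (P`_l / P`_i))].
Proof.
move=> f0 P0; rewrite horner_coef size_map_poly => rel.
pose T (i : 'I_(size P)) := j P`_i * f ^+ i.
have relT : \sum_i T i = 0.
  by rewrite -[RHS]rel; apply: eq_bigr => i _; rewrite coef_map.
have [l [Tl0 lmax]] : exists l, T l != 0 /\ forall i, B (T i / T l).
  have Pl : ((size P).-1 < size P)%N by rewrite prednK // size_poly_gt0.
  have step (n : nat) : (n < size P)%N -> exists l, T l != 0 /\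
      forall i : 'I_(size P), (size P - n.+1 <= i)%N -> B (T i / T l).
    elim: n => [|n IH] nP.
      exists (Ordinal Pl); rewrite /T /=; split.
        by rewrite mulf_neq0 ?expf_neq0 // fmorph_eq0 -lead_coefE lead_coef_eq0.
      move=> i; rewrite subn1 => iP; have -> : i = Ordinal Pl.
        by apply/val_inj/eqP; rewrite eqn_leq /= iP -ltnS prednK ?ltn_ord // size_poly_gt0.
      rewrite /= divff // mulf_neq0 ?expf_neq0 // fmorph_eq0 -lead_coefE lead_coef_eq0 //.
    have [l [Tl0 hl]] := IH (ltnW nP).
    have nP' : (size P - n.+2 < size P)%N by rewrite ltn_subrL (leq_ltn_trans _ nP).
    pose i0 := Ordinal nP'.
    have next (m a b : nat) : (m - b.+2 <= a)%N -> (a < m - b.+1)%N -> a = (m - b.+2)%N by lia.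
    have [h|h] := valuation_ring (T i0 / T l).
      exists l; split=> // i iP; have [/hl//|lt] := leqP (size P - n.+1)%N i.
      by have -> : i = i0 by apply: val_inj; exact: next iP lt.
    have [T0|T0] := eqVneq (T i0) 0.
      exists l; split=> // i iP; have [/hl//|lt] := leqP (size P - n.+1)%N i.
      have -> : i = i0 by apply: val_inj; exact: next iP lt.
      by rewrite T0 mul0r.
    exists i0; split=> // i iP; have [/hl hi|lt] := leqP (size P - n.+1)%N i.
      have -> : T i / T i0 = T i / T l * (T i0 / T l)^-1 by field; rewrite T0 Tl0.
      exact: BM.
    have -> : i = i0 by apply: val_inj; exact: next iP lt.
    by rewrite divff.
  have [l [Tl0 hl]] := step _ Pl; exists l; split=> // i; apply: hl.
  by rewrite prednK ?subnn // size_poly_gt0.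
have [i [il Ti0 Bi]] : exists i, [/\ i != l, T i != 0 & B (T l / T i)].
  apply: contrapT => H.
  have := @nonunit_sum _ [seq i <- enum 'I_(size P) | i != l] (fun i => T i / T l).
  have -> : \sum_(i <- [seq i <- enum 'I_(size P) | i != l]) T i / T l = - 1.
    rewrite big_filter big_enum_cond /= -mulr_suml.
    move: relT; rewrite (bigD1 l) //= => /eqP; rewrite addrC addr_eq0 => /eqP->.
    by rewrite mulNr divff.
  case.
  - move=> i; rewrite mem_filter => /andP[il _].
    have [T0|T0] := eqVneq (T i) 0; first by right; rewrite T0 mul0r.
    left; split=> // h; apply: H; exists i; split=> //.
    by move: h; rewrite invf_div.
  - by case=> _; apply; rewrite invrN invr1; apply: BN.
  - by move/eqP; rewrite oppr_eq0 oner_eq0.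
have key (a b : 'I_(size P)) : (a < b)%N -> T a != 0 -> T b != 0 -> B (T a / T b) -> B (T b / T a) ->
  exists i l, [/\ (i < l < size P)%N, P`_i != 0, P`_l != 0 &
    unit_of B (f ^+ (l - i) * j (P`_l / P`_i))].
  move=> ab Ta Tb h1 h2; exists a, b.
  have Pa : j P`_a != 0 by apply: contraNneq Ta => e; rewrite /T e mul0r.
  have Pb : j P`_b != 0 by apply: contraNneq Tb => e; rewrite /T e mul0r.
  have e : f ^+ (b - a) * j (P`_b / P`_a) = T b / T a.
    have fb : f ^+ b = f ^+ (b - a) * f ^+ a by rewrite -exprD subnK // ltnW.
    rewrite /T rmorphM fmorphV fb; have fa := expf_neq0 a f0; field.
    by rewrite Pa fa.
  rewrite e; split.
  - by rewrite ab ltn_ord.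
  - by rewrite -(fmorph_eq0 j).
  - by rewrite -(fmorph_eq0 j).
  - by split; rewrite // invf_div.
by have [lt|lt|/val_inj e] := ltngtP i l; [apply: (key i l)|apply: (key l i)|rewrite e eqxx in il].
Qed.

End Maximal.
End Chevalley.

Lemma ordXz (k F : fieldType) (iota : {rmorphism k -> F}) (x : place iota) f (a : int) :
  ord x (f ^ a) = a * ord x f.
Proof.
case: a => i; first by rewrite -exprnP ordX -mulr_natl natz.
by rewrite NegzE -exprnN ordV ordX -mulr_natl natz mulNr.
Qed.

Section PlaceExtension.
Variables (k F E : fieldType) (iota : {rmorphism k -> F}) (j : {rmorphism F -> E}).
Variables (iotaE : {rmorphism k -> E}) (x : place iota) (n : nat).
Hypothesis iotaEE : forall c, iotaE c = j (iota c).
Hypothesis bounded : forall f : E, exists P : {poly F},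
  [/\ P != 0, (size P <= n.+1)%N & (map_poly j P).[f] = 0].

(** A maximal extension ring is a valuation ring, and the degree bound makes its value group
    discrete. By [associate_terms] some power of [f] with exponent between 1 and [n] is associated
    to an element of [F], so the power with exponent [n] factorial is associated to a power of [s].
    That exponent, divided by its least positive value, is the normalized valuation. *)
Theorem place_extension : exists w : place iotaE,
  forall f, local_ring w (j f) <-> local_ring x f.
Proof.
have [s hs] := ord_onto x.
have s0 : s != 0 by apply: contra_eq_neq hs => ->; rewrite ord0E.
have js0 : j s != 0 by rewrite fmorph_eq0.
have O1 : local_ring x 1 by right; rewrite ord_one.
have Os : local_ring x s by right; rewrite hs.
have [B [hB maxB]] : exists B, extension_ring j (local_ring x) s B /\
    forall B', extension_ring j (local_ring x) s B' -> B `<=` B' -> B' `<=` B.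
  apply: maximal_extension_ring => //; exists (j @` local_ring x); split.
  - by move=> _ _ [a Oa <-] [b Ob <-]; exists (a - b); rewrite ?rmorphB //; apply: max_powB.
  - by move=> _ _ [a Oa <-] [b Ob <-]; exists (a * b); rewrite ?rmorphM //; apply: max_powMl.
  - by move=> f Of; exists f.
  - move=> [a Oa /fmorph_inj e]; move: Oa; rewrite e => /(max_pow_ord _).
    by rewrite invr_eq0 => /(_ s0); rewrite ordV hs.
have vr := valuation_ring O1 Os s0 hB maxB.
have [BB BM BO Bs] := hB.
have BF f : B (j f) <-> local_ring x f.
  split=> [Bf|]; last exact: BO.
  have [->|f0] := eqVneq f 0; first by left.
  apply: contrapT => nO; apply: Bs; have -> : s^-1 = f * (f^-1 * s^-1) by field; rewrite f0 s0.
  rewrite rmorphM; apply: BM => //; apply: BO; right.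
  have : ~ 0 <= ord x f by move=> h; apply: nO; right.
  by rewrite ordM ?invr_eq0 // !ordV hs; lia.
have uM f g := @unit_ofM _ _ _ _ _ _ hB f g.
have uV f := @unit_ofV _ B f.
have uX f m := @unit_ofX _ _ _ _ _ O1 _ hB f m.
have uF f : f != 0 -> ord x f = 0 -> unit_of B (j f).
  by move=> f0 of0; split; rewrite -?fmorphV; apply: BO; right; rewrite ?ordV of0.
have uS a : unit_of B (j s ^ a) -> a = 0.
  rewrite -rmorphXz; last by rewrite unitfE.
  have sa0 : s ^ a != 0 by rewrite expfz_neq0.
  case; rewrite -fmorphV => /BF/(max_pow_ord sa0) + /BF/max_pow_ord.
  by rewrite invr_eq0 => + /(_ sa0); rewrite ordV ordXz hs; lia.
have ex f : exists a : int, f != 0 -> unit_of B (f ^+ n`! * j s ^ (- a)).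
  have [->|f0] := eqVneq f 0; first by exists 0.
  have [P [P0 sP rel]] := bounded f.
  have [i [l [/andP[il lP] Pi Pl u]]] := associate_terms O1 Os s0 hB maxB f0 P0 rel.
  pose c := P`_l / P`_i; have c0 : c != 0 by rewrite mulf_neq0 ?invr_eq0.
  have /dvdnP[q qE] : (l - i %| n`!)%N by apply: dvdn_fact; lia.
  exists (- (ord x c * q)) => _; rewrite opprK qE mulnC exprM.
  have sc0 : s ^ ord x c / c != 0 by rewrite mulf_neq0 ?invr_eq0 ?expfz_neq0.
  have -> : (f ^+ (l - i)) ^+ q * j s ^ (ord x c * q) =
     (f ^+ (l - i) * j c * j (s ^ ord x c / c)) ^+ q.
    rewrite -mulrA -rmorphM mulrCA mulfV // mulr1 rmorphXz ?unitfE //.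
    by rewrite exprMn -exprz_exp.
  apply: uX; apply: uM => //; apply: uF => //.
  by rewrite ord_div ?expfz_neq0 // ordXz hs mulr1 subrr.
have [w hw] := choice ex.
have jsD a b : j s ^ (a + b) = j s ^ a * j s ^ b by rewrite expfzDr.
have jsN a : j s ^ a * j s ^ (- a) = 1 by rewrite -jsD subrr expr0z.
have jsV a : (j s ^ a)^-1 = j s ^ (- a).
  by apply: (mulfI (expfz_neq0 a js0)); rewrite mulfV ?expfz_neq0 // jsN.
have wP f a : f != 0 -> unit_of B (f ^+ n`! * j s ^ (- a)) -> w f = a.
  move=> f0 u; have := uM _ _ u (uV _ (hw f f0)).
  have fn0 : f ^+ n`! != 0 by rewrite expf_neq0.
  rewrite invfM mulrACA mulfV // mul1r jsV opprK -jsD => /uS.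
  by rewrite addrC => /eqP; rewrite subr_eq0 => /eqP.
have wM f g : f != 0 -> g != 0 -> w (f * g) = w f + w g.
  move=> f0 g0; apply: wP; first by rewrite mulf_neq0.
  rewrite exprMn opprD jsD mulrACA; apply: uM; exact: hw.
have wF f : f != 0 -> w (j f) = ord x f * n`!.
  move=> f0; apply: wP; first by rewrite fmorph_eq0.
  rewrite -rmorphXn -rmorphXz ?unitfE // -rmorphM; apply: uF.
    by rewrite mulf_neq0 ?expf_neq0 ?expfz_neq0.
  by rewrite ordM ?expf_neq0 ?expfz_neq0 // ordX ordXz hs -mulr_natr natz; lia.
have fact0 : (0 < n`!)%N := fact_gt0 n.
have B1 : B 1 by rewrite -(rmorph1 j); apply: BO.
have BX f m : B f -> B (f ^+ m).
  by move=> Bf; elim: m => [|m IH]; rewrite ?expr0 // exprS; apply: BM.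
have BP f : f != 0 -> B f <-> 0 <= w f.
  move=> f0; have [u1 u2] := hw f f0; split=> [Bf|wf].
    have : B (j (s ^ w f)).
      have -> : j (s ^ w f) = f ^+ n`! * (f ^+ n`! * j s ^ (- w f))^-1.
        rewrite rmorphXz ?unitfE // invfM mulrA mulfV ?expf_neq0 // mul1r.
        by rewrite jsV opprK.
      by apply: BM => //; apply: BX.
    by move/BF/(max_pow_ord _); rewrite expfz_neq0 // ordXz hs mulr1; apply.
  have Bfn : B (f ^+ n`!).
    have -> : f ^+ n`! = f ^+ n`! * j s ^ (- w f) * j (s ^ w f).
      by rewrite rmorphXz ?unitfE // -mulrA [j s ^ (- _) * _]mulrC jsN mulr1.
    by apply: BM => //; apply: BO; right; rewrite ordXz hs mulr1.
  have [//|Bf] := vr f.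
  have -> : f = f ^+ n`! * f^-1 ^+ n`!.-1.
    case: (n`!) fact0 => // m _; rewrite exprS exprVn /= -mulrA mulfV ?expf_neq0 //.
    by rewrite mulr1.
  by apply: BM => //; apply: BX.
have wV f : f != 0 -> w f^-1 = - w f.
  move=> f0; apply: (addrI (w f)); rewrite -wM ?invr_eq0 // mulfV // subrr.
  by rewrite -(rmorph1 j) wF ?oner_eq0 // ord_one mul0r.
have wX f m : f != 0 -> w (f ^+ m) = w f * m.
  move=> f0; elim: m => [|m IH].
    by rewrite expr0 -(rmorph1 j) wF ?oner_eq0 // ord_one mul0r mulr0.
  by rewrite exprS wM ?expf_neq0 // IH; lia.
have [m0 [m0_gt0 hm0]] : exists m, (0 < m)%N /\ exists2 f, f != 0 & w f = m.
  by exists n`!; split=> //; exists (j s); rewrite // wF // hs mul1r.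
pose Pm m := `[< (0 < m)%N /\ exists2 f, f != 0 & w f = m >].
have exm : exists m, Pm m by exists m0; apply/asboolP.
case: (ex_minnP exm) => m /asboolP[m_gt0 [f1 f10 wf1]] mmin.
have dvd f : f != 0 -> (m %| w f)%Z.
  move=> f0; apply/dvdz_mod0P.
  have mz' : m%:Z != 0 by lia.
  have m_gt0' : 0 < m%:Z by lia.
  have r_ge0 : 0 <= (w f %% m)%Z := modz_ge0 (w f) mz'.
  have r_lt : (w f %% m)%Z < m := ltz_pmod (w f) m_gt0'.
  have wr : exists2 g, g != 0 & w g = (w f %% m)%Z.
    have wz (a : int) : w (f1 ^ a) = m%:Z * a.
      by case: a => i; [rewrite -exprnP wX // wf1|rewrite NegzE -exprnN wV ?expf_neq0 // wX // wf1; lia].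
    exists (f / f1 ^ (w f %/ m)%Z); first by rewrite mulf_neq0 ?invr_eq0 ?expfz_neq0.
    by rewrite wM ?invr_eq0 ?expfz_neq0 // wV ?expfz_neq0 // wz /modz; lia.
  case: (w f %% m)%Z r_ge0 r_lt wr => // -[|r] // _ r_lt wr.
  have /mmin : Pm r.+1 by apply/asboolP; split.
  by move: r_lt; lia.
pose o (f : E) : int := if f == 0 then 0 else (w f %/ m)%Z.
have oE f : f != 0 -> w f = o f * m.
  by move=> f0; rewrite /o (negPf f0) divzK // dvd.
have o0 : o 0 = 0 by rewrite /o eqxx.
have mz : m%:Z != 0 by lia.
have oP f : f != 0 -> B f <-> 0 <= o f.
  by move=> f0; rewrite BP // oE // pmulr_lge0 //; lia.
have oM f g : f != 0 -> g != 0 -> o (f * g) = o f + o g.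
  move=> f0 g0; apply: (mulIf mz); rewrite mulrDl -!oE ?mulf_neq0 //; exact: wM.
have oV f : f != 0 -> o f^-1 = - o f.
  by move=> f0; apply: (mulIf mz); rewrite mulNr -!oE ?invr_eq0 //; apply: wV.
have BD a b : B a -> B b -> B (a + b).
  move=> Ba Bb; have B0 : B 0 by rewrite -(subrr 1); exact: (BB _ _ B1 B1).
  by rewrite -[b]opprK -[- b]sub0r; exact: (BB _ _ Ba (BB _ _ B0 Bb)).
have oD' f g : f != 0 -> g != 0 -> f + g != 0 -> o f <= o g -> o f <= o (f + g).
  move=> f0 g0 fg0 le; rewrite -subr_ge0 -oV // -oM ?invr_eq0 //.
  apply/oP; first by rewrite mulf_neq0 ?invr_eq0.
  rewrite mulrDl mulfV //; apply: BD => //; apply/oP; first by rewrite mulf_neq0 ?invr_eq0.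
  by rewrite oM ?invr_eq0 // oV // subr_ge0.
have oD f g : f != 0 -> g != 0 -> f + g != 0 -> Order.min (o f) (o g) <= o (f + g).
  move=> f0 g0 fg0; rewrite ge_min; have [le|lt] := leP (o f) (o g).
    by rewrite oD'.
  by rewrite addrC oD' ?orbT // 1?addrC // ltW.
have oC c : o (iotaE c) = 0.
  have [->|c0] := eqVneq c 0; first by rewrite rmorph0.
  have ic0 : iota c != 0 by rewrite fmorph_eq0.
  rewrite iotaEE; apply: (mulIf mz); rewrite mul0r -oE ?fmorph_eq0 // wF // ord_const mul0r.
  by [].
have oO : exists f, o f = 1.
  by exists f1; apply: (mulIf mz); rewrite -oE // wf1 mul1r.
exists (Place o0 oM oD oC oO) => f; rewrite -BF.
have [->|f0] := eqVneq (j f) 0.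
  by split=> _; [rewrite -(subrr 1); exact: (BB _ _ B1 B1)|left].
rewrite oP //; split; last by right.
by move/(max_pow_ord f0).
Qed.

End PlaceExtension.

(** * Places of the cover *)

Section FiniteExtension.
Variables (K : fieldType) (L : fieldExtType K).

Lemma fieldext_bounded (f : L) : exists P : {poly K},
  [/\ P != 0, (size P <= (\dim {:L}).+1)%N & (map_poly (in_alg L) P).[f] = 0].
Proof.
have [|c [[i ci] rel]] := @linear_dependence K 'I_(\dim {:L}).+1 'I_(\dim {:L})
    (fun i j => coord (vbasis {:L}) j (f ^+ i)).
  by rewrite !card_ord.
pose P := \poly_(i < (\dim {:L}).+1) (if insub i is Some i' then c i' else 0).
exists P; split; last 1 first.
- rewrite (@horner_coef_wide _ (\dim {:L}).+1); last first.
    by rewrite size_map_poly size_poly.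
  transitivity (\sum_i c i *: f ^+ i).
    apply: eq_bigr => l _; rewrite coef_map /= coef_poly ltn_ord (valK l).
    by rewrite mulr_algl.
  rewrite (coord_vbasis (memvf (\sum_i c i *: f ^+ i))) big1 // => j _.
  rewrite linear_sum /= (_ : \sum_i _ = 0) ?scale0r // -[RHS](rel j).
  by apply: eq_bigr => l _; rewrite linearZ.
- apply: contra_neq ci => /(congr1 (fun Q : {poly K} => Q`_i)).
  by rewrite coef_poly ltn_ord (valK i) coef0.
- exact: size_poly.
Qed.

End FiniteExtension.

Lemma function_field_gen (k F : fieldType) (iota : {rmorphism k -> F}) (t : F)
    (I : finType) (b : I -> F) :
  (forall P : {poly k}, peval iota t P = 0 -> P = 0) ->
  (forall f : F, exists P Q : I -> {poly k}, (forall j, Q j != 0) /\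
     f = \sum_j peval iota t (P j) / peval iota t (Q j) * b j) ->
  function_field iota.
Proof.
move=> tr gen; exists t; split=> //; exists [seq b i | i <- enum I] => f.
have sz : size [seq b i | i <- enum I] = #|I| by rewrite size_map -cardE.
have [P [Q [Q0 ->]]] := gen f.
exists (fun l => P (enum_val (cast_ord sz l))), (fun l => Q (enum_val (cast_ord sz l))).
split=> //; rewrite (reindex (fun l => enum_val (cast_ord sz l))) /=; last first.
  apply: onW_bij; exists (fun i => cast_ord (esym sz) (enum_rank i)) => l.
    by rewrite enum_valK cast_ordK.
  by rewrite cast_ordKV enum_rankK.
apply: eq_bigr => l _; congr (_ * _).
rewrite (nth_map (enum_default (cast_ord sz l))); last by rewrite -cardE -sz.
by rewrite -(enum_val_nth (enum_default (cast_ord sz l)) (cast_ord sz l)).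
Qed.

Section Cover.
Variables (k K : fieldType) (iota : {rmorphism k -> K}) (L : splittingFieldType K).
Local Notation iotaL := (cover_embedding iota L).

Lemma peval_cover t P : peval iotaL t%:A P = (peval iota t P)%:A.
Proof.
rewrite -!(in_algE L) !(peval_coef _ _ (leqnn _)) rmorph_sum; apply: eq_bigr => i _.
by rewrite rmorphM rmorphXn.
Qed.

Lemma cover_function_field : function_field iota -> function_field iotaL.
Proof.
move=> [t [tr [b gen]]].
apply: (@function_field_gen _ _ _ t%:A ('I_(size b) * 'I_(\dim {:L}))%type
   (fun ij => b`_ij.1 *: (vbasis {:L})`_ij.2)).
  move=> P; rewrite peval_cover => /eqP; rewrite scaler_eq0 oner_eq0 orbF => /eqP.
  exact: tr.
move=> f; have [P HP] := choice (fun j => gen (coord (vbasis {:L}) j f)).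
have [Q HQ] := choice HP.
exists (fun ij => P ij.2 ij.1), (fun ij => Q ij.2 ij.1); split=> [ij|]; first exact: (HQ _).1.
rewrite {1}(coord_vbasis (memvf f)).
rewrite -(pair_bigA _ (fun i j => peval iotaL t%:A (P j i) / peval iotaL t%:A (Q j i) *
   (b`_i *: (vbasis {:L})`_j))) exchange_big /=.
apply: eq_bigr => j _; rewrite {1}(HQ j).2 scaler_suml; apply: eq_bigr => i _.
rewrite !peval_cover -!(in_algE L) -fmorphV -rmorphM /= mulr_algl scalerA.
by [].
Qed.

Section Above.
Variables (x : place iota) (w : place iotaL).
Hypothesis xw : above x w.

Lemma above_ord : exists e : nat, (0 < e)%N /\ forall f, ord w f%:A = ord x f * e.
Proof.
have [s hs] := ord_onto x.
have s0 : s != 0 by apply: contra_eq_neq hs => ->; rewrite ord0E.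
have A0 (f : K) : f != 0 -> f%:A != 0 :> L by rewrite scaler_eq0 oner_eq0 orbF.
have AV (f : K) : f^-1%:A = f%:A^-1 :> L by rewrite -!(in_algE L) fmorphV.
have AM (f g : K) : (f * g)%:A = f%:A * g%:A :> L by rewrite -!(in_algE L) rmorphM.
have nonneg f : f != 0 -> 0 <= ord x f <-> 0 <= ord w f%:A.
  move=> f0; rewrite -(max_powP x 0 f0) -(max_powP w 0 (A0 f f0)).
  by split=> h; apply/(xw f).
have unit f : f != 0 -> ord x f = 0 -> ord w f%:A = 0.
  move=> f0 of0; have h1 : 0 <= ord w f%:A by apply/nonneg; rewrite ?of0.
  have : 0 <= ord w f^-1%:A by apply/nonneg; rewrite ?invr_eq0 // ordV of0.
  by rewrite AV ordV oppr_ge0 => h2; apply/eqP; rewrite eq_le h1 h2.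
have e_gt0 : 0 < ord w s%:A.
  rewrite ltNge; apply/negP => h; have : 0 <= ord x s^-1.
    by apply/nonneg; rewrite ?invr_eq0 // AV ordV oppr_ge0.
  by rewrite ordV hs.
exists `|ord w s%:A|%N; split=> [|f]; first by lia.
rewrite gez0_abs; last by lia.
have [->|f0] := eqVneq f 0; first by rewrite scale0r !ord0E mul0r.
case e: (ord x f) => [i|i].
  have := unit (f / s ^+ i); rewrite mulf_neq0 ?invr_eq0 ?expf_neq0 //.
  rewrite ord_div ?expf_neq0 // ordX e hs natz subrr => /(_ isT erefl).
  rewrite AM AV -(in_algE L (s ^+ i)) rmorphXn /= ord_div ?expf_neq0 ?A0 //.
  by rewrite ordX -mulr_natl natz => /eqP; rewrite subr_eq0 => /eqP.
have := unit (f * s ^+ i.+1); rewrite mulf_neq0 ?expf_neq0 //.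
rewrite ordM ?expf_neq0 // ordX e hs NegzE natz addNr => /(_ isT erefl).
rewrite AM -(in_algE L (s ^+ i.+1)) rmorphXn /= ordM ?expf_neq0 ?A0 //.
rewrite ordX -mulr_natl natz => /eqP; rewrite addr_eq0 => /eqP->.
by rewrite mulNr.
Qed.

End Above.

(** Guarantees that the [xget] in [sigma] does not fall back on its default value. *)
Lemma exists_above (x : place iota) : exists w : place iotaL, above x w.
Proof.
have [w hw] := @place_extension _ _ _ iota (in_alg L) iotaL x _ (fun c => erefl)
  (@fieldext_bounded K L).
by exists w => f; apply: hw.
Qed.

End Cover.

(** * Orders of differentials *)

Section Differentials.
Variables (k F : fieldType) (iota : {rmorphism k -> F}) (c h : F).

(** The differential form [c dh]; [ds] and [ds / s] serve as test forms for [tau_log]. *)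
Definition scaled_diff (D : der iota) : F^o := c * D h.

Lemma scaled_diff_linear : linear scaled_diff.
Proof. by move=> a D1 D2; rewrite /scaled_diff /= mulrDr mulrCA. Qed.

HB.instance Definition _ := GRing.isLinear.Build F (der iota) F^o _ scaled_diff scaled_diff_linear.

End Differentials.

Section DifferentialOrders.
Variables (k : closedFieldType) (F : fieldType) (iota : {rmorphism k -> F}).
Variables (p : nat) (hp : p \in [pchar k]).
Hypothesis hF : function_field iota.
Implicit Types (x : place iota) (w : rat_diff iota).

Lemma der_unique (D D' : der iota) t : D t = 1 -> D' = D' t *: D.
Proof.
move=> Dt; apply: der_ext => f /=.
by rewrite (derivation_unique hp hF f (derivation_along_id D') Dt) mulrC.
Qed.

Section Uniformizer.
Variables (x : place iota) (s : F) (D : der iota).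
Hypotheses (hs : ord x s = 1) (Ds : D s = 1).

Lemma diff_stalkP n w : diff_stalk x n w <-> max_pow x n (w D).
Proof.
split=> [[m [a [h [ha hh ->]]]]|hw].
  by apply: max_pow_sum => j _; exact: max_powMr (ha j) (der_integral hp hF hs Ds (hh j)).
exists 1%N, (fun=> w D), (fun=> s); split=> // [_|D'].
  by right; rewrite hs.
by rewrite big_ord1 {1}(der_unique D' Ds) linearZ /= [LHS]mulrC.
Qed.

Lemma ord_diffE w : w D != 0 -> ord_diff x w = ord x (w D).
Proof.
move=> w0; apply: xget_unique => [|n [/diff_stalkP h0 h2]].
  split; first by apply/diff_stalkP; right.
  by move=> /diff_stalkP h; have := @max_pow_ord _ F _ x _ (w D) w0 h; lia.
have h1 := @max_pow_ord _ F _ x _ (w D) w0 h0; have : ~ n + 1 <= ord x (w D) by move=> h; apply: h2; apply/diff_stalkP; right.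
by lia.
Qed.

Definition log_der (M : set (place iota)) : der iota := if `[< M x >] then s *: D else D.

Lemma tau_logE M : tau_log M x =
  [set D' | exists2 a, local_ring x a & D' = a *: log_der M].
Proof.
have s0 : s != 0 by apply: contra_eq_neq hs => ->; rewrite ord0E.
apply/seteqP; split=> D' /=.
  rewrite /tau_log /omega_log /log_der /=; case: asboolP => Mx H.
    exists (s^-1 * D' s).
      apply: (H (scaled_diff s^-1 s)); apply/diff_stalkP.
      by right; rewrite /= /scaled_diff Ds mulr1 ordV hs.
    by rewrite scalerA mulrAC mulVf // mul1r; apply: der_unique.
  exists (1 * D' s).
    apply: (H (scaled_diff 1 s)); apply/diff_stalkP.
    by right; rewrite /= /scaled_diff Ds mulr1 ord_one.
  by rewrite mul1r; apply: der_unique.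
move=> [a ha ->] w; rewrite /omega_log /log_der linearZ /= => hw.
apply: max_powMl => //; move: hw; case: asboolP => Mx /diff_stalkP // hw.
rewrite linearZ /= -[0](subrr 1); apply: max_powM => //.
by right; rewrite hs.
Qed.

End Uniformizer.
End DifferentialOrders.

(** * Deformation data *)

Section Datum.
Variables (p : nat) (k : closedFieldType) (K : fieldType) (iota : {rmorphism k -> K}).
Variables (L : splittingFieldType K).
Local Notation G := ('Gal({:L} / 1))%g.
Variables (chi : {morphism G >-> {unit 'F_p}}) (omega : rat_diff (cover_embedding iota L)).
Hypotheses (hp : p \in [pchar k]) (hX : function_field iota).
Hypothesis homega : deformation_datum chi omega.
Variables (t : K) (D : der iota).
Hypothesis Dt : D t = 1.
Variable z : L.
Hypothesis hz : forall D', omega D' = z * D' t%:A.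
Variable v : K.
Hypothesis hv : z ^+ p.-1 = v^-1%:A.
Local Notation iotaL := (cover_embedding iota L).

Let p_pr : prime p := pcharf_prime hp.
Let hXL : function_field iotaL := cover_function_field L hX.
Let hpK : p \in [pchar K]. Proof. by rewrite (fmorph_pchar iota). Qed.
Let hpL : p \in [pchar L]. Proof. by rewrite (fmorph_pchar iotaL). Qed.

Let cA (f : K) : in_alg L f = f%:A. Proof. by []. Qed.

Lemma datum_neq0 : z != 0.
Proof.
have [_ _ [D' h] _ _] := homega.
by apply/eqP => z0; apply: h; rewrite hz z0 mul0r.
Qed.

Lemma v_neq0 : v != 0.
Proof.
apply/eqP => v0; have : z ^+ p.-1 != 0 by rewrite expf_neq0 // datum_neq0.
by rewrite hv v0 invr0 scale0r eqxx.
Qed.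

(** A derivation of [L] on which [omega] is nonzero does not kill [t]; rescaled to be 1 at [t], it
    restricts to [D] by uniqueness. *)
Lemma lift_derivation : exists D1 : der iotaL, forall f, D1 f%:A = (D f)%:A.
Proof.
have [_ _ [D' h] _ _] := homega.
have Dt0 : D' t%:A != 0 by apply/eqP => e; apply: h; rewrite hz e mulr0.
pose D1 := (D' t%:A)^-1 *: D'; exists D1 => f.
have D1t : D1 t%:A = 1 by rewrite /= mulVf.
have hd : derivation_along iota (in_alg L) (fun f => D1 f%:A).
  have [dD dM dC] := derP D1; split=> [f1 f2|f1 f2|c].
  - by rewrite -!cA rmorphD dD.
  - by rewrite -!cA rmorphM dM.
  - exact: dC.
by rewrite (derivation_unique hp hX f hd Dt) D1t mulr1.
Qed.

Lemma der_expp (F : fieldType) (iotaF : {rmorphism k -> F}) (D' : der iotaF) f :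
  D' (f ^+ p) = 0.
Proof.
have [->|f0] := eqVneq f 0.
  by rewrite expr0n gtn_eqF ?prime_gt0 // der_0.
have := dlog_exp D' p f0; rewrite (pcharf0 (_ : p \in [pchar F])) ?(fmorph_pchar iotaF) //.
by rewrite mul0r => /eqP; rewrite mulf_eq0 invr_eq0 expf_eq0 (negPf f0) andbF orbF => /eqP.
Qed.

Lemma iter_der_expp (F : fieldType) (iotaF : {rmorphism k -> F}) (D' : der iotaF) f h n :
  iter n D' (f ^+ p * h) = f ^+ p * iter n D' h.
Proof.
elim: n => [|n IH] //; rewrite !iterS IH.
by case: (derP D') => _ -> _; rewrite der_expp mul0r add0r.
Qed.

(* Jacobson's formula for the logarithmic form [omega], multiplied by the p-th
   power [z ^- p], which is a constant. *)
Lemma cartier_identity (D' : der iota) :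
  iter p.-1 D' (v * D' t) = v * iter p D' t - (D' t) ^+ p.
Proof.
have [D1 hD1] := lift_derivation.
pose D2 := (D' t)%:A *: D1.
have hD2 f : D2 f%:A = (D' f)%:A.
  rewrite /= hD1 -!cA -rmorphM; congr (in_alg L _).
  by rewrite [in RHS](der_unique hp hX D' Dt).
have iD2 n f : iter n D2 f%:A = (iter n D' f)%:A.
  by elim: n => [|n IH] //; rewrite !iterS IH hD2.
have [_ _ _ _ [u u0 hu]] := homega.
pose w := z * (D' t)%:A.
have wE : D2 u = w * u.
  have := hu D2; rewrite hz hD2 -/w => ->; rewrite /dd divfK //.
have := jacobson_formula (w := w) hp wE.
have -> : iter p D2 u = u * (z * (iter p D' t)%:A).
  have := hu (der_pow hp D2); rewrite hz /dd /= iD2 => ->.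
  by rewrite mulrC divfK.
move=> /(mulfI u0) E.
suff : (iter p.-1 D' (v * D' t))%:A = (v * iter p D' t - D' t ^+ p)%:A :> L.
  by rewrite -!cA => /fmorph_inj.
have z0 := datum_neq0.
have vE : v%:A = (z^-1) ^+ p * z.
  have -> : v%:A = (z ^+ p.-1)^-1 by rewrite hv -!cA fmorphV invrK.
  have -> : z^-1 ^+ p = z^-1 * z^-1 ^+ p.-1 by rewrite -exprS prednK ?prime_gt0.
  by rewrite exprVn; field; rewrite z0 expf_neq0.
have -> : (iter p.-1 D' (v * D' t))%:A = (z^-1) ^+ p * iter p.-1 D2 w.
  rewrite -iter_der_expp -[LHS]iD2; congr (iter _ _ _).
  by rewrite -cA rmorphM /= vE mulrA.
have -> : iter p.-1 D2 w = z * (iter p D' t)%:A - w ^+ p by rewrite E addrK.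
rewrite -[RHS]cA rmorphB rmorphM rmorphXn /= vE /w exprMn mulrBr !mulrA; congr (_ - _).
by rewrite -exprMn mulVf ?expr1n ?mul1r.
Qed.

Lemma gal_scalar (g : gal_of {:L}) (f : K) : g f%:A = f%:A.
Proof. by rewrite linearZ /= rmorph1. Qed.

Lemma gal_const (g : gal_of {:L}) c : g (iotaL c) = iotaL c.
Proof. exact: gal_scalar. Qed.

Lemma gal_datum (g : gal_of {:L}) : g \in G -> g z = (\val (chi g) : nat)%:R * z.
Proof.
have [D1 hD1] := lift_derivation; have [_ _ _ [_ h] _] := homega.
move=> gG; have := h g D1 gG; rewrite /pullback !hz /= gal_scalar hD1 Dt -[1%:A]/(in_alg L 1) rmorph1.
by rewrite !rmorph1 !mulr1.
Qed.

(** Hence the order of every subgroup of [G] is invertible in [L]. *)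
Lemma card_galois_group : (0 < #|G| < p)%N.
Proof.
have [_ _ _ [inj _] _] := homega; rewrite cardG_gt0 /=.
have := card_injm inj (subxx G) => <-.
apply: (@leq_ltn_trans #|[set: {unit 'F_p}]%SET|); first exact/subset_leq_card/finset.subsetT.
by rewrite card_finField_unit card_Fp // prednK ?prime_gt0.
Qed.

Section Place.
Variables (x : place iota) (w : place iotaL) (e : nat).
Hypotheses (e_gt0 : (0 < e)%N) (we : forall f, ord w f%:A = ord x f * e).

Lemma stabilizer_group : group_set (stabilizer w).
Proof.
apply/group_setP; split.
  by rewrite inE group1 /=; apply/asboolP => f; rewrite gal_id.
move=> g1 g2; rewrite !inE => /andP[G1 /asboolP h1] /andP[G2 /asboolP h2].
by rewrite groupM //=; apply/asboolP => f; rewrite galM ?memvf // h2 h1.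
Qed.

Let H := group stabilizer_group.

Let HP g : g \in H -> g \in G /\ forall f, ord w (g f) = ord w f.
Proof. by rewrite inE => /andP[? /asboolP]. Qed.

(* [g] multiplies the unit [z ^+ e * s ^ (- ord w z)] by [chi g ^+ e], but fixes its
   residue. *)
Lemma stabilizer_root g : g \in H -> (\val (chi g)) ^+ e = 1.
Proof.
move=> /HP[gG hg]; set m : nat := \val (chi g) : nat.
suff : m%:R ^+ e = 1 :> L.
  rewrite -natrX -[1]/(1%:R) => /eqP; have [->|me] := posnP (m ^ e).
    by rewrite eq_sym oner_eq0.
  rewrite -subr_eq0 -natrB // -(dvdn_pcharf hpL) => dvd.
  have : (m ^ e - 1)%:R == 0 :> 'F_p by rewrite -(dvdn_pcharf (pchar_Fp p_pr)).
  by rewrite natrB // subr_eq0 natrX natr_Zp => /eqP.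
have [s hs] := ord_onto x.
have s0 : s != 0 by apply: contra_eq_neq hs => ->; rewrite ord0E.
have sA0 : s%:A != 0 :> L by rewrite scaler_eq0 oner_eq0 orbF.
have z0 := datum_neq0.
pose y := z ^+ e * s%:A ^ (- ord w z).
have y0 : y != 0 by rewrite mulf_neq0 ?expf_neq0 ?expfz_neq0.
have oy : ord w y = 0.
  rewrite ordM ?expf_neq0 ?expfz_neq0 // ordX ordXz we hs -mulr_natl natz.
  by rewrite mul1r mulNr mulrC subrr.
have gy : g y = m%:R ^+ e * y.
  by rewrite /y rmorphM rmorphXn fmorphXz /= gal_scalar gal_datum // exprMn mulrA.
have [c hc] : exists c, max_pow w 1 (y - iotaL c).
  by apply: (residue hXL); right; rewrite oy.
have hgc : max_pow w 1 (g y - iotaL c).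
  have -> : g y - iotaL c = g (y - iotaL c) by rewrite rmorphB; congr (_ - _); exact/esym/gal_const.
  case: hc => [->|h]; first by left; rewrite rmorph0.
  by right; rewrite hg.
have : max_pow w 1 ((m%:R ^+ e - 1) * y).
  have := max_powB hgc hc; rewrite opprB addrA subrK gy.
  by rewrite mulrBl mul1r.
rewrite mulrC max_pow_divl // oy subr0 => hm; apply/eqP; rewrite -subr_eq0.
apply: contraT => nz; have := max_pow_ord nz hm.
have -> : m%:R ^+ e - 1 = iotaL (m%:R ^+ e - 1) by rewrite rmorphB rmorphXn rmorph_nat rmorph1.
by rewrite ord_const.
Qed.

(** [chi] embeds the stabilizer into the roots of [X^e - 1] in [F_p]. *)
Lemma stabilizer_leq : (#|H| <= e)%N.
Proof.
have [_ _ _ [inj _] _] := homega.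
have sz : size ('X^e - 1 : {poly 'F_p}) = e.+1 by rewrite size_Xn_sub_1.
pose rs := [seq \val (chi g) | g <- enum H].
rewrite -ltnS -sz cardE -(size_map (fun g => \val (chi g))).
apply: max_poly_roots.
- by rewrite -size_poly_gt0 sz.
- apply/allP => _ /mapP[g gH ->]; rewrite mem_enum in gH.
  by rewrite rootE !hornerE stabilizer_root // subrr.
- rewrite map_inj_in_uniq ?enum_uniq // => g1 g2; rewrite !mem_enum => h1 h2 /val_inj.
  by apply: (injmP inj); [case: (HP h1)|case: (HP h2)].
Qed.

(* For [h] close to 1 at [w] and to 0 at the other conjugates of [w], the trace of
   [h * \prod_(g in H) g pi] is an element of [K] of order [#|H|] at [w]. *)
Lemma stabilizer_dvd : (e %| #|H|)%N.
Proof.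
have [gal _ _ _ _] := homega.
have [pi hpi] := ord_onto w.
have pi0 : pi != 0 by apply: contra_eq_neq hpi => ->; rewrite ord0E.
have gal_neq0 (g : gal_of {:L}) f : f != 0 -> g f != 0 by rewrite fmorph_eq0.
pose y := \prod_(g in H) g pi.
have y0 : y != 0 by apply/prodf_neq0 => g _; apply: gal_neq0.
have oy : ord w y = #|H|.
  rewrite /y -big_enum /= ord_prod => [|g _]; last exact: gal_neq0.
  rewrite big_enum /= (eq_bigr (fun=> 1)) => [|g /HP[_ ->]//].
  by rewrite sumr_const natz.
have gy g : g \in H -> g y = y.
  move=> gH; rewrite /y rmorph_prod [RHS](reindex_inj (mulIg g)) /=.
  apply: eq_big => [i|i _]; first exact/esym/(@groupMr _ H).
  by rewrite galM ?memvf.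
(* These are the conjugates of [w]; those with [g] in [G] outside the stabilizer differ from [w], so
   weak approximation separates them from it. *)
have wg_place (g : gal_of {:L}) : exists wg : place iotaL, forall f, ord wg f = ord w (g f).
  have h0 : ord w (g 0) = 0 by rewrite rmorph0 ord0E.
  have hM f1 f2 : f1 != 0 -> f2 != 0 -> ord w (g (f1 * f2)) = ord w (g f1) + ord w (g f2).
    by move=> f10 f20; rewrite rmorphM ordM ?gal_neq0.
  have hD f1 f2 : f1 != 0 -> f2 != 0 -> f1 + f2 != 0 ->
      Order.min (ord w (g f1)) (ord w (g f2)) <= ord w (g (f1 + f2)).
    by move=> f10 f20 f120; rewrite rmorphD ordD ?gal_neq0 // -rmorphD gal_neq0.
  have hC c : ord w (g (iotaL c)) = 0 by rewrite gal_const ord_const.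
  have hO : exists f, ord w (g f) = 1.
    by exists ((g^-1)%g pi); rewrite -galM ?memvf // mulVg gal_id.
  by exists (Place h0 hM hD hC hO).
have [W hW] := choice wg_place.
pose c0 := enum (G :\: H).
(* Large enough for [g (y * h)] to have order above [#|H|] at [w] whenever [g] is outside [H]. *)
pose N := (#|H|.+1 + \max_(g in G) `|ord w (g y)|)%N.
have [|h [h1 h2]] := @weak_approximation _ _ _ w (fun i => W (nth 1%g c0 i)) (size c0) N.
  move=> i /(mem_nth 1%g); rewrite mem_enum !inE => /andP[/negP + gG].
  set g := nth _ _ _ in gG * => gH e1; apply: gH; rewrite gG /=.
  by apply/asboolP => f; rewrite -hW e1.
have h3 g : g \in G -> g \notin H -> max_pow w N (g h).
  move=> gG gH; have gc : g \in c0 by rewrite mem_enum inE gH.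
  have := h2 (index g c0); rewrite index_mem nth_index // => /(_ gc) [->|].
    by left; rewrite rmorph0.
  by rewrite hW; right.
pose T := galTrace 1 {:L} (y * h).
have [a Ta] : exists a : K, T = a%:A by apply/vlineP/mem_galTrace => //; exact: memvf.
(* As [#|H| < p], the sum of the conjugates of [h] over [H], congruent to [#|H|], is a unit at
   [w]. *)
have u0 : (#|H|%:R : L) != 0.
  rewrite -(dvdn_pcharf hpL) gtnNdvd ?cardG_gt0 //.
  have /andP[_] := card_galois_group; apply: leq_ltn_trans; apply/subset_leq_card/fintype.subsetP.
  by move=> g /HP[].
have ou : ord w (#|H|%:R : L) = 0 by rewrite -(rmorph_nat iotaL) ord_const.
have [S0 oS] : \sum_(g in H) g h != 0 /\ ord w (\sum_(g in H) g h) = 0.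
  have -> : \sum_(g in H) g h = #|H|%:R + \sum_(g in H) (g h - 1).
    by rewrite sumrB sumr_const addrC subrK.
  rewrite -ou; apply: ord_addl => //; rewrite ou; apply: max_pow_sum => g /HP[_ hg].
  have -> : g h - 1 = g (h - 1) by rewrite rmorphB rmorph1.
  case: h1 => [->|?]; first by left; rewrite rmorph0.
  by right; rewrite hg.
have [T0 oT] : T != 0 /\ ord w T = #|H|%:Z.
  have -> : T = y * (\sum_(g in H) g h) + \sum_(g in G | g \notin H) g (y * h).
    rewrite /T /galTrace (bigID (mem H)) /= mulr_sumr; congr (_ + _).
    apply: eq_big => [g|g /andP[_ gH]]; last by rewrite rmorphM /= gy.
    by apply: andb_idl => /HP[].
  have <- : ord w (y * (\sum_(g in H) g h)) = #|H|%:Z by rewrite ordM // oS addr0.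
  apply: ord_addl; first by rewrite mulf_neq0.
  rewrite ordM // oS addr0 oy; apply: max_pow_sum => g /andP[gG gH].
  rewrite rmorphM; apply: max_powW (max_powM (max_pow_ordE w (g y)) (h3 g gG gH)).
  have := leq_bigmax_cond (F := fun g : gal_of {:L} => `|ord w (g y)|%N) g gG.
  by rewrite /N; move: (\max_(g0 in _) _)%N (ord w (g y)) #|H| => m b c; clear; lia.
move: oT; rewrite Ta we => /(congr1 absz) E; apply/dvdnP; exists `|ord x a|%N.
by rewrite -[LHS]E abszM.
Qed.

Lemma card_stabilizer : #|stabilizer w| = e.
Proof.
apply/eqP; rewrite eqn_leq stabilizer_leq dvdn_leq ?stabilizer_dvd //.
exact: (cardG_gt0 H).
Qed.

End Place.
(** With [e = m_x], three orders combine: [z] has order [- e ord(v) / (p - 1)] because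
    [z^(p-1) v = 1]; tame ramification gives [ds/d(pi)] the order [e - 1]; and passing from [t] to
    [s] contributes [ord (D s)]. *)
Lemma sigmaE x s : ord x s = 1 ->
  sigma omega x = 1 - (ord x v + p.-1%:Z * ord x (D s))%:~R / p.-1%:R.
Proof.
move=> hs; have [_ htame _ _ _] := homega.
rewrite /sigma; set Q := [set q | _].
have [w0 xw0] := exists_above L x.
have [w xw ->] : Q (xget 0 Q) by apply: xgetPex; exists ((ord_diff w0 omega + 1)%:~R / #|stabilizer w0|%:R); exists w0.
have [e [e_gt0 we]] := above_ord xw.
rewrite (card_stabilizer e_gt0 we).
have [D1 hD1] := lift_derivation.
have [pi hpi] := ord_onto w.
have s0 : s != 0 by apply: contra_eq_neq hs => ->; rewrite ord0E.
have A0 (f : K) : f != 0 -> f%:A != 0 :> L by rewrite scaler_eq0 oner_eq0 orbF.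
have sA0 := A0 s s0.
have z0 := datum_neq0.
have Dpi0 : D1 pi != 0.
  apply: (der_uniformizer hp hXL hpi); exists t%:A.
  by rewrite hD1 Dt A0 ?oner_neq0.
have Ds0 : D s != 0.
  by apply: (der_uniformizer hp hX hs); exists t; rewrite Dt oner_neq0.
pose D2 := (D1 pi)^-1 *: D1.
have D2pi : D2 pi = 1 by rewrite /= mulVf.
have omegaD2 : omega D2 = z / D1 pi.
  by rewrite hz /= hD1 Dt -[1%:A]/(in_alg L 1) rmorph1 mulr1.
have oD2 : ord w (omega D2) = ord w z - ord w (D1 pi) by rewrite omegaD2 ord_div.
rewrite (ord_diffE hp hXL hpi D2pi); last by rewrite omegaD2 mulf_neq0 ?invr_eq0.
rewrite oD2.
have osA : ord w s%:A = e by rewrite we hs mul1r.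
(* This is tameness: the residue [e] of the logarithmic derivative of [s] along [pi] does not
   vanish. *)
have e0 : e%:R != 0 :> L.
  rewrite -(dvdn_pcharf hpL); have := htame x w xw s hs.
  by rewrite osA.
have oDs : ord w (D1 pi) = ord x (D s) * e - e%:Z + 1.
  have := der_dlog hp hXL hpi D2pi sA0; rewrite osA => h.
  have oe : ord w (e%:R : L) = 0 by rewrite -(rmorph_nat iotaL) ord_const.
  have [|u0 ou] := @ord_addl _ _ _ w (e%:R : L) (pi * (D2 s%:A / s%:A) - e%:R) e0.
    by rewrite oe.
  rewrite addrC subrK oe in u0 ou.
  have pi0 : pi != 0 by apply: contra_eq_neq hpi => ->; rewrite ord0E.
  move: ou; rewrite /= hD1 ordM ?mulf_neq0 ?invr_eq0 ?A0 // ord_div ?mulf_neq0 ?invr_eq0 ?A0 //.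
  rewrite ordM ?invr_eq0 ?A0 // ordV hpi osA we.
  by move: (ord x (D s)) (ord w (D1 pi)) => b c; clear; lia.
have zv : p.-1%:Z * ord w z = - (ord x v * e).
  have := congr1 (ord w) hv; rewrite ordX -mulr_natl natz => ->.
  by rewrite we ordV mulNr.
have p1 : p.-1%:R != 0 :> rat.
  by rewrite pnatr_eq0 -lt0n -ltnS prednK ?prime_gt0 // prime_gt1.
have e1 : e%:R != 0 :> rat by rewrite pnatr_eq0 -lt0n.
have -> : ord w z - ord w (D1 pi) + 1 = ord w z - ord x (D s) * e + e%:Z by rewrite oDs; ring.
have := congr1 (fun a : int => a%:~R : rat) zv.
rewrite !(rmorphD, rmorphB, rmorphN, rmorphM) /= -!pmulrn.
move: (ord w z) (ord x v) (ord x (D s)) => a b c E.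
have -> : a%:~R = - (b%:~R * e%:R) / p.-1%:R :> rat by rewrite -E mulrAC mulfV // mul1r.
by field; rewrite p1 e1.
Qed.

End Datum.

(** * Expansions at a place *)

Section LocalStructure.
Variables (p : nat) (k : closedFieldType) (K : fieldType) (iota : {rmorphism k -> K}).
Hypotheses (hp : p \in [pchar k]) (hp2 : (2 < p)%N) (hF : function_field iota).
Variables (t : K) (D : der iota) (v : K).
Hypotheses (Dt : D t = 1) (v0 : v != 0).
Hypothesis cartier : forall D' : der iota,
  iter p.-1 D' (v * D' t) = v * iter p D' t - (D' t) ^+ p.

Let p_pr : prime p := pcharf_prime hp.
Let hpK : p \in [pchar K]. Proof. by rewrite (fmorph_pchar iota). Qed.

Lemma iter_der_power (E : der iota) s (n i : nat) : E s = 1 ->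
  iter i E (s ^+ n) = (n ^_ i)%:R * s ^+ (n - i).
Proof.
move=> Es; have [dD dM dC] := derP E.
have EX m : E (s ^+ m) = m%:R * s ^+ m.-1.
  elim: m => [|m IH]; first by rewrite expr0 der_1 mul0r.
  rewrite exprS dM Es IH mul1r; case: m {IH} => [|m] /=; first by rewrite mul0r mulr0 addr0 mul1r.
  by rewrite exprS -[in RHS]addn1 natrD; ring.
elim: i => [|i IH]; first by rewrite ffactn0 subn0 mul1r.
have Enat (m : nat) f : E (m%:R * f) = m%:R * E f by rewrite !mulr_natl der_natmul.
by rewrite iterS IH Enat EX mulrA -natrM -ffactnSr -subnS.
Qed.

Section AtPlace.
Variables (x : place iota) (s : K).
Hypothesis hs : ord x s = 1.

Let s0 : s != 0. Proof. by apply: contra_eq_neq hs => ->; rewrite ord0E. Qed.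

Lemma Ds_neq0 : D s != 0.
Proof. by apply: (der_uniformizer hp hF hs); exists t; rewrite Dt oner_neq0. Qed.

Definition dlocal : der iota := (D s)^-1 *: D.

Lemma dlocal_s : dlocal s = 1.
Proof. by rewrite /= mulVf // Ds_neq0. Qed.

Lemma dlocal_t : dlocal t = (D s)^-1.
Proof. by rewrite /= Dt mulr1. Qed.

(* The analogue of [v] for the parameter [s] in place of [t]. *)
Definition vlocal : K := v * D s ^+ p.-1.

Lemma vlocal_neq0 : vlocal != 0.
Proof. by rewrite mulf_neq0 ?expf_neq0 // Ds_neq0. Qed.

Lemma vlocalE : v * dlocal t = vlocal / D s ^+ p.
Proof.
have := Ds_neq0; rewrite dlocal_t /vlocal -{2}(prednK (prime_gt0 p_pr)) exprS => d0.
by field; rewrite d0 expf_neq0.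
Qed.

(** The p-th power of [dlocal] is a derivation that kills [s], hence zero; and [D s ^+ p] is a
    constant that can be cancelled. *)
Lemma cartier_local : iter p.-1 dlocal vlocal = - 1.
Proof.
have d0 := Ds_neq0.
have Ep : iter p dlocal t = 0.
  have := congr1 (fun E : der iota => E t) (der_unique hp hF (der_pow hp dlocal) dlocal_s).
  rewrite [LHS]/= => ->; rewrite /=.
  have -> : iter p dlocal s = 0.
    rewrite -(prednK (prime_gt0 p_pr)) iterSr dlocal_s.
    case: p hp2 => [|[|q]] // _; rewrite iterSr der_1.
    by elim: (q) => //= m ->; rewrite der_0 mulr0.
  by rewrite mul0r.
have := cartier dlocal; rewrite Ep mulr0 sub0r vlocalE dlocal_t.
have -> : vlocal / D s ^+ p = (D s)^-1 ^+ p * vlocal by rewrite exprVn mulrC.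
rewrite iter_der_expp // => h.
have nz : (D s)^-1 ^+ p != 0 by rewrite expf_neq0 ?invr_eq0.
by apply: (mulfI nz); rewrite h mulrN1.
Qed.

Lemma iter_dlocal_max_pow n (i : nat) f :
  max_pow x n f -> max_pow x (n - i%:Z) (iter i dlocal f).
Proof.
move=> hf; elim: i => [|i IH]; first by rewrite subr0.
rewrite iterS -addn1 PoszD opprD addrA; exact: (der_local hp hF hs dlocal_s).
Qed.

(** Applying [dlocal] [p - 1] times lowers the order by at most [p - 1], and leads to the unit
    -1. *)
Lemma ord_vlocal_lt : ord x vlocal < p%:Z.
Proof.
rewrite ltNge; apply/negP => h.
have := iter_dlocal_max_pow p.-1 (max_pow_ordE x vlocal).
rewrite cartier_local => /max_powN; rewrite opprK max_pow1.
by have := prime_gt0 p_pr; lia.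
Qed.

Lemma ord_dlocal f : f != 0 -> ~~ (p%:Z %| ord x f)%Z ->
  dlocal f != 0 /\ ord x (dlocal f) = ord x f - 1.
Proof.
move=> f0 ndvd; have h := der_dlog hp hF hs dlocal_s f0.
have c0 : (ord x f)%:~R != 0 :> K.
  apply: contra ndvd; rewrite dvdzE /=.
  case: (ord x f) => m; first by rewrite -pmulrn (dvdn_pcharf hpK).
  by rewrite NegzE rmorphN oppr_eq0 /= -pmulrn (dvdn_pcharf hpK).
have oc : ord x ((ord x f)%:~R : K) = 0 by rewrite -(rmorph_int iota) ord_const.
have [|u0 ou] := @ord_addl _ _ _ x _ (s * (dlocal f / f) - (ord x f)%:~R) c0.
  by rewrite oc.
rewrite addrC subrK oc in u0 ou.
have E0 : dlocal f != 0 by apply: contraNneq u0 => ->; rewrite mul0r mulr0.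
split=> //; have h1 := @ordM _ _ _ x s _ s0 (mulf_neq0 E0 (invr_neq0 f0)).
move: ou; rewrite h1 (@ord_div _ _ _ x _ _ E0 f0) hs.
by move: (ord x (dlocal f)) (ord x f) => a b; clear; lia.
Qed.

(** A power of [s] with exponent divisible by [p] is constant and can be factored out. *)
Lemma dlocal_max_pow_dvd n f : (p%:Z %| n)%Z -> max_pow x n f -> max_pow x n (dlocal f).
Proof.
case/dvdzP=> m -> hf.
pose y := s ^ m; have y0 : y != 0 by rewrite expfz_neq0.
have oyp : ord x (y ^+ p) = m * p by rewrite ordX ordXz hs mulr1 -mulr_natr natz.
have -> : f = y ^+ p * (f / y ^+ p) by rewrite mulrC divfK // expf_neq0.
have -> : dlocal (y ^+ p * (f / y ^+ p)) = y ^+ p * dlocal (f / y ^+ p).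
  exact: (iter_der_expp hp dlocal y (f / y ^+ p) 1).
rewrite -[m * p]addr0; apply: max_powM; first by right; rewrite oyp.
apply: (der_integral hp hF hs dlocal_s).
by rewrite mulrC max_pow_divl ?invr_eq0 ?expf_neq0 // ordV oyp sub0r opprK.
Qed.

(* The s^-1 coefficient of [vlocal] vanishes: its image under the (p-1)-st iterate
   of d/ds would be a pole of order p. *)
Lemma primitive_exists : ord x vlocal = -2 ->
  exists c, [/\ c != 0, ord x c = -1 & max_pow x 0 (vlocal + dlocal c)].
Proof.
move=> ov.
have sn0 n : s ^+ n != 0 by rewrite expf_neq0.
have [al hal] : exists c, max_pow x 1 (vlocal * s ^+ 2 - iota c).
  by apply: (residue hF); right; rewrite ordM // ?vlocal_neq0 // ordX hs ov.
pose r := vlocal - iota al / s ^+ 2.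
have hr : max_pow x (-1) r.
  have -> : r = (vlocal * s ^+ 2 - iota al) / s ^+ 2 by rewrite /r; field.
  by rewrite mulrC max_pow_divl ?invr_eq0 // ordV ordX hs.
have [be hbe] : exists c, max_pow x 1 (r * s - iota c).
  by apply: (residue hF); rewrite mulrC max_pow_divl // hs.
pose q := r - iota be / s.
have hq : max_pow x 0 q.
  have -> : q = (r * s - iota be) / s by rewrite /q; field.
  by rewrite mulrC max_pow_divl ?invr_eq0 // ordV hs.
have p_gt2 : (p = p.-2.+2)%N by case: p hp2 => [|[|?]].
(* Factoring out the constant [s^-p] leaves two monomials, of which only [s^(p-1)] survives [p - 1]
   derivations; it becomes [(p-1)!], nonzero by Wilson's theorem. *)
have vE : vlocal = (s^-1) ^+ p * (iota al * s ^+ p.-2 + iota be * s ^+ p.-1) + q.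
  rewrite /q /r exprVn {1 3}p_gt2 (_ : p.-1 = p.-2.+1); last by case: p hp2 => [|[|?]].
  by rewrite !exprS; field; rewrite s0 sn0.
have be0 : be = 0.
  apply/eqP; apply: contraT => be0.
  have := iter_dlocal_max_pow p.-1 hq.
  have -> : iter p.-1 dlocal q = - 1 - (s^-1) ^+ p * (iota be * p.-1`!%:R).
    have [dD dM dC] := derP dlocal.
    have itD m f h : iter m dlocal (f + h) = iter m dlocal f + iter m dlocal h.
      by elim: m => [|m IH] //; rewrite !iterS IH dD.
    have itC m c f : iter m dlocal (iota c * f) = iota c * iter m dlocal f.
      by elim: m => [|m IH] //; rewrite !iterS IH dM dC mul0r add0r.
    have := cartier_local; rewrite {1}vE itD iter_der_expp // itD !itC.
    rewrite !(iter_der_power _ _ dlocal_s) subnn ffactnn ffact_small; last by case: p hp2 => [|[|?]].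
    by rewrite mul0r mulr0 add0r mulr1 => <-; rewrite addrC addKr.
  have f0 : p.-1`!%:R != 0 :> K.
    have : (p %| p.-1`!.+1)%N by rewrite -Wilson // prime_gt1.
    rewrite (dvdn_pcharf hpK) -addn1 natrD addr_eq0 => /eqP->.
    by rewrite oppr_eq0 oner_eq0.
  have nz : (s^-1) ^+ p * (iota be * p.-1`!%:R) != 0.
    by rewrite !mulf_neq0 ?expf_neq0 ?invr_eq0 ?fmorph_eq0.
  move=> h1; have h2 : max_pow x (0 - p.-1%:Z) (- 1).
    by apply: max_powN; apply/max_pow1; lia.
  have := max_powB h2 h1.
  have E (T : K) : - 1 - (- 1 - T) = T by ring.
  rewrite E => /(max_pow_ord nz).
  rewrite ordM ?expf_neq0 ?invr_eq0 ?mulf_neq0 ?fmorph_eq0 // ordX ordV hs.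
  rewrite ordM ?fmorph_eq0 // ord_const -(rmorph_nat iota) ord_const mulNrn natz.
  by have := prime_gt0 p_pr; lia.
(* [al] is the coefficient of [s^-2] in [vlocal], and [- al / s^2] is the derivative of [al / s]. *)
exists (iota al / s); have al0 : al != 0.
  apply/eqP => al0; have : max_pow x 0 vlocal.
    by rewrite vE al0 be0 rmorph0 !mul0r addr0 mulr0 add0r.
  by move/(max_pow_ord vlocal_neq0); rewrite ov.
split.
- by rewrite mulf_neq0 ?invr_eq0 // fmorph_eq0.
- by rewrite ord_div ?fmorph_eq0 // ord_const hs.
- have [dD dM dC] := derP dlocal.
  have -> : dlocal (iota al / s) = - (iota al / s ^+ 2).
    have := dM s s^-1; rewrite mulfV // der_1 dlocal_s mul1r => /esym/eqP.
    rewrite addrC addr_eq0 => /eqP e; rewrite dM dC mul0r add0r.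
    by apply: (mulfI s0); rewrite mulrCA e; field.
  by have := hq; rewrite /q /r be0 rmorph0 mul0r subr0.
Qed.

End AtPlace.
End LocalStructure.

(** * The indigenous bundle *)

Section Extensionality.
Variables (k F : fieldType) (iota : {rmorphism k -> F}).

Lemma vbundle_ext n (E1 E2 : vbundle iota n) : stalk E1 = stalk E2 -> E1 = E2.
Proof.
case: E1 E2 => s1 f1 g1 [s2 f2 g2] /= e; case: _ / e in f2 g2 *.
by congr VBundle; apply: Prop_irrelevance.
Qed.

Lemma flat_bundle_ext n (E1 E2 : flat_bundle iota n) :
  stalk E1 = stalk E2 -> marked E1 = marked E2 -> nabla E1 = nabla E2 -> E1 = E2.
Proof.
move=> /vbundle_ext; case: E1 E2 => v1 m1 a1 n1 b1 c1 d1 e1 [v2 m2 a2 n2 b2 c2 d2 e2] /=.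
move=> ev em en; case: _ / ev in e2 *; case: _ / em in a2 e2 *.
case: _ / en in b2 c2 d2 e2 *.
by rewrite (Prop_irrelevance a1 a2) (Prop_irrelevance b1 b2) (Prop_irrelevance c1 c2)
  (Prop_irrelevance d1 d2) (Prop_irrelevance e1 e2).
Qed.

Lemma indigenous_bundle_ext (E1 E2 : indigenous_bundle iota) :
  stalk E1 = stalk E2 -> marked E1 = marked E2 -> nabla E1 = nabla E2 ->
  hodge E1 = hodge E2 -> E1 = E2.
Proof.
move=> es em en; have := flat_bundle_ext es em en => {es em en}.
case: E1 E2 => f1 h1 a1 b1 c1 [f2 h2 a2 b2 c2] /= ef eh.
case: _ / ef in a2 b2 c2 *; case: _ / eh in a2 b2 c2 *.
by rewrite (Prop_irrelevance a1 a2) (Prop_irrelevance b1 b2) (Prop_irrelevance c1 c2).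
Qed.

End Extensionality.

(** * Local data, stalks and connection *)

Section Stalks.
Variables (p : nat) (k : closedFieldType) (K : fieldType) (iota : {rmorphism k -> K}).
Hypotheses (hp : p \in [pchar k]) (hp2 : (2 < p)%N) (hF : function_field iota).
Variables (t : K) (D : der iota) (v : K).
Hypotheses (Dt : D t = 1) (v0 : v != 0).
Hypothesis cartier : forall D' : der iota,
  iter p.-1 D' (v * D' t) = v * iter p D' t - (D' t) ^+ p.

Definition unif (x : place iota) : K := sval (cid (ord_onto x)).

Lemma ord_unif x : ord x (unif x) = 1.
Proof. exact: svalP (cid (ord_onto x)). Qed.

(* [expo x] is (p - 1)(1 - sigma_x). The stalk at [x] will be spanned by
   [unif x ^ level x] D^(p) and e_0 + [tail x] D^(p), its Hodge filtration by
   [unif x ^ pole x] e_0. *)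
Definition expo x : int := ord x (vlocal p D v (unif x)).

Variables M SS : set (place iota).
Hypothesis hSS : forall x, SS x <-> expo x = -2.
Hypothesis hM : forall x, M x <-> ~ SS x /\ ~~ (p%:Z %| expo x)%Z.

(** The case distinction is the order of a generator of [T(S)] with respect to the p-th tensor power
    of [d/ds]: [p] at a marked point and 0 elsewhere, minus [n_x]. The last term converts to
    [D^(p)], as [d/ds = (D s)^-1 D]. *)
Definition level x : int :=
  (if `[< SS x >] then 0 else if `[< M x >] then expo x + 1 else expo x) -
  p%:Z * ord x (D (unif x)).

Definition pole x : int := if `[< SS x >] then 1 else 0.

Definition dlog x : der iota := log_der x (unif x) (dlocal D (unif x)) M.

Let p_pr : prime p := pcharf_prime hp.
Let u0 x : unif x != 0.
Proof. by apply: contra_eq_neq (ord_unif x) => ->; rewrite ord0E. Qed.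
Let Du0 x : D (unif x) != 0. Proof. exact: (Ds_neq0 hp hF Dt (ord_unif x)). Qed.
Let dl_u x : dlocal D (unif x) (unif x) = 1.
Proof. exact: (dlocal_s hp hF Dt (ord_unif x)). Qed.

(** Off the marked points [unif x ^ level x] is thus a p-th power, hence a constant, and its product
    with [D^(p)] is horizontal. *)
Lemma dvd_level x : ~ M x -> (p%:Z %| level x)%Z.
Proof.
move=> nM; rewrite /level; apply: rpredB; last by rewrite dvdz_mulr ?dvdzz.
case: asboolP => sx; first exact: dvdz0.
case: asboolP => // _; apply: contrapT => /negP h; apply: nM; exact/hM.
Qed.

Lemma dlog_integral x f : max_pow x 0 f -> max_pow x 0 (dlog x f).
Proof.
move=> hf; have h := der_integral hp hF (ord_unif x) (dl_u x) hf.
rewrite /dlog /log_der; case: asboolP => // _; rewrite -[0]addr0.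
by apply: max_powM h; right; rewrite ord_unif.
Qed.

Lemma dlog_level x f : max_pow x (level x) f -> max_pow x (level x) (dlog x f).
Proof.
move=> hf; rewrite /dlog /log_der; case: asboolP => Mx.
  have -> : level x = 1 + (level x - 1) by rewrite addrC subrK.
  by apply: max_powM (der_local hp hF (ord_unif x) (dl_u x) hf); right; rewrite ord_unif.
exact: (dlocal_max_pow_dvd hp hF Dt (ord_unif x) (dvd_level Mx) hf).
Qed.

Lemma dlog_t x : dlog x t != 0 /\
  ord x (dlog x t) = (if `[< M x >] then 1 else 0) - ord x (D (unif x)).
Proof.
rewrite /dlog /log_der; case: asboolP => _ /=; rewrite Dt mulr1.
  by rewrite mulf_neq0 ?invr_eq0 // ordM ?invr_eq0 // ord_unif ordV.
by rewrite invr_eq0 ordV sub0r.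
Qed.

(** This is the order that Kodaira-Spencer requires: the generator [unif x ^ pole x] e_0 of the
    filtration is sent to that power times [v * dlog x t] in the coordinate of [D^(p)], where the
    quotient line is generated in order [level x - pole x]. *)
Lemma v_dlog_t x : v * dlog x t != 0 /\ ord x (v * dlog x t) = level x - pole x *+ 2.
Proof.
have [d0 _] := dlog_t x; split; first by rewrite mulf_neq0.
have vl0 := vlocal_neq0 hp hF Dt v0 (ord_unif x).
have vE : ord x (v * dlocal D (unif x) t) = expo x - p%:Z * ord x (D (unif x)).
  rewrite (vlocalE hp hF v Dt (ord_unif x)) ord_div ?expf_neq0 // ordX.
  by rewrite -mulr_natl natz.
have dt0 : dlocal D (unif x) t != 0 by rewrite (dlocal_t Dt) invr_eq0.
rewrite /level /pole /dlog /log_der; case: (asboolP (SS x)) => sx; case: (asboolP (M x)) => mx.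
- by have [] := (hM x).1 mx.
- by rewrite vE ((hSS x).1 sx) mulr2n; lia.
- rewrite /= mulrCA ordM ?mulf_neq0 ?invr_eq0 ?Dt ?oner_eq0 //.
  have -> : v * ((D (unif x))^-1 * 1) = v * dlocal D (unif x) t by rewrite /= Dt.
  by rewrite vE ord_unif mul0rn subr0; lia.
- by rewrite vE mul0rn subr0.
Qed.

(** The local primitive refers to the p-th power of [d/ds]; the constant [(D (unif x))^-1 ^+ p]
    adapts it to [D^(p)]. The last clause makes e_0 + [tail x] D^(p) horizontal modulo
    [unif x ^ level x] D^(p). *)
Lemma tail_exists x : exists c, [/\ SS x -> c != 0 /\ ord x c = level x - 1,
  ~ SS x -> c = 0 & max_pow x (level x) (dlog x c + v * dlog x t)].
Proof.
have [sx|nsx] := pselect (SS x); last first.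
  exists 0; split=> //; rewrite der_0 add0r; right.
  have [_ ->] := v_dlog_t x; rewrite /pole; case: asboolP => // _.
  by rewrite mul0rn subr0.
have [c [c0 oc hc]] := primitive_exists hp hp2 hF Dt v0 cartier (ord_unif x) ((hSS x).1 sx).
have nM : ~ M x by case/hM.
have lE : level x = - (p%:Z * ord x (D (unif x))) by rewrite /level asboolT // sub0r.
have Dp0 : D (unif x) ^+ p != 0 by rewrite expf_neq0.
exists ((D (unif x))^-1 ^+ p * c); split=> // [_|].
  rewrite mulf_neq0 ?expf_neq0 ?invr_eq0 // ordM ?expf_neq0 ?invr_eq0 // ordX ordV oc lE.
  by rewrite -mulr_natl natz mulrN.
rewrite /dlog /log_der asboolF //.
have := iter_der_expp hp (dlocal D (unif x)) (D (unif x))^-1 c 1; rewrite [LHS]/= => E.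
have -> : dlocal D (unif x) ((D (unif x))^-1 ^+ p * c) =
    (D (unif x))^-1 ^+ p * dlocal D (unif x) c by exact: E.
rewrite (vlocalE hp hF v Dt (ord_unif x)) [_ / _]mulrC -exprVn -mulrDr addrC.
rewrite -[level x]addr0; apply: max_powM => //.
by right; rewrite ordX ordV lE -mulr_natl natz mulrN.
Qed.

Definition tail x : K := sval (cid (tail_exists x)).

Lemma tailP x : [/\ SS x -> tail x != 0 /\ ord x (tail x) = level x - 1,
  ~ SS x -> tail x = 0 & max_pow x (level x) (dlog x (tail x) + v * dlog x t)].
Proof. exact: svalP (cid (tail_exists x)). Qed.

Lemma tail_mul x f : max_pow x 0 f -> max_pow x (level x) (f * tail x) <-> max_pow x (pole x) f.
Proof.
have [h1 h2 _] := tailP x; rewrite /pole => hf; case: asboolP => sx.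
  have [c0 oc] := h1 sx; rewrite mulrC max_pow_divl // oc.
  by rewrite opprB addrC subrK.
by rewrite h2 // mulr0; split=> // _; left.
Qed.

Lemma tail_max_pow x : max_pow x (level x - pole x) (tail x).
Proof.
have [h1 h2 _] := tailP x; rewrite /pole; case: asboolP => sx.
  by right; case: (h1 sx) => _ ->.
by left; apply: h2.
Qed.

Definition stalk_at x : set 'rV[K]_2 :=
  [set s | local_ring x (s 0 1) /\ max_pow x (level x) (s 0 0 - s 0 1 * tail x)].

Definition hodge_at x : set 'rV[K]_2 := [set s | s 0 0 = 0 /\ max_pow x (pole x) (s 0 1)].

(** The filtration is thus determined by the stalk, as uniqueness requires; [tail_mul] decides which
    multiples of e_0 lie in the stalk. *)
Lemma hodge_atE x s : hodge_at x s <-> stalk_at x s /\ s 0 0 = 0.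
Proof.
split=> [[e h]|[[h1 h2] e]].
  have h1 : max_pow x 0 (s 0 1).
    by apply: max_powW h; rewrite /pole; case: asboolP.
  split=> //; split=> //; rewrite e sub0r; apply/max_powN/tail_mul => //.
split=> //; apply/tail_mul => //.
by move: h2; rewrite e sub0r => /max_powN; rewrite opprK.
Qed.

Lemma stalk_at_fst x s : stalk_at x s -> max_pow x (level x - pole x) (s 0 0).
Proof.
move=> [h1 h2]; rewrite -(subrK (s 0 1 * tail x) (s 0 0)); apply: max_powD.
  by apply: max_powW h2; rewrite /pole; case: asboolP => _; lia.
by apply: max_powMl => //; apply: tail_max_pow.
Qed.

Lemma stalk_atD x s1 s2 : stalk_at x s1 -> stalk_at x s2 -> stalk_at x (s1 + s2).
Proof.
move=> [a1 a2] [b1 b2]; split; rewrite !mxE; first exact: max_powD.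
have -> (a b c d e : K) : a + b - (c + d) * e = (a - c * e) + (b - d * e) by ring.
exact: max_powD.
Qed.

Lemma stalk_atZ x f s : local_ring x f -> stalk_at x s -> stalk_at x (f *: s).
Proof.
move=> hf [a1 a2]; split; rewrite !mxE; first exact: max_powMl.
by rewrite -mulrA -mulrBr; apply: max_powMl.
Qed.

Definition connection (D' : der iota) (s : 'rV[K]_2) : 'rV[K]_2 :=
  \row_j (if j == 0 then D' (s 0 0) + s 0 1 * (v * D' t) else D' (s 0 1)).

Lemma connection0 D' s : connection D' s 0 0 = D' (s 0 0) + s 0 1 * (v * D' t).
Proof. by rewrite mxE. Qed.

Lemma connection1 D' s : connection D' s 0 1 = D' (s 0 1).
Proof. by rewrite mxE. Qed.

Lemma row2P (s1 s2 : 'rV[K]_2) : s1 0 0 = s2 0 0 -> s1 0 1 = s2 0 1 -> s1 = s2.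
Proof.
move=> e0 e1; apply/rowP => j; case: (unliftP ord0 j) => [i ->|->] //.
by rewrite (ord1 i) (_ : lift _ _ = 1) //; apply: val_inj.
Qed.

Lemma connection_linear a D1 D2 s :
  connection (a *: D1 + D2) s = a *: connection D1 s + connection D2 s.
Proof. by apply: row2P; rewrite !mxE /=; ring. Qed.

Lemma connectionD D' s1 s2 : connection D' (s1 + s2) = connection D' s1 + connection D' s2.
Proof.
by have [dD _ _] := derP D'; apply: row2P; rewrite !mxE /= !dD; ring.
Qed.

Lemma connection_leibniz D' f s :
  connection D' (f *: s) = D' f *: s + f *: connection D' s.
Proof.
by have [_ dM _] := derP D'; apply: row2P; rewrite !mxE /= !dM; ring.
Qed.

Lemma tau_log_dlog x : tau_log M x =
  [set D' | exists2 a, local_ring x a & D' = a *: dlog x].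
Proof. exact: (tau_logE hp hF (ord_unif x) (dl_u x)). Qed.

Lemma connection_stalk x D' s :
  tau_log M x D' -> stalk_at x s -> stalk_at x (connection D' s).
Proof.
rewrite tau_log_dlog => -[a ha ->] hs.
have -> : connection (a *: dlog x) s = a *: connection (dlog x) s.
  by rewrite -[a *: dlog x]addr0 connection_linear; apply: row2P; rewrite !mxE /=; ring.
apply: stalk_atZ => //; case: hs => h1 h2; split.
  by rewrite connection1; apply: dlog_integral.
rewrite connection0 connection1; have [dD dM _] := derP (dlog x).
have -> : dlog x (s 0 0) + s 0 1 * (v * dlog x t) - dlog x (s 0 1) * tail x =
    dlog x (s 0 0 - s 0 1 * tail x) + s 0 1 * (dlog x (tail x) + v * dlog x t).
  have -> : dlog x (s 0 0 - s 0 1 * tail x) = dlog x (s 0 0) - dlog x (s 0 1 * tail x).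
    have e := dD (s 0 0 - s 0 1 * tail x) (s 0 1 * tail x); rewrite subrK in e.
    by rewrite e addrK.
  by rewrite dM; ring.
apply: max_powD; first exact: dlog_level.
by apply: max_powMl => //; case: (tailP x).
Qed.


Implicit Types x : place iota.

(** * The vector bundle and its Hodge filtration *)

Lemma latticeP x (B : 'M[K]_2) s : lattice x B s <-> exists y0 y1,
  [/\ local_ring x y0, local_ring x y1, s 0 0 = y0 * B 0 0 + y1 * B 1 0 &
      s 0 1 = y0 * B 0 1 + y1 * B 1 1].
Proof.
have E (c : 'rV[K]_2) j : (c *m B) 0 j = c 0 0 * B 0 j + c 0 1 * B 1 j.
  rewrite mxE big_ord_recl big_ord1 (_ : lift _ _ = 1) //; exact: val_inj.
split=> [[c [hc ->]]|[y0 [y1 [h0 h1 e0 e1]]]].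
  by exists (c 0 0), (c 0 1); rewrite !E; split.
exists (\row_j (if j == 0 then y0 else y1)); split=> [j|].
  by rewrite mxE; case: ifP.
by apply: row2P; rewrite E !mxE /=.
Qed.

Definition mx22 (a b c d : K) : 'M[K]_2 :=
  \matrix_(i, j) (if i == 0 then if j == 0 then a else b else if j == 0 then c else d).

Lemma mx22_unit a b c d : a * d - b * c != 0 -> mx22 a b c d \in unitmx.
Proof.
set e := a * d - b * c => e0.
suff : mx22 a b c d *m mx22 (d / e) (- b / e) (- c / e) (a / e) = 1%:M.
  by move/mulmx1_unit => [].
apply/row_matrixP => i; apply: row2P; case: (unliftP ord0 i) => [i' ->|->];
  rewrite ?(ord1 i') !mxE big_ord_recl big_ord1 !mxE /= /e; by field; rewrite -/e.
Qed.

Lemma stalk_at_lattice x : stalk_at x = lattice x (mx22 (unif x ^ level x) 0 (tail x) 1).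
Proof.
apply/seteqP; split=> s; rewrite latticeP !mxE /=; last first.
  move=> [y0 [y1 [h0 h1 e0 e1]]]; split; rewrite e1 mulr0 add0r mulr1 //.
  rewrite e0 addrK; apply: max_powMl => //.
  by right; rewrite ordXz ord_unif mulr1.
move=> [h1 h2]; have ul0 : unif x ^ level x != 0 by rewrite expfz_neq0.
exists ((s 0 0 - s 0 1 * tail x) / unif x ^ level x), (s 0 1); split=> //.
- rewrite /local_ring mulrC max_pow_divl ?invr_eq0 // ordV ordXz ord_unif.
  by rewrite mulr1 sub0r opprK.
- by rewrite divfK // subrK.
- by rewrite mulr0 add0r mulr1.
Qed.

Lemma finite_ord_uniformizer : finite_set [set x : place iota | ord x (D (unif x)) != 0].
Proof.
apply: sub_finite_set (finite_ramification hp hF Dt) => x h.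
by exists (unif x); first exact: ord_unif.
Qed.

Lemma expoE x : expo x = ord x v + p.-1%:Z * ord x (D (unif x)).
Proof. by rewrite /expo /vlocal ordM ?expf_neq0 // ordX -mulr_natl natz. Qed.

(** Where [v] and [D (unif x)] are units, [expo x = 0], so the point is neither marked nor
    supersingular. *)
Lemma stalk_at_generic : finite_set [set x | stalk_at x <> lattice x 1%:M].
Proof.
apply: (@sub_finite_set _ _ ([set x : place iota | ord x v != 0] `|` [set x : place iota | ord x (D (unif x)) != 0])).
  move=> x; apply: contra_notP => /not_orP[/negP + /negP]; rewrite !negbK => /eqP ov /eqP od.
  have e0 : expo x = 0 by rewrite expoE ov od mulr0.
  have nss : ~ SS x by move=> /hSS; rewrite e0.
  have nm : ~ M x by move=> /hM[_]; rewrite e0 dvdz0.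
  have [_ /(_ nss) c0 _] := tailP x.
  rewrite stalk_at_lattice /level !asboolF // e0 od mulr0 subr0 expr0z c0.
  congr lattice; apply/row_matrixP => i.
  by apply: row2P; case: (unliftP ord0 i) => [i' ->|->]; rewrite ?(ord1 i') !mxE.
by rewrite finite_setU; split; [apply: finite_ord_neq0|exact: finite_ord_uniformizer].
Qed.

Lemma stalk_at_free x : exists2 B, B \in unitmx & stalk_at x = lattice x B.
Proof.
exists (mx22 (unif x ^ level x) 0 (tail x) 1); last exact: stalk_at_lattice.
by rewrite mx22_unit // mulr1 mul0r subr0 expfz_neq0.
Qed.

Hypothesis Mfin : finite_set M.

Definition datum_vbundle : vbundle iota 2 := VBundle stalk_at_free stalk_at_generic.

Definition datum_flat : flat_bundle iota 2 :=
  @FlatBundle _ _ iota 2 datum_vbundle M Mfin connection connection_linear connectionD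
    connection_leibniz connection_stalk.

Lemma hodge_at_generator x (B : 'M[K]_2) : B 0 0 = 0 -> B 0 1 != 0 ->
  ord x (B 0 1) = pole x ->
  hodge_at x = [set s | exists2 c, local_ring x c & s = c *: row 0 B].
Proof.
move=> B00 B01 oB; apply/seteqP; split=> s.
  move=> [e h]; exists (s 0 1 / B 0 1).
    by rewrite /local_ring mulrC max_pow_divl ?invr_eq0 // ordV oB sub0r opprK.
  by apply: row2P; rewrite !mxE ?B00 ?mulr0 // divfK.
move=> [c hc ->]; split; rewrite !mxE ?B00 ?mulr0 //.
by apply: max_powMl => //; right; rewrite oB.
Qed.

Lemma hodge_at_filtration : filtration datum_flat hodge_at.
Proof.
split.
  exists (basis_e0 K).
    by apply/eqP => /rowP/(_ 1)/eqP; rewrite !mxE /= oner_eq0.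
  move=> x s [e _]; exists (s 0 1); apply: row2P; rewrite !mxE /= ?mulr0 ?mulr1 //.
move=> x /=; have [sx|nsx] := pselect (SS x).
  have [/(_ sx)[c0 oc] _ _] := tailP x.
  (* The first row must generate the filtration. From [unif x] e_0 and e_0 + [tail x] D^(p) one
     recovers [unif x * tail x] D^(p), of order [level x]. *)
  exists (mx22 0 (unif x) (tail x) 1); split.
  - by rewrite mx22_unit // mul0r sub0r oppr_eq0 mulf_neq0.
  - apply/seteqP; split=> s; rewrite latticeP !mxE /=.
      move=> [h1 h2]; pose y0 := - ((s 0 0 - s 0 1 * tail x) / (unif x * tail x)).
      have hy : max_pow x 0 y0.
        apply: max_powN; rewrite mulrC max_pow_divl ?invr_eq0 ?mulf_neq0 //.
        by rewrite ordV ordM // oc ord_unif addrCA subrr addr0 sub0r opprK.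
      exists y0, (s 0 1 - y0 * unif x); split=> //.
      + apply: max_powB => //; apply: max_powMl => //; right; by rewrite ord_unif.
      + by rewrite /y0; field; rewrite u0 c0.
      + by rewrite mulr1 addrC subrK.
    move=> [y0 [y1 [h0 h1 e0 e1]]]; rewrite mulr0 add0r in e0; rewrite mulr1 in e1.
    split; rewrite e1.
      by apply: max_powD => //; apply: max_powMl => //; right; rewrite ord_unif.
    have -> : s 0 0 - (y0 * unif x + y1) * tail x = - (y0 * (unif x * tail x)).
      by rewrite e0; ring.
    apply: max_powN; apply: max_powMl => //; right.
    by rewrite ordM // oc ord_unif addrCA subrr addr0.
  - by apply: hodge_at_generator; rewrite !mxE //= ord_unif /pole asboolT.
have [_ /(_ nsx) c0 _] := tailP x.
exists (mx22 0 1 (unif x ^ level x) 0); split.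
- by rewrite mx22_unit // mul0r sub0r oppr_eq0 mul1r expfz_neq0.
- rewrite stalk_at_lattice c0; apply/seteqP; split=> s; rewrite !latticeP !mxE /=;
    by move=> [y0 [y1 [h0 h1 e0 e1]]]; exists y1, y0; split; rewrite ?e0 ?e1; try ring.
- by apply: hodge_at_generator; rewrite !mxE ?oner_neq0 //= ord_one /pole asboolF.
Qed.

Lemma stalk_atN x s : stalk_at x s -> stalk_at x (- s).
Proof. by rewrite -scaleN1r; apply: stalk_atZ; apply/max_powN/max_pow1. Qed.

Lemma tau_log_self x : tau_log M x (dlog x).
Proof. by rewrite tau_log_dlog; exists 1; rewrite ?scale1r //; right; rewrite ord_one. Qed.

(** Modulo the filtration only the coordinate of [D^(p)] matters, where the map is multiplication by
    [v * dlog x t]; the preimage is a quotient, whose order [v_dlog_t] controls. *)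
Lemma datum_kodaira_spencer : kodaira_spencer_iso datum_flat hodge_at.
Proof.
move=> x; exists (dlog x); split; first exact: tau_log_dlog.
move=> e he; have [w0 ow] := v_dlog_t x.
pose f := e 0 0 / (v * dlog x t).
pose s := f *: basis_e0 K.
have s00 : s 0 0 = 0 by rewrite !mxE mulr0.
have s01 : s 0 1 = f by rewrite !mxE mulr1.
have hf : max_pow x (pole x) f.
  rewrite /f mulrC max_pow_divl ?invr_eq0 // ordV ow opprK mulr2n.
  have -> : pole x + (level x - (pole x + pole x)) = level x - pole x by ring.
  exact: stalk_at_fst.
have hs : hodge_at x s by split; rewrite ?s01.
exists s; split.
  split=> //; apply/hodge_atE; split.
    apply: stalk_atD; last exact: stalk_atN.
    exact: (connection_stalk (@tau_log_self x) (proj1 (proj1 (hodge_atE x s) hs))).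
  by rewrite !mxE /= mulr0 der_0 add0r mulr1 /f divfK ?subrr.
move=> s' [[s'0 _] [+ _]]; rewrite !mxE /= s'0 der_0 add0r => /eqP.
rewrite subr_eq0 => /eqP e0; apply: row2P; first by rewrite s00 s'0.
by rewrite s01 /f -e0 mulfK.
Qed.

(** The residue sends e_0 to [v * dlog x t] times [D^(p)], of order exactly [level x]: a generator
    of the stalk of [T(S)]. *)
Lemma datum_monodromy x : M x -> monodromy_neq0 datum_flat x.
Proof.
move=> mx; have nss : ~ SS x by case/hM: mx.
exists (unif x), (dlog x); split; first exact: ord_unif.
  by rewrite /dlog /log_der asboolT //= mulVf // mulr1.
have [_ /(_ nss) c0 _] := tailP x; have [w0 ow] := v_dlog_t x.
exists (basis_e0 K).
  by split; rewrite !mxE /= ?c0 ?mulr0 ?subr0; [right; rewrite ord_one|left].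
move=> [f [s1 [hf [_ h1] /rowP/(_ 0)]]]; rewrite !mxE /= der_0 add0r mul1r => e.
rewrite c0 mulr0 subr0 in h1.
have := max_powM hf h1; rewrite -e => /(max_pow_ord w0); rewrite ow /pole asboolF //.
by rewrite mul0rn; lia.
Qed.

Definition datum_bundle : indigenous_bundle iota :=
  IndigenousBundle hodge_at_filtration datum_kodaira_spencer datum_monodromy.

(** The numbers [n_at], expressed through [expo x = (p - 1)(1 - sigma)]. *)
Definition vanishing x : int :=
  if `[< SS x >] then 0 else if `[< M x >] then p%:Z - 1 - expo x else - expo x.

(** At a singular point this is the bound on the order of [vlocal]; at an ordinary point that order
    is also divisible by [p], so being below [p] it is at most 0. *)
Lemma vanishing_ge0 x : 0 <= vanishing x.
Proof.
have lt : expo x < p by apply: (ord_vlocal_lt hp hp2 hF Dt v0 cartier (ord_unif x)).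
rewrite /vanishing; case: asboolP => sx //; case: asboolP => mx; first by lia.
have : (p%:Z %| expo x)%Z by apply: contrapT => /negP h; apply: mx; exact/hM.
have p0 : 0 < p%:Z by have := prime_gt0 p_pr; lia.
case/dvdzP => m e; move: lt; rewrite e -{2}[p%:Z]mul1r ltr_pM2r // oppr_ge0 => m1.
by rewrite pmulr_lle0 //; lia.
Qed.

(** The right-hand side is the order of a generator of [T] in the coordinate of [D^(p)], so
    [level x] is that of [T(S)]. *)
Lemma dlog_vanishing x : level x + vanishing x = p%:Z * ord x (dlog x t).
Proof.
have [_ ->] := dlog_t x; rewrite /level /vanishing.
case: asboolP => sx; first by rewrite (asboolF (_ : ~ M x)); [ring|case/hM].
by case: asboolP => mx; ring.
Qed.

Variable S : place iota -> rat.
Hypothesis hS : forall x, S x = (vanishing x)%:~R.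

Lemma T_twistE x a : T_twist p M S D x a <-> max_pow x (level x) a.
Proof.
have [d0 od] := dlog_t x; have lE := dlog_vanishing x.
split=> [[h [c [f [hh hc]]]]|ha].
  rewrite tau_log_dlog => -[b hb e] ->.
  have fE : f = b * dlog x t.
    by have := congr1 (fun E : der iota => E t) e; rewrite /= Dt mulr1.
  have hf : max_pow x (ord x (dlog x t)) f.
    by rewrite fE; apply: max_powMl => //; right.
  have {}hh : max_pow x (- vanishing x) h.
    by case: hh => [->|]; [left|rewrite hS -rmorphN ler_int; right].
  rewrite mulrCA; apply: max_powMl => //.
  have := max_powM hh (max_powX p hf); rewrite -mulr_natl natz -lE.
  by rewrite addrCA addNr addr0.
have dp0 : dlog x t ^+ p != 0 by rewrite expf_neq0.
exists (a / dlog x t ^+ p), 1, (dlog x t); split.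
- have : max_pow x (- vanishing x) (a / dlog x t ^+ p).
    rewrite mulrC max_pow_divl ?invr_eq0 // ordV ordX -mulr_natl natz opprK -lE.
    by rewrite addrCA addNr addr0.
  by rewrite hS -rmorphN ler_int.
- by right; rewrite ord_one.
- by rewrite -(der_unique hp hF (dlog x) Dt); exact: tau_log_self.
- by rewrite mul1r divfK.
Qed.

Lemma datum_extends : extends_construction p M (~` SS) S D v datum_bundle.
Proof.
split=> //.
- move=> x nss; have [_ /(_ nss) c0 _] := tailP x.
  apply/seteqP; split=> s [h1 h2]; split=> //.
    by rewrite c0 mulr0 subr0 in h2; apply/T_twistE.
  by rewrite c0 mulr0 subr0; apply/T_twistE.
- by apply: row2P; rewrite !mxE /= ?der_1 ?der_0 ?mul0r ?addr0.
- by apply: row2P; rewrite !mxE /= ?der_1 ?der_0 ?Dt ?mulr0 ?mulr1 ?mul1r ?add0r.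
Qed.

Lemma e0_section : rational_section hodge_at (basis_e0 K).
Proof.
move=> x; exists (unif x ^ (- pole x)), ((unif x ^ pole x) *: basis_e0 K).
split; first by split; rewrite !mxE /= ?mulr0 ?mulr1 //; right; rewrite ordXz ord_unif mulr1.
by rewrite scalerA -expfzDr // addNr expr0z scale1r.
Qed.

Definition e0_coordinate (s : 'rV[K]_2) : K^o := s 0 1.

Lemma e0_coordinate_linear : linear e0_coordinate.
Proof. by move=> a s1 s2; rewrite /e0_coordinate !mxE. Qed.

HB.instance Definition _ :=
  GRing.isLinear.Build K 'rV[K]_2 K^o _ e0_coordinate e0_coordinate_linear.

Lemma e0_coordinate_image x : e0_coordinate @` stalk_at x = local_ring x.
Proof.
apply/seteqP; split=> [_ [s [hs _] <-] //|f hf].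
exists (\row_j (if j == 0 then f * tail x else f)); last by rewrite /e0_coordinate mxE.
by split; rewrite !mxE //= subrr; left.
Qed.

Lemma datum_compatible : compatible datum_bundle.
Proof. by split; [exact: e0_section|exact: e0_coordinate_image]. Qed.

Lemma datum_horizontal : horizontal_epi datum_flat e0_coordinate.
Proof. by split; [exact: e0_coordinate_image|move=> D' s; rewrite /= /e0_coordinate mxE]. Qed.

(** * The p-curvature *)

Lemma iter_connection_scale D' n f s : iter n (connection D') (f *: s) =
  \sum_(i < n.+1) (iter (n - i) D' f *: iter i (connection D') s) *+ 'C(n, i).
Proof.
have cD : {morph connection D' : s1 s2 / s1 + s2} by move=> *; exact: connectionD.
have c0 : connection D' 0 = 0 by apply: (addrI (connection D' 0)); rewrite -cD !addr0.
have cn s' m : connection D' (s' *+ m) = connection D' s' *+ m.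
  by elim: m => [|m IH]; rewrite ?mulr0n // !mulrS cD IH.
elim: n => [|n IH]; first by rewrite big_ord1 bin0.
rewrite iterS IH (big_morph _ cD c0).
transitivity (\sum_(i < n.+1) (iter (n - i).+1 D' f *: iter i (connection D') s) *+ 'C(n, i) +
   \sum_(i < n.+1) (iter (n - i) D' f *: iter i.+1 (connection D') s) *+ 'C(n, i)).
  rewrite -big_split; apply: eq_bigr => i _.
  by rewrite cn connection_leibniz mulrnDl.
rewrite [in RHS]big_ord_recl /= bin0 [X in X + _ = _]big_ord_recl /= bin0.
rewrite -addrA subn0; congr (_ + _).
rewrite [X in _ + X]big_ord_recr /= [in RHS]big_ord_recr /= addrA.
rewrite !subnn !binn; congr (_ + _).
rewrite -big_split /=; apply: eq_bigr => i _.
rewrite binS mulrnDr /bump /= add1n subSS; congr (_ *+ _ + _).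
by rewrite -[in RHS](subnSK (ltn_ord i)).
Qed.

(** On e_0 the p-th iterate of the connection is the [(p-1)]-st derivative of [v * D' t], which
    [cartier] evaluates; its term with [iter p D' t] is cancelled by the connection along the p-th
    power of [D']. *)
Lemma pcurv_datum D' c s : pcurv hp datum_flat D' c s =
  - (c * s 0 1 * D' t ^+ p) *: basis_Dp K.
Proof.
have hpK : p \in [pchar K] by rewrite (fmorph_pchar iota).
rewrite /pcurv /=.
have iterDp n a : iter n (connection D') (a *: basis_Dp K) = iter n D' a *: basis_Dp K.
  elim: n => [|n IH] //; rewrite !iterS IH; apply: row2P; rewrite !mxE /=.
    by rewrite mulr1 mulr0 mul0r addr0 mulr1.
  by rewrite !mulr0 der_0.
have itp f w : iter p (connection D') (f *: w) = iter p D' f *: w + f *: iter p (connection D') w.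
  rewrite iter_connection_scale; case: (p) p_pr hpK => // q q_pr hq.
  rewrite big_ord_recr big_ord_recl /= subnn bin0 binn !mulr1n big1 ?addr0 // => i _.
  rewrite -scaler_nat; have /dvdnP[m ->] : (q.+1 %| 'C(q.+1, bump 0 i))%N.
    by apply: prime_dvd_bin; rewrite // /bump /= add1n ltnS.
  by rewrite natrM (pcharf0 hq) mulr0 scale0r.
have e0p : iter p (connection D') (basis_e0 K) =
    (v * iter p D' t - D' t ^+ p) *: basis_Dp K.
  rewrite -cartier -iterDp -{1}(prednK (prime_gt0 p_pr)) iterSr; congr (iter _ _ _).
  by apply: row2P; rewrite !mxE /= ?der_0 ?der_1 ?add0r ?mul1r ?mulr1 ?mulr0.
have -> : iter p (connection D') s = iter p D' (s 0 0) *: basis_Dp K +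
    (iter p D' (s 0 1) *: basis_e0 K + s 0 1 *: ((v * iter p D' t - D' t ^+ p) *: basis_Dp K)).
  have {1}-> : s = s 0 0 *: basis_Dp K + s 0 1 *: basis_e0 K.
    by apply: row2P; rewrite !mxE /= ?mulr1 ?mulr0 ?addr0 ?add0r.
  have itD n s1 s2 : iter n (connection D') (s1 + s2) =
      iter n (connection D') s1 + iter n (connection D') s2.
    by elim: n => [|n IH] //; rewrite !iterS IH connectionD.
  by rewrite itD iterDp itp e0p.
by apply: row2P; rewrite !mxE /=; ring.
Qed.

Lemma datum_active : active_bundle hp datum_flat.
Proof.
exists D, 1, (basis_e0 K); rewrite pcurv_datum => /rowP/(_ 0)/eqP.
by rewrite !mxE /= Dt expr1n !mulr1 oppr_eq0 oner_eq0.
Qed.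

Lemma datum_nilpotent : nilpotent_bundle hp datum_flat.
Proof.
move=> D' c; exists 2%N => s /=; rewrite !pcurv_datum !mxE /=.
by rewrite !mulr0 mul0r oppr0 scale0r.
Qed.

Lemma datum_pcurv_order x : exists2 n : nat, n%:R = S x & pcurv_order hp datum_flat x n.
Proof.
have [d0 od] := dlog_t x; have lE := dlog_vanishing x; have n0 := vanishing_ge0 x.
exists `|vanishing x|%N; first by rewrite hS pmulrn gez0_abs.
split.
  move=> D' c s; rewrite tau_log_dlog => -[b hb ->] hc [h1 _]; rewrite pcurv_datum /=.
  exists (unif x ^+ `|vanishing x|%N).
  exists ((unif x ^+ `|vanishing x|%N)^-1 *: (- (c * s 0 1 * (b * dlog x t) ^+ p) *: basis_Dp K)).
  have un0 : unif x ^+ `|vanishing x|%N != 0 by rewrite expf_neq0.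
  split; [|split|].
  - by right; rewrite ordX ord_unif natz.
  - by rewrite !mxE /= !mulr0; left.
  - rewrite !mxE /= mulr1 !mulr0 mul0r subr0 max_pow_divl ?invr_eq0 // ordV opprK.
    rewrite ordX ord_unif natz gez0_abs // lE; apply: max_powN.
    apply: max_powMl; first exact: max_powMl.
    rewrite exprMn; apply: max_powMl; last by right; rewrite ordX -mulr_natl natz.
    by have := max_powX p hb; rewrite mul0rn.
  - by rewrite scalerA mulfV // scale1r.
move=> H.
(* The p-curvature sends this generator to [- dlog x t ^+ p], of order exactly
   [level x + vanishing x]. *)
pose s : 'rV[K]_2 := \row_j (if j == 0 then tail x else 1).
have hs : stalk_at x s by split; rewrite !mxE /= ?mul1r ?subrr; [right; rewrite ord_one|left].
have [|f [s1 [hf [h1 h2] e]]] := H (dlog x) 1 s (@tau_log_self x) _ hs.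
  by right; rewrite ord_one.
move/rowP: e => e; have := e 0; have := e 1.
rewrite pcurv_datum !mxE /= !mulr0 !mulr1 ?mul1r => e1 e0.
have {}h2 : max_pow x (vanishing x + 1 + level x) (dlog x t ^+ p).
  have [f0|f0] := eqVneq f 0.
    by rewrite f0 mul0r in e0; move/eqP: e0; rewrite oppr_eq0 expf_eq0 (negPf d0) andbF.
  have s10 : s1 0 1 = 0 by move/esym/eqP: e1; rewrite mulf_eq0 (negPf f0) => /eqP.
  rewrite s10 mul0r subr0 in h2.
  have := max_powM hf h2; rewrite -e0 => /max_powN; rewrite opprK.
  by rewrite -addn1 PoszD gez0_abs.
have := max_pow_ord (expf_neq0 p d0) h2; rewrite ordX -mulr_natl natz -lE; lia.
Qed.

(** The horizontal surjection is arbitrary, so it must be shown to be the projection to e_0 up to a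
    factor. It sends [D^(p)] to a constant [a] and e_0 to some [b] with [D b = v a]; applying [D]
    another [p - 1] times gives [0 = - a]. *)
Lemma datum_supersingular : bundle_supersingular datum_bundle = SS.
Proof.
apply/seteqP; split=> x /=.
  move=> [gamma [e [[himg hnab] hsec ge nhe]]].
  apply: contrapT => nss; apply: nhe.
  have pE : pole x = 0 by rewrite /pole asboolF.
  pose a := gamma (basis_Dp K) : K; pose b := gamma (basis_e0 K) : K.
  have hnab' D' w : gamma (connection D' w) = D' (gamma w) := hnab D' w.
  have Da (D' : der iota) : D' a = 0.
    transitivity (gamma (connection D' (basis_Dp K))); first exact/esym/hnab'.
    have -> : connection D' (basis_Dp K) = 0.
      by apply: row2P; rewrite !mxE /= ?der_1 ?der_0 ?mul0r ?addr0.
    exact: linear0.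
  have Db (D' : der iota) : D' b = v * D' t * a.
    transitivity (gamma (connection D' (basis_e0 K))); first exact/esym/hnab'.
    have -> : connection D' (basis_e0 K) = (v * D' t) *: basis_Dp K.
      by apply: row2P; rewrite !mxE /= ?der_1 ?der_0 ?add0r ?mul1r ?mulr1 ?mulr0.
    by rewrite linearZ.
  have a0 : a = 0.
    have iD n f : iter n D (a * f) = a * iter n D f.
      by elim: n => [|n IH] //; rewrite !iterS IH; have [_ -> _] := derP D; rewrite Da mul0r add0r.
    have Dp f : iter p D f = 0.
      have := congr1 (fun E : der iota => E f) (der_unique hp hF (der_pow hp D) Dt).
      rewrite [LHS]/= => ->; rewrite /=; have -> : iter p D t = 0.
        rewrite -(prednK (prime_gt0 p_pr)) iterSr Dt.
        case: (p) hp2 => [|[|q]] // _; rewrite iterSr der_1.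
        by elim: (q) => //= m ->; rewrite der_0.
      by rewrite mul0r.
    have := Dp b; rewrite -(prednK (prime_gt0 p_pr)) iterSr Db mulrC iD cartier Dp.
    by rewrite Dt expr1n mulr0 sub0r mulrN1 => /eqP; rewrite oppr_eq0 => /eqP.
  have gE s : gamma s = s 0 1 * b.
    have {1}-> : s = s 0 0 *: basis_Dp K + s 0 1 *: basis_e0 K.
      by apply: row2P; rewrite !mxE /= ?mulr1 ?mulr0 ?addr0 ?add0r.
    rewrite linearD !linearZ /= -/a -/b a0; exact: (etrans (congr1 (+%R^~ _) (mulr0 _)) (add0r _)).
  have [f [s1 [[s10 hs1] ef]]] := hsec x.
  have e0 : e 0 0 = 0 by rewrite ef !mxE s10 mulr0.
  have be : e 0 1 * b = 1 by rewrite -gE ge.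
  have b0 : b != 0 by apply: contra_eq_neq be => ->; rewrite mulr0 eq_sym oner_eq0.
  (* Surjectivity at [x] makes [b] a unit, so the canonical section [b^-1] e_0 has a pole only where
     e_0 has one. *)
  have hb : ord x b = 0.
    have [s hs] : exists2 s, stalk_at x s & gamma s = 1 :> K.
      have : local_ring x 1 by right; rewrite ord_one.
      by rewrite -himg => -[s hs es]; exists s.
    rewrite gE => e1; have s01 : s 0 1 != 0.
      by apply: contra_eq_neq e1 => ->; rewrite mul0r eq_sym oner_eq0.
    have := congr1 (ord x) e1; rewrite ord_one ordM // => h.
    have h1 : 0 <= ord x (s 0 1) by apply: (max_pow_ord s01); case: hs.
    have : local_ring x b.
      rewrite -himg; exists (\row_j (if j == 0 then tail x else 1)).
        by split; rewrite !mxE /= ?mul1r ?subrr; [right; rewrite ord_one|left].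
      by rewrite gE !mxE /= mul1r.
    move/(max_pow_ord b0); move: (ord x (s 0 1)) (ord x b) h h1 => m n; lia.
  split=> //; have -> : e 0 1 = b^-1 by rewrite -[LHS](mulfK b0) be mul1r.
  by right; rewrite ordV hb pE.
move=> sx; exists e0_coordinate, (basis_e0 K); split.
- exact: datum_horizontal.
- exact: e0_section.
- by rewrite /= /e0_coordinate mxE.
- by move=> [_]; rewrite !mxE /= max_pow1 /pole asboolT.
Qed.

(** * Uniqueness of the extension *)

Section Uniqueness.
Variable E : indigenous_bundle iota.
Hypothesis hE : extends_construction p M (~` SS) S D v E.
Hypothesis hEc : compatible E.

Lemma nabla_extension D' s : nabla E D' s = connection D' s.
Proof.
have [_ _ nDp ne0] := hE.
have n0 s1 : nabla E 0 s1 = 0.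
  have := nabla_linear E 1 0 0 s1; rewrite scale1r addr0 scale1r => e.
  by apply: (addrI (nabla E 0 s1)); rewrite -e addr0.
have nD s1 : nabla E D s1 = connection D s1.
  have {1}-> : s1 = s1 0 0 *: basis_Dp K + s1 0 1 *: basis_e0 K.
    by apply: row2P; rewrite !mxE /= ?mulr1 ?mulr0 ?addr0 ?add0r.
  rewrite nablaD !nabla_leibniz nDp ne0.
  by apply: row2P; rewrite !mxE /= ?Dt; ring.
rewrite (der_unique hp hF D' Dt) -[_ *: D]addr0 nabla_linear n0 addr0 nD.
by apply: row2P; rewrite !mxE /= ?Dt; ring.
Qed.

Lemma hodge_basis x : exists B : 'M[K]_2, [/\ B \in unitmx, E x = lattice x B,
  hodge E x = [set s | exists2 c, local_ring x c & s = c *: row 0 B],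
  B 0 0 = 0 & B 0 1 != 0 /\ B 1 0 != 0].
Proof.
have [_ /(_ x)[B [Bu EB HB]]] := hodge_filtration E.
exists B; have [hsec _] := hEc; have [f [s0 []]] := hsec x; rewrite HB => -[c hc ->].
rewrite scalerA => /rowP e.
have e0 := e 0; have e1 := e 1; rewrite !mxE /= in e0 e1.
have fc0 : f * c != 0 by apply: contra_eq_neq e1 => ->; rewrite mul0r oner_eq0.
have B00 : B 0 0 = 0 by move/esym/eqP: e0; rewrite mulf_eq0 (negPf fc0) => /eqP.
split=> //; split.
  by apply: contra_eq_neq e1 => ->; rewrite mulr0 oner_eq0.
apply/eqP => B10; have /matrixP/(_ 0 0) := mulVmx Bu.
rewrite !mxE big_ord_recl big_ord1 (_ : lift _ _ = 1); last exact: val_inj.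
by rewrite B00 B10 !mulr0 addr0 /= => /esym/eqP; rewrite oner_eq0.
Qed.

(** The second basis vector lies outside [K e_0], so the stalk determines the filtration. *)
Lemma hodge_extension x s : hodge E x s <-> E x s /\ s 0 0 = 0.
Proof.
have [B [Bu EB -> B00 [B01 B10]]] := hodge_basis x; split=> [[c hc ->]|[]].
  split; last by rewrite !mxE B00 mulr0.
  rewrite EB latticeP; exists c, 0; rewrite !mxE !mul0r !addr0; split=> //.
  by left.
rewrite EB latticeP => -[y0 [y1 [h0 h1 e0 e1]]] s00.
move: e0; rewrite s00 B00 mulr0 add0r => /esym/eqP; rewrite mulf_eq0 (negPf B10) orbF.
move=> /eqP y10; exists y0 => //; apply: row2P; rewrite !mxE.
  by rewrite s00 B00 mulr0.
by rewrite e1 y10 mul0r addr0.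
Qed.

Section AtSupersingular.
Variable x : place iota.
Hypothesis sx : SS x.

Let nM : ~ M x. Proof. by case/hM. Qed.
Let pole1 : pole x = 1. Proof. by rewrite /pole asboolT. Qed.
Let u := unif x.
Let w := v * dlog x t.
Let w0 : w != 0. Proof. by case: (v_dlog_t x). Qed.
Let ow : ord x w = level x - 2.
Proof. by rewrite (proj2 (v_dlog_t x)) pole1. Qed.
Let dvdl : (p%:Z %| level x)%Z. Proof. exact: dvd_level. Qed.

Let dlogE : dlog x = dlocal D u.
Proof. by rewrite /dlog /log_der asboolF. Qed.

Lemma ndvd_level (i : int) : 0 < i < p%:Z -> ~~ (p%:Z %| level x - i)%Z.
Proof.
move=> /andP[i0 ip]; apply/negP => h.
have : (p%:Z %| i)%Z by rewrite -(subKr (level x) i) rpredB.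
by case: i i0 ip {h} => // m m0 mp; rewrite dvdzE /= gtnNdvd.
Qed.

Lemma ord_dlog_pole f (i : int) : f != 0 -> ord x f = level x - i -> 0 < i < p%:Z ->
  dlog x f != 0 /\ ord x (dlog x f) = level x - i - 1.
Proof.
move=> f0 of0 hi; rewrite dlogE -of0; apply: (ord_dlocal hp hF Dt (ord_unif x) f0).
by rewrite of0 ndvd_level.
Qed.

Lemma tau_log_extension D' : tau_log (marked E) x D' <->
  exists2 a, local_ring x a & D' = a *: dlog x.
Proof. by have [-> _ _ _] := hE; rewrite tau_log_dlog. Qed.

(* With rows [(0, f)] (spanning the Hodge filtration) and [(c, g)] for a basis of
   the stalk, the Kodaira-Spencer isomorphism forces [ord c = ord f + level - 2]. *)
Lemma hodge_basis_ord (B : 'M[K]_2) : E x = lattice x B ->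
  hodge E x = [set s | exists2 c, local_ring x c & s = c *: row 0 B] ->
  B 0 0 = 0 -> B 0 1 != 0 -> B 1 0 != 0 ->
  ord x (B 1 0) = ord x (B 0 1) + level x - 2.
Proof.
move=> EB HB B00 B01 B10.
have lat0 : E x (row 0 B).
  rewrite EB latticeP; exists 1, 0; rewrite !mxE !mul1r !mul0r !addr0; split=> //.
    by right; rewrite ord_one.
  by left.
have lat1 : E x (row 1 B).
  rewrite EB latticeP; exists 0, 1; rewrite !mxE !mul1r !mul0r !add0r; split=> //.
    by left.
  by right; rewrite ord_one.
apply/eqP; rewrite eq_le; apply/andP; split.
  (* Stability under the connection gives this inequality, surjectivity of the Kodaira-Spencer map
     the opposite one. *)
  have : E x (connection (dlog x) (row 0 B)).
    rewrite -nabla_extension; apply: nabla_stalk => //.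
    by apply/tau_log_extension; exists 1; rewrite ?scale1r //; right; rewrite ord_one.
  rewrite EB latticeP => -[y0 [y1 [_ h1 + _]]].
  rewrite !mxE /= B00 der_0 mulr0 !add0r -/w => e.
  have y10 : y1 != 0.
    apply: contraNneq (mulf_neq0 B01 w0) => y10; by rewrite e y10 mul0r.
  have := congr1 (ord x) e; rewrite (ordM x B01 w0) (ordM x y10 B10) ow; have := max_pow_ord y10 h1.
  by move: (ord x y1) (ord x (B 1 0)) (ord x (B 0 1)) (level x) => a b c d; lia.
have [D0 [tD0 ks]] := hodge_ks E x.
have [a ha D0E] : exists2 a, local_ring x a & D0 = a *: dlog x.
  by apply/tau_log_extension; rewrite tD0; exists 1; rewrite ?scale1r //; right; rewrite ord_one.
have [s [[+ +] _]] := ks _ lat1; rewrite HB => -[y hy ->] [y' _ /rowP/(_ 0)].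
rewrite nabla_extension D0E !mxE /= B00 !mulr0 der_0 !mulr0 add0r => /eqP.
rewrite subr_eq0 => /eqP e.
have e' : y * a * (B 0 1 * w) = B 1 0 by rewrite -e /w; ring.
have ya0 : y * a != 0 by apply: contraNneq B10 => ya0; rewrite -e' ya0 mul0r.
have hya : max_pow x 0 (y * a) by apply: max_powMl.
have := congr1 (ord x) e'; rewrite (ordM x ya0 (mulf_neq0 B01 w0)) (ordM x B01 w0) ow.
have := max_pow_ord ya0 hya.
by move: (ord x (y * a)) (ord x (B 1 0)) (ord x (B 0 1)) (level x) => a' b c d; clear; lia.
Qed.

(** Let [(0, f)], [(c, g)] be a basis of the stalk. Once [f] is known to vanish at [x], surjectivity
    onto the local ring makes [g] a unit, and stability makes e_0 + [c / g] D^(p) horizontal up to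
    order [level x]. As [tail x] has the same property, the two can be compared. *)
Lemma stalk_extension_ss : E x = stalk_at x.
Proof.
have [B [Bu EB HB B00 [B01 B10]]] := hodge_basis x.
have oc := hodge_basis_ord EB HB B00 B01 B10.
have [_ himg] := hEc.
set f := B 0 1 in oc B01; set c := B 1 0 in oc B10; set g := B 1 1.
have latE s : E x s <-> exists y0 y1, [/\ local_ring x y0, local_ring x y1,
    s 0 0 = y1 * c & s 0 1 = y0 * f + y1 * g].
  rewrite EB latticeP; split=> -[y0 [y1 [a1 a2 a3 a4]]]; exists y0, y1; split=> //.
    by rewrite a3 B00 mulr0 add0r.
  by rewrite B00 mulr0 add0r.
have O0 : local_ring x 0 by left.
have O1 : local_ring x 1 by right; rewrite ord_one.
have snd s : E x s -> local_ring x (s 0 1) by move=> hs; rewrite -himg; exists s.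
have E0 : E x (row 0 B).
  by apply/latE; exists 1, 0; rewrite !mxE B00 !mul0r mul1r addr0.
have E1 : E x (row 1 B).
  by apply/latE; exists 0, 1; rewrite !mxE !mul0r !mul1r add0r.
have hf : max_pow x 0 f by have := snd _ E0; rewrite mxE.
have hg : max_pow x 0 g by have := snd _ E1; rewrite mxE.
have stable s : E x s -> E x (connection (dlog x) s).
  move=> hs; rewrite -nabla_extension; apply: nabla_stalk => //.
  by apply/tau_log_extension; exists 1; rewrite ?scale1r.
have [dD dM _] := derP (dlog x).
have p_gt2 : (2 : int) < p by have := hp2; lia.
(* If [f] were a unit, the stalk would contain [c] D^(p) with [c] of order [level x - 2]. This is
   prime to [p], so differentiation lowers it and leads out of the stalk. *)
have m_gt0 : 0 < ord x f.
  rewrite lt_neqAle (max_pow_ord B01 hf) andbT eq_sym; apply/eqP => m0.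
  rewrite m0 add0r in oc.
  have hfV : max_pow x 0 f^-1 by right; rewrite ordV m0.
  have [|dc0 odc] := ord_dlog_pole B10 oc; first by move: p_gt2; clear; lia.
  have : E x (connection (dlog x) (\row_j (if j == 0 then c else 0))).
    apply: stable; apply/latE; exists (- (g * f^-1)), 1; rewrite !mxE /= !mul1r.
    by split=> //; [apply: max_powN; apply: max_powMl|rewrite mulNr divfK ?addNr].
  rewrite latE => -[y0 [y1 [_ h1 + _]]].
  rewrite !mxE /= mul0r addr0 => e.
  have y10 : y1 != 0 by apply: contraNneq dc0 => y10; rewrite e y10 mul0r.
  have := congr1 (ord x) e; rewrite odc ordM // oc; have := max_pow_ord y10 h1.
  by move: (ord x y1) (level x) => a b; clear; lia.
have [g0 og] : g != 0 /\ ord x g = 0.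
  have [s hs es] : exists2 s, E x s & s 0 1 = 1.
    by move: O1; rewrite -himg => -[s hs es]; exists s.
  move/latE: hs => [y0 [y1 [h0 h1 _]]]; rewrite es => e.
  have h : max_pow x 1 (1 - y1 * g).
    by rewrite e addrK; apply: max_powMl => //; right; rewrite -gtz0_ge1.
  have g0 : g != 0.
    by apply/eqP => ge; move: h; rewrite ge mulr0 subr0 max_pow1.
  split=> //; apply/eqP; rewrite eq_le (max_pow_ord g0 hg) andbT leNgt; apply/negP => og.
  have : max_pow x 1 (1 : K).
    rewrite -[X in max_pow _ _ X](subrK (y1 * g)); apply: max_powD => //.
    by apply: max_powMl => //; right; rewrite -gtz0_ge1.
  by rewrite max_pow1.
have hgV : max_pow x 0 g^-1 by right; rewrite ordV og.
pose c1 := c / g; have c10 : c1 != 0 by rewrite mulf_neq0 ?invr_eq0.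
have oc1 : ord x c1 = ord x f + level x - 2 by rewrite ord_div // og subr0.
(* The second row is mapped into the stalk; eliminating the derivative of [g] leaves a term
   divisible by [c * f], of order at least [level x]. *)
have dc1 : max_pow x (level x) (dlog x c1 + w).
  have /latE[y0 [y1 [h0 h1]]] := stable _ E1; rewrite !mxE /= -/c -/g -/w => e0 e1.
  have -> : dlog x c1 + w = - (c * (y0 * f) * (g^-1 * g^-1)).
    have cE : c = c1 * g by rewrite divfK.
    have := dM c1 g; rewrite -cE => ed; rewrite ed e1 in e0.
    apply: (mulIf g0); have -> : (dlog x c1 + w) * g =
      (dlog x c1 * g + c1 * (y0 * f + y1 * g) + g * w) - c1 * (y0 * f + y1 * g) by ring.
    by rewrite e0 /c1; field.
  apply: max_powN; apply: max_powMr; last exact: max_powMl.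
  rewrite mulrCA; apply: max_powMl => //.
  by right; rewrite ordM // oc; move: (ord x f) (level x) m_gt0 => a b; clear; lia.
have [/(_ sx)[tau0 otau] _ dtau] := tailP x.
set tau := tail x in tau0 otau dtau *.
(* A difference of order [level x - 1], prime to [p], would have a derivative of order
   [level x - 2], against [dd]. *)
have hd : max_pow x (level x) (c1 - tau).
  have [-> | d0] := eqVneq (c1 - tau) 0; first by left.
  have dd : max_pow x (level x) (dlog x (c1 - tau)).
    have := max_powB dc1 dtau; rewrite opprD addrACA -/w subrr addr0.
    have e := dD (c1 - tau) tau; rewrite subrK in e.
    by rewrite e addrK.
  have : max_pow x (level x - 1) (c1 - tau).
    apply: max_powB; last by right; rewrite otau.
    by right; rewrite oc1; move: (ord x f) (level x) m_gt0 => a b; clear; lia.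
  move=> /(max_pow_ord d0); rewrite le_eqVlt => /orP[/eqP/esym od|lt]; last first.
    by right; move: lt; move: (ord x (c1 - tau)) (level x) => a b; clear; lia.
  have [|dd0 odd] := ord_dlog_pole d0 od; first by move: p_gt2; clear; lia.
  by have := max_pow_ord dd0 dd; rewrite odd; move: (level x) => b; clear; lia.
(* The order of [c1] is now that of [tau], which fixes the order of [f]. *)
have of1 : ord x f = 1.
  have [|_] := @ord_addl _ _ _ x tau (c1 - tau) tau0; first by rewrite otau subrK.
  by rewrite addrC subrK oc1 otau; move: (ord x f) (level x) => a b; clear; lia.
have oc' : ord x c = level x - 1 by rewrite oc of1; ring.
apply/seteqP; split=> s.
  move/latE=> [y0 [y1 [h0 h1 e0 e1]]]; split.
    by rewrite e1; apply: max_powD; apply: max_powMl.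
  have -> : s 0 0 - s 0 1 * tau = y1 * g * (c1 - tau) - y0 * (f * tau).
    by rewrite e0 e1 /c1; field.
  apply: max_powB; apply: max_powMl => //; first exact: max_powMl.
  by right; rewrite ordM // of1 otau addrC subrK.
move=> [h1 h2]; apply/latE.
have hs0 : max_pow x (level x - 1) (s 0 0).
  by have := stalk_at_fst (conj h1 h2); rewrite pole1.
exists ((s 0 1 * (c1 - tau) - (s 0 0 - s 0 1 * tau)) * (c1^-1 * f^-1)), (s 0 0 / c).
split.
- rewrite /local_ring -(subrr (level x)); apply: max_powM.
    by apply: max_powB => //; apply: max_powMl.
  right; rewrite ordM ?invr_eq0 // !ordV of1 oc1 of1.
  by move: (level x) => b; clear; lia.
- rewrite /local_ring -(subrr (level x - 1)); apply: max_powM => //.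
  by right; rewrite ordV oc'.
- by rewrite divfK.
- by rewrite /c1; field; rewrite B01 B10 g0.
Qed.

End AtSupersingular.
Lemma stalk_extension x : E x = stalk_at x.
Proof.
have [sx|nsx] := pselect (SS x); first exact: stalk_extension_ss.
have [_ /(_ x nsx) -> _ _] := hE.
by have [_ /(_ x nsx) h _ _] := datum_extends; exact/esym/h.
Qed.

Lemma extension_unique : E = datum_bundle.
Proof.
have hst := stalk_extension; have [hm _ _ _] := hE.
apply: indigenous_bundle_ext => //; first exact/funext/hst.
- by apply/funext => D'; apply/funext => s; exact: nabla_extension.
- apply/funext => x; apply/seteqP; split=> s.
    by move/hodge_extension; rewrite hst => h; apply/hodge_atE.
  by move/hodge_atE => h; apply/hodge_extension; rewrite hst.
Qed.

End Uniqueness.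
End Stalks.

(** Multiplication by [p - 1], prime to [p], does not affect divisibility. This translates the
    congruence of [sigma] with 1 into divisibility of [expo]. *)
Lemma dvdz_numq (p : nat) (a : int) : (1 < p)%N ->
  prime p -> (p%:Z %| numq (- (a%:~R / p.-1%:R) : rat))%Z = (p%:Z %| a)%Z.
Proof.
move=> p1 p_pr; set q : rat := - _.
have q0 : p.-1%:R != 0 :> rat by rewrite pnatr_eq0 -lt0n -ltnS prednK // ltnW.
have E : numq q * p.-1%:Z = - a * denq q.
  apply: (@intr_inj rat); rewrite !rmorphM /= rmorphN /= -!pmulrn.
  have d0 : (denq q)%:~R != 0 :> rat by rewrite intr_eq0 denq_neq0.
  have qd : (numq q)%:~R = q * (denq q)%:~R by rewrite -{2}(divq_num_den q) divfK.
  by rewrite qd /q; field.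
have cop1 : coprimez p%:Z p.-1%:Z.
  by rewrite coprimezE /= prime_coprime //; apply/negP => /dvdn_leq; move: p1; lia.
apply/idP/idP => h.
  have copd : coprimez p%:Z (denq q).
    rewrite coprimezE; apply: coprime_dvdl (coprime_num_den q).
    by move: h; rewrite dvdzE.
  have : (p%:Z %| - a * denq q)%Z by rewrite -E dvdz_mulr.
  by rewrite Gauss_dvdzl // rpredN.
have : (p%:Z %| numq q * p.-1%:Z)%Z by rewrite E mulNr -mulrN dvdz_mulr.
by rewrite Gauss_dvdzl.
Qed.

Theorem proposition4p8 (p : nat) (k : closedFieldType) (K : fieldType)
  (iota : {rmorphism k -> K}) (g r : nat)
  (L : splittingFieldType K)
  (chi : {morphism ('Gal({:L} / 1))%g >-> {unit 'F_p}})
  (omega : rat_diff (cover_embedding iota L))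
  (hp : p \in [pchar k]) (hp2 : (2 < p)%N)
  (hX : function_field iota) (hg : has_genus iota g)
  (homega : deformation_datum chi omega)
  (hr : singular p omega #= `I_r)
  (hgr : (2 < 2 * g + r)%N)
  (t : K) (D : der iota) (hD : dd t D = 1)
  (z : L) (hz : forall D', omega D' = z * dd t%:A D')
  (v : K) (hv : z ^+ p.-1 = v^-1%:A) :
  exists E : indigenous_bundle iota,
    (* (i) *)
    (let extension (E' : indigenous_bundle iota) :=
       extends_construction p (singular p omega) (~` supersingular p omega)
         (n_at p omega) D v E' /\ compatible E' in
     extension E /\ forall E', extension E' -> E' = E) /\
    (* (ii) *)
    [/\ active_bundle hp E, nilpotent_bundle hp E & normalized_bundle E] /\
    (* (iii) *)
    (bundle_supersingular E = supersingular p omega /\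
     marked E = singular p omega) /\
    (* (iv) *)
    (forall x : place iota,
       exists2 n : nat, n%:R = n_at p omega x & pcurv_order hp E x n).
Proof.
have p_pr := pcharf_prime hp.
have Dt : D t = 1 := hD.
have v0 := v_neq0 homega hz hv.
have cartier := cartier_identity hp hX homega Dt hz hv.
have p1 : (p.-1%:R : rat) != 0 by rewrite pnatr_eq0 -lt0n -ltnS prednK ?prime_gt0 ?prime_gt1.
have sE x : sigma omega x = 1 - (expo p D v x)%:~R / p.-1%:R.
  by rewrite (expoE hp hX Dt v0) (sigmaE hp hX homega Dt hz hv (ord_unif x)).
have pE : (p.+1%:R : rat) = p.-1%:R + 2.
  by rewrite -[in LHS](prednK (prime_gt0 p_pr)) -addn2 natrD.
have hSS x : supersingular p omega x <-> expo p D v x = -2.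
  rewrite /supersingular /= sE; split=> [e|->].
    apply: (@intr_inj rat); move/(congr1 (fun q => q * p.-1%:R)): e.
    rewrite mulrBl mul1r !divfK // pE => e.
    by apply: (addrI (- p.-1%:R)); apply: oppr_inj; rewrite opprD !opprK e; ring.
  by rewrite pE; field.
have hM x : singular p omega x <-> ~ supersingular p omega x /\ ~~ (p%:Z %| expo p D v x)%Z.
  have E : eq_mod p (sigma omega x) 1 <-> (p%:Z %| expo p D v x)%Z.
    rewrite /eq_mod sE addrAC subrr add0r dvdz_numq //; exact: prime_gt1.
  by rewrite /singular /=; split=> -[h1 h2]; split=> //; [apply/negP => /E|move/E; exact/negP].
have Mfin : finite_set (singular p omega) by apply/finite_setP; exists r.
have hS x : n_at p omega x = (vanishing p D v (singular p omega) (supersingular p omega) x)%:~R.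
  rewrite /n_at /vanishing; case: asboolP => // _; rewrite sE; case: asboolP => _.
    rewrite mulrBr mulrCA mulfV // !mulr1 !rmorphB /= -{1}[p in RHS](prednK (prime_gt0 p_pr)).
    by rewrite -addn1 PoszD rmorphD /= addrK -pmulrn.
  by rewrite addrAC subrr add0r mulrN mulrCA mulfV // mulr1 rmorphN.
exists (datum_bundle hp hp2 hX Dt v0 cartier hSS hM Mfin); split; [|split; [|split]].
- split; first by split; [exact: datum_extends|exact: datum_compatible].
  by move=> E' [h1 h2]; apply: extension_unique hS _ h1 h2.
- split; [exact: datum_active|exact: datum_nilpotent|].
  by exists (@e0_coordinate K); exact: datum_horizontal.
- by split=> //; exact: datum_supersingular.
- by move=> x; exact: datum_pcurv_order.
Qed.
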